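(* Let $D\subset\mathbb{C}$ be a bounded domain with $C^1$ boundary and suppose $u\in C^\infty(\overline{D})$ is a positive function. For $z\in D$ let $g_z$ be the Green function of the Laplacian on $D$ with pole at $z$, and define $T\phi(z)=\int_D\phi\,u\,g_z\,dA$. For $\epsilon\geq0$ and a bounded Borel function $f$ on $\partial D$, let $\phi_\epsilon$ be the solution to the Dirichlet problem $(\Delta-\epsilon u)\phi_\epsilon=0$ in $D$, $\phi_\epsilon=f$ on $\partial D$. Then $$\phi_\epsilon(z)=\phi_0(z)+\epsilon\int_D u\,\phi_0\,g_z\,dA+o(\epsilon)$$ as $\epsilon\to0$, where the error term converges uniformly in $z$. Moreover, a full series expansion is given by $\phi_\epsilon=\sum_{n=0}^\infty\epsilon^nT^n\phi_0$.
   Context: The Green function $g_z$ of the Laplacian on $D$ solves $\Delta g_z=\delta_z$ in $D$, $g_z=0$ on $\partial D$. $\phi_0$ is the solution of the Dirichlet problem for the Laplacian with boundary data $f$. $T^n$ is the $n$-fold iterate of $T$; $dA$ is area measure.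
   Formalization: The full series expansion is proved, with pointwise convergence on D, for all sufficiently small ε ≥ 0 (below some positive threshold) rather than for every ε ≥ 0, since the series diverges for large ε in general (e.g. the unit disc with u = 1, f = 1). *)

(* Defs.v *)
(* The complex plane C is modelled as R * R
   (R : realType), with Lebesgue (product) measure dA and Euclidean
   geometry made explicit where it matters. *)
From HB Require Import structures.
From mathcomp Require Import all_boot all_order all_algebra.
From mathcomp Require Import all_classical all_reals all_analysis.
Set Implicit Arguments. Unset Strict Implicit. Unset Printing Implicit Defensive.
Import Order.TTheory GRing.Theory Num.Theory.
Import numFieldNormedType.Exports.
Local Open Scope classical_set_scope.
Local Open Scope ring_scope.

Section Defs.
Variable R : realType.
Local Notation P := (R * R)%type.

Definition areaM := (@lebesgue_measure R \x @lebesgue_measure R)%E.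

Definition dirv (b : bool) : P := if b then (1, 0) else (0, 1).

Definition partial (b : bool) (f : P -> R) : P -> R :=
  fun x => 'D_(dirv b) f x.

Definition ipartial (s : seq bool) (f : P -> R) : P -> R :=
  foldr partial f s.

Definition lap (f : P -> R) : P -> R :=
  fun x => partial true (partial true f) x + partial false (partial false f) x.

Definition C2_on (D : set P) (f : P -> R) :=
  forall s : seq bool, (size s <= 2)%N ->
    forall x, D x -> {for x, continuous (ipartial s f)} /\
      ((size s < 2)%N -> forall b, derivable (ipartial s f) x (dirv b)).

Definition smooth_on_closure (D : set P) (f : P -> R) :=
  {within closure D, continuous f} /\
  forall s : seq bool,
    (forall x b, D x -> derivable (ipartial s f) x (dirv b)) /\
    exists v : P -> R, {within closure D, continuous v} /\
                       {in D, ipartial s f =1 v}.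

Definition boundary (D : set P) : set P := closure D `\` D.

Definition edist (z w : P) : R :=
  Num.sqrt ((w.1 - z.1) ^+ 2 + (w.2 - z.2) ^+ 2).

Definition C1_domain (D : set P) :=
  open D /\ connected D /\ D !=set0 /\
  (exists M : R, forall x, D x -> `|x| <= M) /\
  forall p, boundary D p ->
    exists (a b r : R) (gam : R -> R),
      [/\ a ^+ 2 + b ^+ 2 = 1, 0 < r,
          (forall t, derivable gam t 1), continuous (derive1 gam) &
          forall x : P, edist p x < r ->
            (D x <-> - b * x.1 + a * x.2 > gam (a * x.1 + b * x.2))].

(* g is the Green function of the Laplacian on D:
   Delta g_z = delta_z in D, g_z = 0 on the boundary *)
Definition green_function (D : set P) (g : P -> P -> R) :=
  forall z, D z ->
    (exists h : P -> R, C2_on D h /\ (forall w, D w -> lap h w = 0) /\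
       forall w, D w -> w != z -> g z w = ln (edist z w) / (2 * pi) + h w) /\
    (forall w, closure D w -> w != z -> {for w, {within closure D, continuous g z}}) /\
    (forall w, boundary D w -> g z w = 0).

Definition classical_dirichlet (D : set P) (u : P -> R) (eps : R)
    (h psi : P -> R) :=
  [/\ {within closure D, continuous psi}, C2_on D psi,
      (forall x, D x -> lap psi x - eps * u x * psi x = 0) &
      (forall x, boundary D x -> psi x = h x)].

(* the (Schroedinger-)harmonic measure at z for Delta - eps u on D:
   the Borel measure on the boundary representing the classical
   solution operator on continuous boundary data *)
Definition dirichlet_measure (D : set P) (u : P -> R) (eps : R) (z : P)
    (mu : {measure set P -> \bar R}) :=
  mu (~` boundary D) = 0%E /\
  forall h psi : P -> R, continuous h -> classical_dirichlet D u eps h psi ->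
    (\int[mu]_(x in boundary D) (h x)%:E)%E = (psi z)%:E.

Definition dirichlet_solution (D : set P) (u : P -> R) (eps : R)
    (f phi : P -> R) :=
  forall z, D z -> exists mu : {measure set P -> \bar R},
    dirichlet_measure D u eps z mu /\ phi z = Rintegral mu (boundary D) f.

Definition Top (D : set P) (u : P -> R) (g : P -> P -> R) (phi : P -> R) : P -> R :=
  fun z => Rintegral areaM D (fun w => phi w * u w * g z w).

End Defs.

(* Main.v *)
(* Everything follows from the identity phi_eps = phi_0 + eps T phi_eps on D:
   iterating it gives phi_eps - sum_(n < N) eps^n T^n phi_0 = eps^N T^N phi_eps,
   and T is bounded for the sup norm.

   Testing the harmonic measures mu_w for the Laplacian on ln |z - .| shows that
   the regular part of g_z at w is -(2 pi)^-1 int ln |z - x| dmu_w(x), which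
   is harmonic in the pole z.  By the maximum principle g <= 0, so g_z(w) is
   bounded by a multiple of 1/|z - w|; approximating a boundary point by points of
   an exterior cone gives g_z(w) -> 0 as z tends to the boundary.  Hence
   G f(z) = int_D f g_z dA is C^1 for bounded f, is C^2 with Laplacian f when f is
   moreover C^1, and vanishes at the boundary.  For smooth boundary data H and
   small eps, the fixed point of psi = H + G (eps u psi - lap H) is then
   a classical solution, which proves the identity for f = H.  Bounded
   limits carry it to indicators of quadrants, Dynkin's lemma to Borel sets,
   and uniform approximation to bounded Borel functions. *)

Require Import Defs.
From HB Require Import structures.
From mathcomp Require Import all_boot all_order all_algebra.
From mathcomp Require Import all_classical all_reals all_analysis.
From mathcomp Require Import measurable_realfun.
From mathcomp Require Import ring lra.
Set Implicit Arguments.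
Unset Strict Implicit.
Unset Printing Implicit Defensive.
Import Order.TTheory GRing.Theory Num.Theory.
Import numFieldNormedType.Exports.
Local Open Scope classical_set_scope.
Local Open Scope ring_scope.

(** The Green function is given pole by pole, with neither symmetry nor regularity in the pole,
    whereas [T] and its iterates need both size and regularity of [z -> g z w]. All of that is
    extracted from the formula for the regular part, where the pole enters only through a logarithm
    integrated against a measure of mass one. The measures in turn are known only through classical
    solutions with data continuous on the whole plane; this is why classical solutions have to be
    constructed for smooth data, and why truncated logarithms serve as test data. The bootstrap
    feeds the Green operator a density that is at first bounded and then C^1, so Newton potentials
    are treated at exactly these two levels, the second by moving one derivative onto the density.
    The only smallness is [eps * theta <= 1 / 2], with [theta] a bound for [T]: it is the
    contraction ratio of the fixed point and the origin of [eps0] in the theorem. *)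

Section Sequences.
Context {R : realType} {V : normedModType R}.

(** Dominated convergence speaks of sequences, continuity and derivatives of filters; this is the
    bridge. If the limit failed, points of [D] within [1/(n+1)] of [p] would keep [f] at distance at
    least some [e] from [l]. *)
Lemma cvg_within_seq (D : set V) (f : V -> R) (p : V) (l : R) :
  (forall u : nat -> V, (forall n, D (u n)) -> u @ \oo --> p ->
     f (u n) @[n --> \oo] --> l) ->
  f x @[x --> within D (nbhs p)] --> l.
Proof.
move=> H; apply: contrapT => nH.
have [e [e0 He]] : exists e : R, 0 < e /\ forall d : R, 0 < d ->
    exists x, D x /\ `|p - x| < d /\ e <= `|l - f x|.
  apply: contrapT => nE; apply: nH; apply/cvgrPdist_lt => e e0.
  move/forallNP : nE => /(_ e)/not_andP[//|/existsNP[d /not_implyP[d0 Hd]]].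
  rewrite near_withinE; apply/nbhs_ballP; exists d => // x; rewrite -ball_normE /= => px Dx.
  rewrite ltNge; apply/negP => le; apply: Hd; by exists x.
have /choice[u Hu] : forall n : nat, exists x, D x /\ `|p - x| < n.+1%:R^-1 /\ e <= `|l - f x|.
  by move=> n; apply: He; rewrite invr_gt0.
have up : u @ \oo --> p.
  apply/cvgrPdist_lt => d d0; near=> n.
  apply: (lt_trans (Hu n).2.1); near: n; exact: near_infty_natSinv_lt (PosNum d0).
have /cvgrPdist_lt/(_ _ e0) := H u (fun n => (Hu n).1) up.
case=> N _ /(_ N (leqnn _)) /=; rewrite ltNge => /negP; apply; exact: (Hu N).2.2.
Unshelve. all: by end_near. Qed.

Lemma cvg_dnbhs0 (t : nat -> R) : (forall n, t n != 0) -> t @ \oo --> (0 : R) ->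
  t @ \oo --> (0 : R)^'.
Proof.
move=> t0 tc S; rewrite /fmap/= /nbhs/= /dnbhs/= /within/= => hS.
by have [N _ hN] := tc _ hS; exists N => // n /hN /(_ (t0 n)).
Qed.

Lemma is_derive_cvg (f : V -> R) (x v : V) (d : R) :
  h^-1 * (f (x + h *: v) - f x) @[h --> 0^'] --> d -> is_derive x v f d.
Proof.
move=> H.
have H' : h^-1 *: ((f \o shift x) (h *: v) - f x) @[h --> 0^'] --> d.
  by under eq_fun do rewrite /= [_ + x]addrC.
by split; [apply/cvg_ex; exists d|exact: cvg_lim].
Qed.

Lemma cvg_is_derive (f : V -> R) (x v : V) (d : R) : is_derive x v f d ->
  h^-1 * (f (x + h *: v) - f x) @[h --> 0^'] --> d.
Proof.
case=> H <-; rewrite /derive; under eq_fun do rewrite [x + _]addrC.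
exact: H.
Qed.

End Sequences.

(** * Directional derivatives as derivatives along lines *)

Section Lines.
Context {R : realType} {V : normedModType R}.

Lemma is_derive_line (f : V -> R) (x v : V) (t d : R) :
  is_derive (x + t *: v) v f d -> is_derive t 1 (fun s : R => f (x + s *: v)) d.
Proof.
move=> /cvg_is_derive H; apply: is_derive_cvg.
under eq_fun do rewrite [_%:A]mulr1 scalerDl addrA; exact: H.
Qed.

Lemma line_is_derive (f : V -> R) (x v : V) (d : R) :
  is_derive (0:R) 1 (fun s : R => f (x + s *: v)) d -> is_derive x v f d.
Proof.
move=> /cvg_is_derive H; apply: is_derive_cvg.
by move: H; under eq_fun do rewrite add0r [_%:A]mulr1 scale0r addr0.
Qed.

Lemma is_derive_comp1 (phi : R -> R) (f : V -> R) (x v : V) (d e : R) :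
  is_derive x v f d -> is_derive (f x) 1 phi e ->
  is_derive x v (phi \o f) (e * d).
Proof.
move=> fd pe; apply: line_is_derive.
have := @is_derive_line f x v 0 d; rewrite scale0r addr0 => /(_ fd) {}fd.
apply: (@is_derive1_comp _ phi (fun s => f (x + s *: v))).
by rewrite scale0r addr0.
Qed.

Lemma line_MVT (f df : V -> R) (x v : V) (t M : R) :
  (forall s : R, `|s| <= `|t| -> is_derive (x + s *: v) v f (df (x + s *: v))) ->
  (forall s : R, `|s| <= `|t| -> `|df (x + s *: v)| <= M) ->
  `|f (x + t *: v) - f x| <= M * `|t|.
Proof.
move=> fd fM; pose g s := f (x + s *: v); pose dg s := df (x + s *: v).
have gd (s : R) : `|s| <= `|t| -> is_derive s 1 g (dg s).
  by move=> st; apply: is_derive_line; exact: fd.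
have gc (s : R) : `|s| <= `|t| -> {for s, continuous g}.
  move=> st; apply/differentiable_continuous/derivable1_diffP.
  by have [] := gd s st.
have [t0|t0] := leP 0 t.
- have [||c] := @MVT_segment R g dg 0 t t0.
  + move=> s; rewrite in_itv/= => /andP[s0 st]; apply: gd.
    by rewrite !ger0_norm// ltW.
  + apply: continuous_in_subspaceT => s; rewrite inE/= in_itv/= => /andP[s0 st].
    by apply: gc; rewrite !ger0_norm.
  rewrite in_itv/= => /andP[c0 ct]; rewrite {1 2}/g scale0r addr0 subr0 => ->.
  by rewrite normrM ler_wpM2r// fM// !ger0_norm.
- have [||c] := @MVT_segment R g dg t 0 (ltW t0).
  + move=> s; rewrite in_itv/= => /andP[s0 st]; apply: gd.
    by rewrite !ler0_norm ?lerN2 ltW.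
  + apply: continuous_in_subspaceT => s; rewrite inE/= in_itv/= => /andP[s0 st].
    by apply: gc; rewrite !ler0_norm ?lerN2// ltW.
  rewrite in_itv/= => /andP[c0 ct]; rewrite {1 2}/g scale0r addr0 sub0r => gE.
  rewrite distrC gE normrM normrN ler_wpM2r// fM// !ler0_norm ?lerN2// ltW//.
Qed.

End Lines.

(** * Functions of class C^1 and C^2 on open sets of the plane *)

Section C1C2.
Context {R : realType}.
Local Notation P := (R * R)%type.
Local Notation dirv := (@dirv R).
Implicit Types (U : set P) (f g : P -> R).

(** Continuity of [f] is recorded alongside that of the partials, so that derivatives along the two
    axes are the only ones ever handled. *)
Record C1 U f : Prop := mkC1 { C1P : forall x, U x -> {for x, continuous f} /\
  forall b, derivable f x (dirv b) /\ {for x, continuous (partial b f)} }.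

Record C2 U f : Prop := mkC2 { C2_C1 : C1 U f ; C2_p : forall b, C1 U (partial b f) }.

Lemma C1_derive U f x b : C1 U f -> U x -> is_derive x (dirv b) f (partial b f x).
Proof. by move=> cf Ux; have [_ /(_ b)[df _]] := C1P cf Ux; split. Qed.

Lemma C1_cont U f x : C1 U f -> U x -> {for x, continuous f}.
Proof. by move=> cf /(C1P cf)[]. Qed.

Lemma C1_pcont U f b x : C1 U f -> U x -> {for x, continuous (partial b f)}.
Proof. by move=> cf /(C1P cf)[_ /(_ b)[]]. Qed.

Arguments C1_derive {U f x} b _ _.
Arguments C1_pcont {U f} b {x} _ _.

Lemma C1S U U' f : U `<=` U' -> C1 U' f -> C1 U f.
Proof. by move=> UU' cf; split=> x /UU'/(C1P cf). Qed.

Lemma C2S U U' f : U `<=` U' -> C2 U' f -> C2 U f.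
Proof. by move=> UU' [c1 c2]; split => [|b]; [exact: (C1S UU' c1)|exact: (C1S UU' (c2 b))]. Qed.

Lemma open_near U x : open U -> U x -> \forall y \near x, U y.
Proof. by move=> oU Ux; apply: open_nbhs_nbhs; split. Qed.

Lemma for_cont_ext U f g x : open U -> U x -> (forall y, U y -> f y = g y) ->
  {for x, continuous f} -> {for x, continuous g}.
Proof.
move=> oU Ux fg; rewrite /prop_for /continuous_at -(fg x Ux).
apply: cvg_trans; apply: near_eq_cvg; near=> y; apply: fg.
by near: y; exact: open_near.
Unshelve. all: by end_near. Qed.

Lemma is_derive_ext U f g (x v : P) d : open U -> U x ->
  (forall y, U y -> f y = g y) -> is_derive x v f d -> is_derive x v g d.
Proof.
move=> oU Ux fg; apply: near_eq_is_derive; near=> y; apply: fg.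
by near: y; exact: open_near.
Unshelve. all: by end_near. Qed.

Lemma partial_ext U f g b x : open U -> U x -> (forall y, U y -> f y = g y) ->
  partial b f x = partial b g x.
Proof.
move=> oU Ux fg; apply: near_eq_derive; near=> y; apply: fg.
by near: y; exact: open_near.
Unshelve. all: by end_near. Qed.

(** Each closure property below exhibits the partials as an explicit continuous family. The formula
    is returned together with the class, so that second derivatives come from a second
    application. *)
Lemma C1_intro U f (df : bool -> P -> R) : open U ->
  (forall x, U x -> {for x, continuous f}) ->
  (forall x b, U x -> {for x, continuous (df b)}) ->
  (forall x b, U x -> is_derive x (dirv b) f (df b x)) ->
  C1 U f /\ (forall x b, U x -> partial b f x = df b x).
Proof.
move=> oU cf cdf fd.
have E x b : U x -> partial b f x = df b x by move=> /fd - /(_ b)[].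
split; last exact: E.
split => x Ux; split; first exact: cf.
move=> b; split; first by have [] := fd x b Ux.
apply: (@for_cont_ext U (df b)) => //; last exact: cdf.
by move=> y Uy; rewrite E.
Qed.

Lemma C1_ext U f g : open U -> (forall y, U y -> f y = g y) -> C1 U f -> C1 U g.
Proof.
move=> oU fg cf; apply: (proj1 (@C1_intro U g (fun b => partial b f) oU _ _ _)).
- move=> x Ux. apply: (for_cont_ext oU Ux fg); exact: (C1_cont cf Ux).
- by move=> x b Ux; exact: (C1_pcont b cf Ux).
- by move=> x b Ux; apply: (is_derive_ext oU Ux fg); exact: (C1_derive b cf Ux).
Qed.

Lemma C2_ext U f g : open U -> (forall y, U y -> f y = g y) -> C2 U f -> C2 U g.
Proof.
move=> oU fg [cf ccf]; split => [|b]; first exact: C1_ext cf.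
apply: (C1_ext oU _ (ccf b)) => y Uy; exact: (partial_ext b oU Uy fg).
Qed.

Lemma lap_ext U f g x : open U -> U x -> (forall y, U y -> f y = g y) ->
  lap f x = lap g x.
Proof.
move=> oU Ux fg.
have H b : partial b (partial b f) x = partial b (partial b g) x.
  by apply: (partial_ext b oU Ux) => y Uy; exact: (partial_ext b oU Uy fg).
by rewrite /lap (H true) (H false).
Qed.

Lemma C1_local U f : (forall x, U x -> exists V, V x /\ C1 V f) -> C1 U f.
Proof. by move=> H; split => x /H[V [Vx cf]]; exact: (C1P cf Vx). Qed.

Lemma C2_local U f : (forall x, U x -> exists V, V x /\ C2 V f) -> C2 U f.
Proof.
move=> H; split => [|b]; apply: C1_local => x /H[V [Vx [c1 c2]]]; exists V.
  by split.
by split; [|exact: (c2 b)].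
Qed.

Lemma C2_on_C2 U f : C2_on U f -> C2 U f.
Proof.
move=> H; split => [|b]; split => x Ux; split => [|b'].
- by have [] := H [::] isT x Ux.
- have [_ /(_ isT b') h1] := H [::] isT x Ux.
  by have [h2 _] := H [:: b'] isT x Ux.
- by have [] := H [:: b] isT x Ux.
- have [_ /(_ isT b') h1] := H [:: b] isT x Ux.
  by have [h2 _] := H [:: b'; b] isT x Ux.
Qed.

Lemma C2_C2_on U f : C2 U f -> C2_on U f.
Proof.
move=> [c1 c2] [|b [|b' [|//]]] _ x Ux; split => //=.
- exact: (C1_cont c1).
- by move=> _ b; have [_ /(_ b)[]] := C1P c1 Ux.
- exact: (C1_pcont b c1 Ux).
- by move=> _ b'; have [_ /(_ b')[]] := C1P (c2 b) Ux.
- exact: (C1_pcont b (c2 b') Ux).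
Qed.

Opaque partial.

Lemma C1_cst U (c : R) : open U -> C1 U (fun=> c) /\ (forall x b, U x -> partial b (fun=> c) x = 0).
Proof.
move=> oU; apply: (@C1_intro U _ (fun _ _ => 0) oU).
- by move=> x _; exact: cvg_cst.
- by move=> x b _; exact: cvg_cst.
Qed.

Lemma C1D U f g : open U -> C1 U f -> C1 U g -> C1 U (fun x => f x + g x) /\
  (forall x b, U x -> partial b (fun x => f x + g x) x = partial b f x + partial b g x).
Proof.
move=> oU cf cg.
apply: (@C1_intro U _ (fun b x => partial b f x + partial b g x) oU).
- by move=> x Ux; apply: cvgD; [exact: (C1_cont cf Ux)|exact: (C1_cont cg Ux)].
- by move=> x b Ux; apply: cvgD; [exact: (C1_pcont b cf Ux)|exact: (C1_pcont b cg Ux)].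
- by move=> x b Ux; apply: is_deriveD; [exact: (C1_derive b cf Ux)|exact: (C1_derive b cg Ux)].
Qed.

Lemma C1M U f g : open U -> C1 U f -> C1 U g -> C1 U (fun x => f x * g x) /\
  (forall x b, U x -> partial b (fun x => f x * g x) x =
                      f x * partial b g x + g x * partial b f x).
Proof.
move=> oU cf cg.
apply: (@C1_intro U _ (fun b x => f x * partial b g x + g x * partial b f x) oU).
- by move=> x Ux; apply: cvgM; [exact: (C1_cont cf Ux)|exact: (C1_cont cg Ux)].
- move=> x b Ux; apply: cvgD; apply: cvgM.
  + exact: (C1_cont cf Ux).
  + exact: (C1_pcont b cg Ux).
  + exact: (C1_cont cg Ux).
  + exact: (C1_pcont b cf Ux).
- by move=> x b Ux; apply: is_deriveM; [exact: (C1_derive b cf Ux)|exact: (C1_derive b cg Ux)].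
Qed.

Lemma C1Z U f (c : R) : open U -> C1 U f -> C1 U (fun x => c * f x) /\
  (forall x b, U x -> partial b (fun x => c * f x) x = c * partial b f x).
Proof.
move=> oU cf; have [c0 p0] := C1_cst c oU; have [c1 c2] := C1M oU c0 cf.
by split; [exact: c1|move=> x b Ux; rewrite c2// p0// mulr0 addr0].
Qed.

Lemma C1_comp U f (phi dphi : R -> R) : open U -> C1 U f ->
  (forall x, U x -> is_derive (f x) 1 phi (dphi (f x))) ->
  (forall x, U x -> {for f x, continuous dphi}) ->
  C1 U (fun x => phi (f x)) /\
  (forall x b, U x -> partial b (fun x => phi (f x)) x = dphi (f x) * partial b f x).
Proof.
move=> oU cf dp cdp.
apply: (@C1_intro U _ (fun b x => dphi (f x) * partial b f x) oU).
- move=> x Ux; apply: (@continuous_comp _ _ _ f phi); first exact: (C1_cont cf Ux).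
  by apply/differentiable_continuous/derivable1_diffP; have [] := dp x Ux.
- move=> x b Ux; apply: cvgM; last exact: (C1_pcont b cf Ux).
  by apply: (@continuous_comp _ _ _ f dphi); [exact: (C1_cont cf Ux)|exact: cdp].
- by move=> x b Ux; apply: is_derive_comp1; [exact: (C1_derive b cf Ux)|exact: dp].
Qed.

Lemma C2D U f g : open U -> C2 U f -> C2 U g -> C2 U (fun x => f x + g x) /\
  (forall x, U x -> lap (fun x => f x + g x) x = lap f x + lap g x).
Proof.
move=> oU [cf ccf] [cg ccg]; have [c1 p1] := C1D oU cf cg.
split.
  split; [exact: c1|move=> b]; apply: (C1_ext oU _ (proj1 (C1D oU (ccf b) (ccg b)))).
  by move=> y Uy; rewrite p1.
move=> x Ux; rewrite /lap.
have H b : partial b (partial b (fun x => f x + g x)) x =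
   partial b (partial b f) x + partial b (partial b g) x.
  rewrite -(proj2 (C1D oU (ccf b) (ccg b)))//.
  by apply: (partial_ext b oU Ux) => y Uy; rewrite p1.
rewrite (H true).
rewrite (H false).
exact: (addrACA (partial true (partial true f) x) _ _ _).
Qed.

Lemma C2Z U f (c : R) : open U -> C2 U f -> C2 U (fun x => c * f x) /\
  (forall x, U x -> lap (fun x => c * f x) x = c * lap f x).
Proof.
move=> oU [cf ccf]; have [c1 p1] := C1Z c oU cf.
split.
  split; [exact: c1|move=> b]; apply: (C1_ext oU _ (proj1 (C1Z c oU (ccf b)))).
  by move=> y Uy; rewrite p1.
move=> x Ux; rewrite /lap.
have H b : partial b (partial b (fun x => c * f x)) x = c * partial b (partial b f) x.
  rewrite -(proj2 (C1Z c oU (ccf b)))//.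
  by apply: (partial_ext b oU Ux) => y Uy; rewrite p1.
by rewrite (H true) (H false) mulrDr.
Qed.

Lemma C2M U f g : open U -> C2 U f -> C2 U g -> C2 U (fun x => f x * g x).
Proof.
move=> oU [cf ccf] [cg ccg]; have [c1 p1] := C1M oU cf cg.
split; [exact: c1|move=> b].
apply: (C1_ext oU _ (proj1 (C1D oU (proj1 (C1M oU cf (ccg b))) (proj1 (C1M oU cg (ccf b)))))).
by move=> y Uy; rewrite p1.
Qed.

Lemma C2_cst U (c : R) : open U -> C2 U (fun=> c) /\ (forall x, U x -> lap (fun=> c) x = 0).
Proof.
move=> oU; have [c1 p1] := C1_cst c oU; have [c0 p0] := C1_cst 0 oU; split.
  by split; [exact: c1|move=> b]; apply: (C1_ext oU _ c0) => y Uy; rewrite p1.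
move=> x Ux; have H b : partial b (partial b (fun=> c)) x = 0.
  by rewrite -(p0 x b Ux); apply: (partial_ext b oU Ux) => y Uy; rewrite p1.
by rewrite /lap (H true) (H false) addr0.
Qed.

Definition co (b : bool) (x : P) : R := if b then x.1 else x.2.

Lemma co_cont b (x : P) : {for x, continuous (co b)}.
Proof. by case: b; [exact: cvg_fst|exact: cvg_snd]. Qed.

Lemma co_derive b b' (x : P) : is_derive x (dirv b') (co b) (b == b')%:R.
Proof.
apply: is_derive_cvg.
have E : \forall h \near 0^', (b == b')%:R = h^-1 * (co b (x + h *: dirv b') - co b x) :> R.
  near=> h; have h0 : h != 0 by near: h; exact: nbhs_dnbhs_neq.
  by case: b; case: b'; rewrite /=/dirv/= ?scaler0 ?addr0 ?subrr ?mulr0// addrC addKr [_%:A]mulr1 mulVf.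
by apply: cvg_trans (near_eq_cvg E) _; exact: cvg_cst.
Unshelve. all: by end_near. Qed.

Lemma C1_co U b : open U -> C1 U (co b) /\ (forall x b', U x -> partial b' (co b) x = (b == b')%:R).
Proof.
move=> oU; apply: (@C1_intro U _ (fun b' _ => (b == b')%:R) oU).
- by move=> x _; exact: co_cont.
- by move=> x b' _; exact: cvg_cst.
- by move=> x b' _; exact: co_derive.
Qed.

End C1C2.
Arguments C1_derive {R U f x} b _ _.
Arguments C1_pcont {R U f} b {x} _ _.

(** * The logarithmic kernel: size and Lipschitz bounds *)

Section LogKernel.
Context {R : realType}.
Local Notation P := (R * R)%type.
Local Notation dirv := (@dirv R).
Implicit Types (U : set P) (z y : P).

(* [`|z - y|] is the sup norm of the plane; [sq] is the squared Euclidean distance,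
   so that [L z y] is ln |z - y|, with the junk value [L z z = 0]. *)
Definition sq z y : R := (z.1 - y.1) ^+ 2 + (z.2 - y.2) ^+ 2.
Definition L z y : R := ln (sq z y) / 2.
(** [L_C2] proves that these closed forms are the derivatives of [L] in its first argument off the
    diagonal. On the diagonal both are 0, because division by 0 yields 0. *)
Definition dL b z y : R := (co b z - co b y) / sq z y.
Definition ddL b b' z y : R := (b == b')%:R / sq z y
  - 2 * (co b z - co b y) * (co b' z - co b' y) / sq z y ^+ 2.

Lemma prodnE (x : P) : `|x| = Num.max `|x.1| `|x.2|. Proof. by []. Qed.

(** The logarithm needs the Euclidean distance while the norm of the plane is the sup norm; this
    bound and the next compare the two squares up to a factor 2. *)
Lemma sq_ge z y : `|z - y| ^+ 2 <= sq z y.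
Proof.
rewrite prodnE /sq maxEle; case: ifP => _; rewrite real_normK ?num_real//=.
  by rewrite lerDr sqr_ge0.
by rewrite lerDl sqr_ge0.
Qed.

Lemma sq_le z y : sq z y <= 2 * `|z - y| ^+ 2.
Proof.
rewrite /sq.
have H (a : R) : `|a| <= `|z - y| -> a ^+ 2 <= `|z - y| ^+ 2.
  by move=> h; rewrite -(real_normK (num_real a)) lerXn2r ?nnegrE.
have := H (z.1 - y.1); have := H (z.2 - y.2); rewrite prodnE !le_max !lexx orbT /=.
by move=> /(_ isT) ? /(_ isT) ?; lra.
Qed.

Lemma sqC z y : sq z y = sq y z. Proof. by rewrite /sq; ring. Qed.

Lemma LC z y : L z y = L y z. Proof. by rewrite /L sqC. Qed.

Lemma sq_gt0 z y : z != y -> 0 < sq z y.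
Proof.
move=> zy; apply: lt_le_trans (sq_ge z y).
by rewrite exprn_gt0// normr_gt0 subr_eq0.
Qed.

Lemma ln_edist z y : ln (Defs.edist z y) = L z y.
Proof.
rewrite /L /Defs.edist sqC -/(sq y z); have := sq_ge y z.
case: (eqVneq y z) => [->|/sq_gt0 h _].
  by rewrite /sq !subrr expr0n /= addr0 sqrtr0 (@ln0 _ 0)// mul0r.
have s0 : 0 < Num.sqrt (sq y z) by rewrite sqrtr_gt0.
by rewrite -{2}(sqr_sqrtr (ltW h)) lnXn// mulr2n; lra.
Qed.

Lemma co_norm b z y : `|co b z - co b y| <= `|z - y|.
Proof. by rewrite prodnE le_max; case: b; rewrite /= lexx ?orbT. Qed.

Lemma dL_bound b z y : z != y -> `|dL b z y| <= `|z - y|^-1.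
Proof.
move=> zy; have n0 : 0 < `|z - y| by rewrite normr_gt0 subr_eq0.
rewrite /dL normrM normfV (gtr0_norm (sq_gt0 zy)) ler_pdivrMr ?sq_gt0//.
apply: (le_trans (co_norm b z y)).
by rewrite -ler_pdivrMl ?invr_gt0// invrK -expr2 sq_ge.
Qed.

Lemma ddL_bound b b' z y : z != y -> `|ddL b b' z y| <= 3 / `|z - y| ^+ 2.
Proof.
move=> zy; have n0 : 0 < `|z - y| by rewrite normr_gt0 subr_eq0.
have s0 := sq_gt0 zy; have n20 : 0 < `|z - y| ^+ 2 by rewrite exprn_gt0.
have h1 : (sq z y)^-1 <= (`|z - y| ^+ 2)^-1 by rewrite lef_pV2// sq_ge.
rewrite /ddL; apply: (le_trans (ler_normB _ _)).
have -> : 3 / `|z - y| ^+ 2 = 1 * (`|z - y| ^+ 2)^-1 + 2 * (`|z - y| ^+ 2)^-1 by ring.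
apply: lerD.
  rewrite normrM normfV (gtr0_norm s0); apply: ler_pM; rewrite ?invr_ge0// ?(ltW s0)//.
  by rewrite normr_nat; case: (b == b').
rewrite normrM normfV (gtr0_norm (exprn_gt0 2 s0)) normrM normrM gtr0_norm//.
rewrite -!mulrA ler_pM2l//; rewrite expr2 invfM.
have h2 b0 : `|co b0 z - co b0 y| * (sq z y)^-1 <= `|z - y|^-1.
  by have := dL_bound b0 zy; rewrite /dL normrM normfV (gtr0_norm s0).
rewrite (_ : _ * _ = (`|co b z - co b y| * (sq z y)^-1) * (`|co b' z - co b' y| * (sq z y)^-1)); last by ring.
by rewrite expr2 invfM; apply: ler_pM => //; rewrite mulr_ge0// invr_ge0 ltW.
Qed.

(** Put [n] for the norm. By [sq_le], twice the left side is at most [ln 2 + 2 ln n], and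
    [ln 2 <= 1], [ln n <= n - 1]. *)
Lemma L_ub z y : z != y -> L z y <= `|z - y|.
Proof.
move=> zy; have n0 : 0 < `|z - y| by rewrite normr_gt0 subr_eq0.
have s0 := sq_gt0 zy; have n20 : 0 < `|z - y| ^+ 2 by rewrite exprn_gt0.
have : ln (sq z y) <= ln (2 * `|z - y| ^+ 2) by rewrite ler_ln ?posrE ?mulr_gt0// sq_le.
rewrite lnM ?posrE// lnXn// mulr2n => h.
have := @le_ln1Dx R 1 ltac:(lra); rewrite (_ : 1 + 1 = 2 :> R); last by ring.
have := @le_ln1Dx R (`|z - y| - 1) ltac:(lra); rewrite addrCA subrr addr0.
by rewrite /L; lra.
Qed.

Lemma L_bound z y : z != y -> `|L z y| <= `|z - y| + `|z - y|^-1.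
Proof.
move=> zy; have n0 : 0 < `|z - y| by rewrite normr_gt0 subr_eq0.
have s0 := sq_gt0 zy; have n20 : 0 < `|z - y| ^+ 2 by rewrite exprn_gt0.
have ni : 0 < `|z - y|^-1 by rewrite invr_gt0.
rewrite ler_norml; apply/andP; split.
- have : ln (`|z - y| ^+ 2) <= ln (sq z y) by rewrite ler_ln ?posrE// sq_ge.
  rewrite lnXn// -(opprK (ln `|_|)) -lnV ?posrE// mulr2n => h.
  have := ln_sublinear ni; rewrite /L; lra.
- by have := L_ub zy; lra.
Qed.

(** The mean value theorem breaks down when [y] lies on the segment from [z] to [z']. With [a], [b]
    the Euclidean distances to [y], one uses [ln (a / b) <= (a - b) / b] instead, where [a - b] is
    at most [2 * d] and [b] at least the sup distance. The bound dominates difference quotients of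
    [L] across the singularity. *)
Lemma L_lip z z' y : z != y -> z' != y ->
  L z y - L z' y <= 2 * `|z - z'| / `|z' - y|.
Proof.
move=> zy zy'; set n := `|z - y|; set n' := `|z' - y|; set d := `|z - z'|.
have n0 : 0 < n by rewrite normr_gt0 subr_eq0.
have n'0 : 0 < n' by rewrite normr_gt0 subr_eq0.
have A0 := sq_gt0 zy; have B0 := sq_gt0 zy'.
pose a := Num.sqrt (sq z y); pose b := Num.sqrt (sq z' y).
have a0 : 0 < a by rewrite sqrtr_gt0. have b0 : 0 < b by rewrite sqrtr_gt0.
have aE : a ^+ 2 = sq z y by rewrite sqr_sqrtr// ltW.
have bE : b ^+ 2 = sq z' y by rewrite sqr_sqrtr// ltW.
have na : n <= a by rewrite -ler_sqr ?nnegrE ?(ltW n0) ?(ltW a0)// aE; exact: sq_ge.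
have nb : n' <= b by rewrite -ler_sqr ?nnegrE ?(ltW n'0) ?(ltW b0)// bE; exact: sq_ge.
have d0 : 0 <= d by exact: normr_ge0.
have ab : a ^+ 2 - b ^+ 2 <= 2 * d * (n + n').
  rewrite aE bE /sq.
  have H c : (co c z - co c y) ^+ 2 - (co c z' - co c y) ^+ 2 <= d * (n + n').
    rewrite subr_sqr; apply: (le_trans (ler_norm _)); rewrite normrM.
    apply: ler_pM => //.
      by rewrite (_ : _ - _ = co c z - co c z'); [exact: co_norm|ring].
    by apply: (le_trans (ler_normD _ _)); apply: lerD; exact: co_norm.
  by have := H true; have := H false; rewrite /=; lra.
have ab' : a - b <= 2 * d.
  have : (a - b) * (a + b) <= 2 * d * (a + b).
    rewrite -subr_sqr; apply: (le_trans ab); rewrite ler_wpM2l ?mulr_ge0//; lra.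
  by rewrite ler_pM2r// addr_gt0.
have LE w : 0 < Num.sqrt (sq w y) -> L w y = ln (Num.sqrt (sq w y)).
  rewrite sqrtr_gt0 => h; rewrite /L -{1}(sqr_sqrtr (ltW h)) lnXn ?sqrtr_gt0// mulr2n; lra.
rewrite !LE// -/a -/b -ln_div ?posrE//.
have := @le_ln1Dx R (a / b - 1); rewrite addrCA subrr addr0.
have ab0 : 0 < a / b by rewrite divr_gt0.
move=> /(_ ltac:(lra)) h; apply: (le_trans h).
rewrite -[X in _ - X](divff (lt0r_neq0 b0)) -mulrBl.
apply: (@le_trans _ _ (2 * d / b)); first by rewrite ler_wpM2r// invr_ge0 ltW.
by rewrite ler_wpM2l ?mulr_ge0// lef_pV2.
Qed.

Lemma L_lip2 z z' y : z != y -> z' != y ->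
  `|L z y - L z' y| <= 2 * `|z - z'| * (`|z - y|^-1 + `|z' - y|^-1).
Proof.
move=> zy zy'; have h1 := L_lip zy zy'; have h2 := L_lip zy' zy.
rewrite (distrC z' z) in h2.
have : 0 <= 2 * `|z - z'| / `|z - y| by rewrite divr_ge0// mulr_ge0.
have : 0 <= 2 * `|z - z'| / `|z' - y| by rewrite divr_ge0// mulr_ge0.
by rewrite ler_norml mulrDr; lra.
Qed.

End LogKernel.

(** * Smoothness and harmonicity of the logarithm off its pole *)

Section LogKernelC2.
Context {R : realType}.
Local Notation P := (R * R)%type.
Local Notation dirv := (@dirv R).
Implicit Types (U : set P) (z y : P).

Lemma is_derive1_inv (x : R) : x != 0 -> is_derive x 1 (@GRing.inv R) (- x ^- 2).
Proof.
move=> x0; have h : derivable (id : R -> R) x 1 by exact: derivable_id.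
split; first exact: (@derivableV _ _ id).
by rewrite (@deriveV _ _ id)// derive_id scaler1.
Qed.

Lemma cont_inv2 (x : R) : x != 0 -> {for x, continuous (fun x : R => - x ^- 2)}.
Proof.
by move=> x0; apply: cvgN; apply: cvgV; [rewrite expf_neq0|exact: exprn_continuous].
Qed.

Lemma C1_V U (f : P -> R) : open U -> C1 U f -> (forall x, U x -> f x != 0) ->
  C1 U (fun x => (f x)^-1) /\
  (forall x b, U x -> partial b (fun x => (f x)^-1) x = - (f x) ^- 2 * partial b f x).
Proof.
move=> oU cf f0; apply: (@C1_comp R U f GRing.inv (fun x => - x ^- 2) oU cf).
- by move=> x Ux; apply: is_derive1_inv; exact: f0.
- by move=> x Ux; apply: cont_inv2; exact: f0.
Qed.

Let cb y b z : R := co b z + - co b y.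

Let C1_cb U y b : open U -> C1 U (cb y b) /\
  (forall x b', U x -> partial b' (cb y b) x = (b == b')%:R).
Proof.
move=> oU; have [c1 p1] := C1_co b oU; have [c2 p2] := C1_cst (- co b y) oU.
have [c3 p3] := C1D oU c1 c2; split; first exact: c3.
by move=> x b' Ux; rewrite p3// p1// p2// addr0.
Qed.

Let sqE y : sq^~ y = fun z => cb y true z * cb y true z + cb y false z * cb y false z.
Proof. by apply/funext => z. Qed.

Lemma C1_sq U y : open U -> C1 U (sq^~ y) /\
  (forall x b, U x -> partial b (sq^~ y) x = 2 * (co b x - co b y)).
Proof.
move=> oU; rewrite sqE.
have [c1 p1] := C1_cb y true oU; have [c2 p2] := C1_cb y false oU.
have [c3 p3] := C1M oU c1 c1; have [c4 p4] := C1M oU c2 c2.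
have [c5 p5] := C1D oU c3 c4; split; first exact: c5.
move=> x b Ux; rewrite p5// p3// p4// p1// p2//; rewrite /cb.
by case: b => /=; ring.
Qed.

Lemma L_C2 U y : open U -> (forall z, U z -> z != y) ->
  [/\ C2 U (L^~ y), forall z b, U z -> partial b (L^~ y) z = dL b z y,
    forall z b b', U z -> partial b' (partial b (L^~ y)) z = ddL b b' z y &
    forall z, U z -> lap (L^~ y) z = 0].
Proof.
move=> oU Uy; have [c1 p1] := C1_sq y oU.
have s0 z : U z -> sq z y != 0 by move=> /Uy h; rewrite gt_eqF// sq_gt0.
have [c2 p2] : C1 U (fun z => ln (sq z y)) /\ (forall x b, U x ->
    partial b (fun z => ln (sq z y)) x = (sq x y)^-1 * partial b (sq^~ y) x).
  apply: (@C1_comp R U (sq^~ y) (@ln R) GRing.inv oU c1).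
    by move=> x Ux; apply: is_derive1_ln; apply: sq_gt0; exact: Uy.
  by move=> x Ux; apply: cvgV; [exact: s0|exact: cvg_id].
have [c3 p3] := C1Z 2^-1 oU c2.
have LE z : 2^-1 * ln (sq z y) = L z y by rewrite mulrC.
have c4 : C1 U (L^~ y) by apply: (C1_ext oU _ c3) => z _; rewrite LE.
have p4 z b : U z -> partial b (L^~ y) z = dL b z y.
  move=> Uz; rewrite -(@partial_ext R U (fun z => 2^-1 * ln (sq z y)))//.
  by rewrite p3// p2// p1// /dL; field; exact: s0.
have [c5 p5] := C1_V oU c1 s0.
have C b : C1 U (dL b ^~ y) /\ forall z b', U z -> partial b' (dL b ^~ y) z = ddL b b' z y.
  have [c6 p6] := C1_cb y b oU; have [c7 p7] := C1M oU c6 c5.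
  split; first exact: c7.
  move=> z b' Uz; rewrite [LHS]p7// p5// p6// p1// /ddL /cb.
  by case: (b == b') => /=; field; exact: s0.
have p8 z b b' : U z -> partial b' (partial b (L^~ y)) z = ddL b b' z y.
  move=> Uz; rewrite -(proj2 (C b))//; apply: (partial_ext b' oU Uz).
  by move=> t Ut; exact: p4.
split => //.
- split; first exact: c4.
  by move=> b; apply: (C1_ext oU _ (proj1 (C b))) => z Uz; rewrite p4.
- move=> z Uz; rewrite /lap (p8 z true true)// (p8 z false false)// /ddL /=.
  by have := s0 z Uz; rewrite /sq => h; field.
Qed.

End LogKernelC2.

(** * Borel sets of the plane *)

Section PlaneMeasurability.
Context {R : realType}.
Local Notation P := (R * R)%type.
Implicit Types (U : set P).

Lemma ball_prodE (x : P) (r : R) : ball x r = ball x.1 r `*` ball x.2 r.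
Proof. by apply/seteqP; split => y [a b]; split. Qed.

Lemma ball_normP (x y : P) (r : R) : ball x r y <-> `|x - y| < r.
Proof. by rewrite -ball_normE. Qed.

Lemma measurable_ballP (x : P) (r : R) : measurable (ball x r).
Proof. by rewrite ball_prodE; apply: measurableX; rewrite ball_itv; exact: measurable_itv. Qed.

(** The sigma-algebra is the product one, so an open set is written as the countable union of the
    squares with rational centre and radius that it contains. *)
Lemma open_measurableP U : open U -> measurable U.
Proof.
move=> oU.
pose A (q1 q2 r : rat) : set P :=
  if pselect (ball ((ratr q1, ratr q2) : P) (ratr r : R) `<=` U)
  then ball ((ratr q1, ratr q2) : P) (ratr r : R) else set0.
have -> : U = \bigcup_q1 \bigcup_q2 \bigcup_r A q1 q2 r.
  apply/seteqP; split => [x Ux|x [q1 _ [q2 _ [r _]]]]; last first.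
    by rewrite /A; case: pselect => // h /h.
  have /nbhs_ballP[e /= e0 xU] := oU x Ux.
  have e20 : 0 < e / 2 by rewrite divr_gt0.
  (* Radius between [e/4] and [e/2], centre within [e/4] of [x]: the square contains [x], and its
     points are within [e/4 + e/2 < e] of [x]. *)
  have [r] := @rat_in_itvoo R (e / 4) (e / 2) ltac:(lra).
  rewrite in_itv/= => /andP[r1 r2].
  have [q1] := @rat_in_itvoo R (x.1 - e / 4) (x.1 + e / 4) ltac:(lra).
  rewrite in_itv/= => /andP[a1 a2].
  have [q2] := @rat_in_itvoo R (x.2 - e / 4) (x.2 + e / 4) ltac:(lra).
  rewrite in_itv/= => /andP[b1 b2].
  exists q1 => //; exists q2 => //; exists r => //.
  have nq : `|((ratr q1, ratr q2) : P) - x| < e / 4.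
    by rewrite prodnE/= gt_max !ltr_norml; apply/andP; split; apply/andP; split; lra.
  rewrite /A; case: pselect => [h|[]]; first by apply/ball_normP; lra.
  move=> y /ball_normP qy; apply: xU; apply/ball_normP.
  rewrite (_ : x - y = - ((ratr q1, ratr q2) - x) + ((ratr q1, ratr q2) - y)); last first.
    by rewrite opprB addrA subrK.
  by apply: (le_lt_trans (ler_normD _ _)); rewrite normrN; lra.
apply: bigcupT_measurable_rat => q1; apply: bigcupT_measurable_rat => q2; apply: bigcupT_measurable_rat => r.
by rewrite /A; case: pselect => ?; [exact: measurable_ballP|exact: measurable0].
Qed.

Lemma closed_measurableP U : closed U -> measurable U.
Proof. by move=> cU; rewrite -[U]setCK; apply: measurableC; apply: open_measurableP; exact: closed_openC. Qed.

Lemma cont_measurable U (f : P -> R) : open U -> (forall x, U x -> {for x, continuous f}) ->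
  measurable_fun U f.
Proof.
move=> oU cf; apply: (measurability _ (measurable_realfun.RGenOpens.measurableE R)).
move=> _ [_ [a [b ->] <-]]; apply: open_measurableP.
rewrite openE => x [Ux fx]; rewrite /interior; near=> y; split.
  by near: y; exact: open_near.
near: y; apply: (cf x Ux); apply: open_nbhs_nbhs; split => //; exact: interval_open.
Unshelve. all: by end_near. Qed.

Lemma contT_measurable U (f : P -> R) : (forall x, {for x, continuous f}) ->
  measurable_fun U f.
Proof.
move=> cf; apply: (@measurable_funS _ _ _ _ setT) => //.
by apply: cont_measurable => //; exact: openT.
Qed.

End PlaneMeasurability.

(** * Dominated convergence and integrability for real-valued integrals *)

Section Dominated.
Context d (T : measurableType d) {R : realType}.
Variable mu : {measure set T -> \bar R}.

Lemma Rdct (Y : set T) (k : nat -> T -> R) (l g : T -> R) : measurable Y ->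
  (forall n, measurable_fun Y (k n)) ->
  (forall y, Y y -> k n y @[n --> \oo] --> l y) ->
  mu.-integrable Y (EFin \o g) ->
  (forall n y, Y y -> `|k n y| <= g y) ->
  mu.-integrable Y (EFin \o l) /\
  (\int[mu]_(y in Y) k n y) @[n --> \oo] --> \int[mu]_(y in Y) l y.
Proof.
move=> mY mk kl ig kg.
have ml : measurable_fun Y l.
  by apply: (@measurable_fun_cvg _ _ _ Y k l).
have [|||||il _ cv] := @dominated_convergence _ _ _ mu Y mY (fun n => EFin \o k n)
  (EFin \o l) (EFin \o g).
- by move=> n; apply/measurable_EFinP.
- by apply/measurable_EFinP.
- by apply: aeW => y Yy; apply: cvg_EFin; [exact: nearW|exact: kl].
- by [].
- by apply: aeW => y Yy n; rewrite /= lee_fin kg.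
split => //.
apply: fine_cvg => /=; rewrite fineK; last exact: (integrable_fin_num _ il).
exact: cv.
Qed.

Lemma Rbounded_integrable (Y : set T) (k : T -> R) (M : R) : measurable Y ->
  (mu Y < +oo)%E -> measurable_fun Y k -> (forall y, Y y -> `|k y| <= M) ->
  mu.-integrable Y (EFin \o k).
Proof.
move=> mY Yoo mk kM; apply: measurable_bounded_integrable => //.
exists M; split; first exact: num_real.
by move=> x Mx y Yy /=; apply: (le_trans (kM y Yy)); exact: ltW.
Qed.

Lemma Rbounded_le (Y : set T) (k : T -> R) (M : R) : measurable Y ->
  (mu Y < +oo)%E -> measurable_fun Y k -> (forall y, Y y -> `|k y| <= M) ->
  `|\int[mu]_(y in Y) k y| <= M * fine (mu Y).
Proof.
move=> mY Yoo mk kM; rewrite -Rintegral_cst//.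
have ik := Rbounded_integrable mY Yoo mk kM.
apply: (le_trans (le_normr_Rintegral mY ik)); apply: le_Rintegral => //.
  exact: (integrable_norm ik).
apply: (@Rbounded_integrable _ _ `|M|) => //.
Qed.

Lemma RintegrableD (Y : set T) (f g : T -> R) : measurable Y ->
  mu.-integrable Y (EFin \o f) -> mu.-integrable Y (EFin \o g) ->
  mu.-integrable Y (EFin \o (fun y => f y + g y)).
Proof.
move=> mY i1 i2; have := integrableD mY i1 i2.
by apply: eq_integrable => // y _; rewrite /= -EFinD.
Qed.

Lemma RintegrableZ (Y : set T) (f : T -> R) (c : R) : measurable Y ->
  mu.-integrable Y (EFin \o f) -> mu.-integrable Y (EFin \o (fun y => c * f y)).
Proof.
move=> mY i1; have := integrableZl mY c i1.
by apply: eq_integrable => // y _; rewrite /= -EFinM.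
Qed.

Lemma RintegrableB (Y : set T) (f g : T -> R) : measurable Y ->
  mu.-integrable Y (EFin \o f) -> mu.-integrable Y (EFin \o g) ->
  mu.-integrable Y (EFin \o (fun y => f y - g y)).
Proof.
move=> mY i1 i2; have := integrableB mY i1 i2.
by apply: eq_integrable => // y _; rewrite /= -EFinB.
Qed.

Lemma Rle_integrable (Y : set T) (f g : T -> R) : measurable Y ->
  measurable_fun Y f -> mu.-integrable Y (EFin \o g) ->
  (forall y, Y y -> `|f y| <= g y) -> mu.-integrable Y (EFin \o f).
Proof.
move=> mY mf ig fg; apply: (le_integrable mY _ _ ig); first exact/measurable_EFinP.
by move=> y Yy; rewrite /= lee_fin; apply: (le_trans (fg y Yy)); exact: ler_norm.
Qed.

End Dominated.

Section SeqOpen.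
Context {R : realType} {V : normedModType R}.

Lemma cvg_seq_open (U : set V) (f : V -> R) (p : V) (l : R) : open U -> U p ->
  (forall u : nat -> V, (forall n, U (u n)) -> u @ \oo --> p ->
     f (u n) @[n --> \oo] --> l) ->
  f x @[x --> p] --> l.
Proof.
move=> oU Up H; have h := @cvg_within_seq R V U f p l H.
apply: cvg_trans h => A; rewrite /fmap/= /nbhs/= /within/= => hA.
have Un : \forall y \near p, U y by apply: open_nbhs_nbhs; split.
by apply: filterS2 Un hA => y Uy; apply.
Qed.

(** The bound [r] keeps the points [x + t n *: v] in a neighbourhood fixed in advance, on which the
    difference quotients can be dominated. *)
Lemma is_derive_seq_small (f : V -> R) (x v : V) (d r : R) : 0 < r ->
  (forall t : nat -> R, (forall n, t n != 0) -> (forall n, `|t n| < r) -> t @ \oo --> (0:R) ->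
     (t n)^-1 * (f (x + t n *: v) - f x) @[n --> \oo] --> d) ->
  is_derive x v f d.
Proof.
move=> r0 H; apply: is_derive_cvg.
pose D := [set h : R | h != 0 /\ `|h| < r].
have h : h^-1 * (f (x + h *: v) - f x) @[h --> within D (nbhs (0:R))] --> d.
  by apply: (@cvg_within_seq R R^o) => u uD u0; apply: H => // n; have [] := uD n.
apply: cvg_trans h => A; rewrite /fmap/= /nbhs/= /dnbhs /within/= => hA.
have Un : \forall y \near (0:R), `|y| < r.
  by apply/nbhs_ballP; exists r => //= y; rewrite -ball_normE /= sub0r normrN.
by apply: filterS2 Un hA => y yr h y0; apply: h.
Qed.

End SeqOpen.

(** * Differentiation under the integral sign *)

Section ParamIntegral.
Context {R : realType} d (T : measurableType d).
Local Notation P := (R * R)%type.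
Local Notation dirv := (@dirv R).
Variable nu : {measure set T -> \bar R}.
Implicit Types (U : set P) (k : P -> T -> R).

Lemma norm_dirv b : `|dirv b| = 1 :> R.
Proof. by case: b; rewrite prodnE /Defs.dirv /= normr0 normr1 ?(max_l ler01) ?(max_r ler01). Qed.

Lemma open_ball_sub U z : open U -> U z -> exists r : R, 0 < r /\ ball z r `<=` U.
Proof. by move=> oU Uz; have /nbhs_ballP[r /= r0 h] := oU z Uz; exists r. Qed.

Lemma ball_line (z : P) b (r s : R) : `|s| < r -> ball z r (z + s *: dirv b).
Proof.
by move=> sr; apply/ball_normP; rewrite opprD addrA subrr add0r normrN normrZ norm_dirv mulr1.
Qed.

(** By the mean value inequality the difference quotients are bounded by [M], a constant integrable
    on the finite measure set [X]. The measurability in the conclusion is what lets [param_C2]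
    repeat the argument on the partials. *)
Lemma param_C1 U (X : set T) k (M : R) : open U -> measurable X -> (nu X < +oo)%E ->
  (forall z, U z -> measurable_fun X (k z)) ->
  (forall x, X x -> C1 U (k^~ x)) ->
  (forall z x, U z -> X x -> `|k z x| <= M) ->
  (forall z x b, U z -> X x -> `|partial b (k^~ x) z| <= M) ->
  [/\ C1 U (fun z => \int[nu]_(x in X) k z x),
      forall z b, U z -> partial b (fun z => \int[nu]_(x in X) k z x) z =
                         \int[nu]_(x in X) partial b (k^~ x) z &
      forall z b, U z -> measurable_fun X (fun x => partial b (k^~ x) z)].
Proof.
move=> oU mX Xoo mk ck kM dkM.
have Mint : nu.-integrable X (EFin \o cst M).
  have := @Rbounded_integrable _ _ _ nu X (cst M) `|M| mX Xoo.
  by apply => // y _; exact: lexx.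
have quot z b x t : U z -> X x -> (exists r, `|t| < r /\ ball z r `<=` U) ->
    `|k (z + t *: dirv b) x - k z x| <= M * `|t|.
  move=> Uz Xx [r [tr zr]]; apply: (@line_MVT R _ (k^~ x) (partial b (k^~ x))).
    move=> s st; apply: (C1_derive b (ck x Xx)); apply: zr.
    by apply: ball_line; exact: le_lt_trans tr.
  move=> s st; apply: dkM => //; apply: zr.
  by apply: ball_line; exact: le_lt_trans tr.
have key z b (t : nat -> R) r : U z -> ball z r `<=` U -> (forall n, t n != 0) ->
    (forall n, `|t n| < r) -> t @ \oo --> (0 : R) ->
    forall x, X x -> (t n)^-1 * (k (z + t n *: dirv b) x - k z x) @[n --> \oo]
      --> partial b (k^~ x) z.
  move=> Uz zr t0 tr tc x Xx.
  have h := cvg_is_derive (C1_derive b (ck x Xx) Uz).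
  exact: (cvg_comp _ _ (cvg_dnbhs0 t0 tc) h).
have mq z b t r : U z -> ball z r `<=` U -> `|t| < r ->
    measurable_fun X (fun x => t^-1 * (k (z + t *: dirv b) x - k z x)).
  move=> Uz zr tr; apply: measurable_funM => //; apply: measurable_funB.
    by apply: mk; apply: zr; exact: ball_line.
  exact: mk.
(* A derivative is the pointwise limit of difference quotients along the steps [t n], hence
   measurable. *)
have mp z b : U z -> measurable_fun X (fun x => partial b (k^~ x) z).
  move=> Uz; have [r [r0 zr]] := open_ball_sub oU Uz.
  pose t n : R := r / 2 / n.+1%:R.
  have tr n : `|t n| < r.
    rewrite /t ger0_norm ?divr_ge0 ?(ltW r0)// ltr_pdivrMr//.
    have : (1:R) <= n.+1%:R by rewrite ler1n.
    by nra.
  have t0 n : t n != 0 by rewrite /t !mulf_neq0 ?invr_neq0 ?gt_eqF// ?ltr0n.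
  apply: (@measurable_fun_cvg _ _ _ X
    (fun n x => (t n)^-1 * (k (z + t n *: dirv b) x - k z x))).
    by move=> n; exact: (mq _ _ _ r).
  apply: key zr t0 tr _ => //.
  rewrite -(mulr0 (r / 2)); apply: cvgM; first exact: cvg_cst.
  exact: cvg_harmonic.
pose dF b z := \int[nu]_(x in X) partial b (k^~ x) z.
have [c1 p1] : C1 U (fun z => \int[nu]_(x in X) k z x) /\
   forall z b, U z -> partial b (fun z => \int[nu]_(x in X) k z x) z = dF b z.
  apply: (@C1_intro R U _ dF oU).
  - move=> z Uz; apply: (cvg_seq_open oU Uz) => u Uu uz.
    apply: (proj2 (@Rdct _ _ _ nu X (fun n => k (u n)) (k z) (cst M) mX _ _ Mint _)).
    + by move=> n; exact: mk.
    + move=> x Xx; have := C1_cont (ck x Xx) Uz; rewrite /prop_for /continuous_at => h.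
      exact: (cvg_comp _ _ uz h).
    + by move=> n x Xx; exact: kM.
  - move=> z b Uz; apply: (cvg_seq_open oU Uz) => u Uu uz.
    apply: (proj2 (@Rdct _ _ _ nu X (fun n x => partial b (k^~ x) (u n)) (fun x => partial b (k^~ x) z) (cst M) mX _ _ Mint _)).
    + by move=> n; exact: mp.
    + move=> x Xx; have := C1_pcont b (ck x Xx) Uz; rewrite /prop_for /continuous_at => h.
      exact: (cvg_comp _ _ uz h).
    + by move=> n x Xx; exact: dkM.
  - move=> z b Uz; have [r [r0 zr]] := open_ball_sub oU Uz.
    apply: (is_derive_seq_small r0) => t t0 tr tc.
    have ik w : U w -> nu.-integrable X (EFin \o k w).
      by move=> Uw; apply: (Rbounded_integrable mX Xoo (mk w Uw)) => x Xx; exact: kM.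
    have zU n : U (z + t n *: dirv b) by apply: zr; exact: ball_line.
    have E n : (t n)^-1 * (\int[nu]_(x in X) k (z + t n *: dirv b) x - \int[nu]_(x in X) k z x)
       = \int[nu]_(x in X) ((t n)^-1 * (k (z + t n *: dirv b) x - k z x)).
      rewrite -RintegralB//; [|exact: ik|exact: ik].
      rewrite RintegralZl//; exact: (integrableB mX (ik _ (zU n)) (ik _ Uz)).
    rewrite (eq_cvg _ _ E).
    apply: (proj2 (@Rdct _ _ _ nu X (fun n x => (t n)^-1 * (k (z + t n *: dirv b) x - k z x)) (fun x => partial b (k^~ x) z) (cst M) mX _ _ Mint _)).
    + by move=> n; exact: (mq _ _ _ r).
    + exact: key zr t0 tr tc.
    + move=> n x Xx; rewrite normrM normfV mulrC ler_pdivrMr ?normr_gt0//.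
      by apply: quot => //; exists r.
by split.
Qed.

Lemma param_C2 U (X : set T) k (M : R) : open U -> measurable X -> (nu X < +oo)%E ->
  (forall z, U z -> measurable_fun X (k z)) ->
  (forall x, X x -> C2 U (k^~ x)) ->
  (forall z x, U z -> X x -> `|k z x| <= M) ->
  (forall z x b, U z -> X x -> `|partial b (k^~ x) z| <= M) ->
  (forall z x b b', U z -> X x -> `|partial b' (partial b (k^~ x)) z| <= M) ->
  C2 U (fun z => \int[nu]_(x in X) k z x) /\
  (forall z b b', U z -> partial b' (partial b (fun z => \int[nu]_(x in X) k z x)) z =
                         \int[nu]_(x in X) partial b' (partial b (k^~ x)) z) /\
  (forall z b, U z -> partial b (fun z => \int[nu]_(x in X) k z x) z =
                         \int[nu]_(x in X) partial b (k^~ x) z) /\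
  (forall z b b', U z -> measurable_fun X (fun x => partial b' (partial b (k^~ x)) z)).
Proof.
move=> oU mX Xoo mk ck kM dkM ddkM.
have [c1 p1 m1] := param_C1 oU mX Xoo mk (fun x Xx => C2_C1 (ck x Xx)) kM dkM.
have H b := @param_C1 U X (fun z x => partial b (k^~ x) z) M oU mX Xoo
  (fun z => m1 z b) (fun x Xx => C2_p (ck x Xx) b) (fun z x => dkM z x b)
  (fun z x b' => ddkM z x b b').
split; first split => // b.
  have [c2 _ _] := H b; apply: (C1_ext oU _ c2) => z Uz.
  by rewrite p1.
split; last by split => // z b b' Uz; have [_ _ h] := H b; exact: h.
move=> z b b' Uz; have [_ p2 _] := H b; rewrite -p2//.
by apply: (partial_ext b' oU Uz) => w Uw; rewrite p1.
Qed.

End ParamIntegral.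

(** * Area measure and the integrable kernel [1/|y - z|] *)

Section Area.
Context {R : realType}.
Local Notation P := (R * R)%type.
Local Notation P2 := (measurableTypeR R * measurableTypeR R)%type.
Implicit Types (Y : set P) (z : P).

(* The same measure as [areaM], on the display where the integration lemmas of
   the library expect it. *)
Definition lam2 : {measure set P2 -> \bar R} := (@lebesgue_measure R \x @lebesgue_measure R)%E.

Lemma lam2_ball z (r : R) : 0 <= r -> lam2 (ball z r) = (4 * r ^+ 2)%:E.
Proof.
move=> r0; rewrite ball_prodE /lam2/= product_measure1E; last 2 first.
- by rewrite ball_itv; exact: measurable_itv.
- by rewrite ball_itv; exact: measurable_itv.
transitivity ((r *+ 2)%:E * (r *+ 2)%:E)%E.
  exact: (congr2 mule (lebesgue_measure_ball z.1 r0) (lebesgue_measure_ball z.2 r0)).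
by rewrite -EFinM; congr (_%:E); rewrite mulr2n; ring.
Qed.

Lemma lam2_fin Y z (r : R) : measurable Y -> Y `<=` ball z r -> (lam2 Y < +oo)%E.
Proof.
move=> mY Yr; have [r0|r0] := leP 0 r.
  apply: (@le_lt_trans _ _ (lam2 (ball z r))).
    by apply: le_measure; rewrite ?inE//; exact: measurable_ballP.
  by rewrite lam2_ball// ltry.
suff -> : Y = set0 by rewrite measure0.
by apply/seteqP; split => // y /Yr /ball_normP h; have := normr_ge0 (z - y); lra.
Qed.

Lemma closed_ptP z : closed [set z].
Proof. exact/accessible_closed_set1/hausdorff_accessible/norm_hausdorff. Qed.

Lemma lam2_set1 z : lam2 [set z] = 0%E.
Proof.
apply/eqP; rewrite -measure_le0; apply/lee_addgt0Pr => e e0; rewrite add0e.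
pose r := Num.min 1 (e / 4).
have r0 : 0 < r by rewrite lt_min ltr01 divr_gt0.
apply: (@le_trans _ _ (lam2 (ball z r))).
  apply: le_measure; rewrite ?inE//; first 2 last.
  - by move=> y ->; exact: ballxx.
  - by apply: closed_measurableP; exact: closed_ptP.
  - exact: measurable_ballP.
rewrite (lam2_ball z (ltW r0)) lee_fin.
have : r <= 1 by rewrite ge_min lexx.
have : r <= e / 4 by rewrite ge_min lexx orbT.
by nra.
Qed.

Lemma measurable_ptP z : measurable [set z].
Proof. by apply: closed_measurableP; exact: closed_ptP. Qed.

Lemma measurable_off_pt Y z (f : P -> R) : measurable Y ->
  measurable_fun (Y `\ z) f -> measurable_fun Y f.
Proof.
move=> mY mf.
have mYz : measurable (Y `\ z) by apply: measurableD => //; exact: measurable_ptP.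
apply: (@measurable_funS _ _ _ _ ((Y `\ z) `|` [set z])).
- by apply: measurableU => //; exact: measurable_ptP.
- by move=> y Yy; have [->|yz] := pselect (y = z); [right|left].
apply/measurable_funU => //; first exact: measurable_ptP.
by split => //; exact: measurable_fun_set1.
Qed.

(** Two exceptional points, because a sequence of poles and its limit both carry unspecified
    values. *)
Lemma Rint_eq_off2 Y (a b : P) (f f' : P -> R) : measurable Y ->
  measurable_fun Y f -> measurable_fun Y f' ->
  (forall y, Y y -> y != a -> y != b -> f y = f' y) ->
  \int[lam2]_(y in Y) f y = \int[lam2]_(y in Y) f' y.
Proof.
move=> mY mf mf' E; congr fine; apply: ae_eq_integral => //.
- exact/measurable_EFinP.
- exact/measurable_EFinP.
exists ([set a] `|` [set b]); split.
- by apply: measurableU; exact: measurable_ptP.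
- have U0 : (lam2 ([set a] `|` [set b]) <= lam2 [set a] + lam2 [set b])%E.
    by apply: measureU2; exact: measurable_ptP.
  apply/eqP; rewrite -measure_le0; apply: (le_trans U0).
  by rewrite (lam2_set1 a) (lam2_set1 b) adde0.
- move=> y /= /not_implyP[Yy] h; apply: contrapT => /not_orP[/eqP ya /eqP yb].
  by apply: h; congr (_%:E); exact: E.
Qed.

Lemma open_off z : open (~` [set z]).
Proof. by apply: closed_openC; exact: closed_ptP. Qed.

Arguments open_off : clear implicits.

Lemma measurable_off_cont Y z (f : P -> R) : measurable Y ->
  (forall y, y != z -> {for y, continuous f}) -> measurable_fun Y f.
Proof.
move=> mY cf; apply: (measurable_off_pt (z := z)) => //.
apply: (@measurable_funS _ _ _ _ (~` [set z])); first exact: open_measurableP (open_off z).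
  by move=> y [].
by apply: cont_measurable => [|y /= /eqP]; [exact: open_off|exact: cf].
Qed.

(** The common majorant of the logarithm, of its gradient and of the Green function, up to
    constants. Its value at [y = z] is 0, the inverse of 0. *)
Definition pk z (y : P) : R := `|y - z|^-1.

Lemma pk_ge0 z y : 0 <= pk z y. Proof. by rewrite invr_ge0. Qed.

Lemma measurable_pk Y z : measurable Y -> measurable_fun Y (pk z).
Proof.
move=> mY; apply: (measurable_off_cont (z := z)) => // y yz; apply: cvgV.
  by rewrite normr_eq0 subr_eq0.
by apply: cvg_norm; apply: cvgB; [exact: cvg_id|exact: cvg_cst].
Qed.

Lemma dyadic_scale (t r : R) : 0 < t < r -> exists n, r / 2 ^+ n.+1 <= t < r / 2 ^+ n.
Proof.
move=> /andP[t0 tr].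
have [n hn] : exists n, r / 2 ^+ n.+1 <= t.
  have [n _ /(_ n (leqnn n)) /= h] : \forall n \near \oo, n%:R > r / t by exact: nbhs_infty_gtr.
  exists n; rewrite ler_pdivrMr ?exprn_gt0// mulrC -ler_pdivrMr//.
  apply: (le_trans (ltW h)); rewrite -natrX ler_nat ltnW// (@ltn_trans (2 ^ n))//.
    exact: ltn_expl.
  by rewrite ltn_exp2l.
pose Q := [pred n | r / 2 ^+ n.+1 <= t].
have eQ : exists n, Q n by exists n.
have [m Qm mmin] := ex_minnP eQ; exists m.
apply/andP; split => //; rewrite ltNge; apply/negP.
case: m Qm mmin => [|m] Qm mmin; first by rewrite expr0 divr1 leNgt tr.
by move=> h; have := mmin m h; rewrite ltnn.
Qed.

(** Dyadic decomposition: where the distance is at least [r/2^(n+1)], the kernel is at most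
    [2^(n+1)/r], and the ball of radius [r/2^n] has area [4 r^2/4^n]. The products are
    [16 r/2^(n+1)], whose sum is [16 r]. *)
Lemma int_pk z (r : R) : 0 < r -> (\int[lam2]_(y in ball z r) (pk z y)%:E <= (16 * r)%:E)%E.
Proof.
move=> r0.
pose f (n : nat) (y : P) : \bar R := ((2 ^+ n.+1 / r) * \1_(ball z (r / 2 ^+ n)) y)%:E.
have rn n : 0 < r / 2 ^+ n by rewrite divr_gt0// exprn_gt0.
have f0 n y : (0 <= f n y)%E.
  by rewrite lee_fin mulr_ge0// divr_ge0 ?exprn_ge0// ltW.
have mf n : measurable_fun (ball z r) (f n).
  apply/measurable_EFinP; apply: measurable_funM => //.
  by apply: measurable_indic; exact: measurable_ballP.
have mB := measurable_ballP z r.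
apply: (@le_trans _ _ (\int[lam2]_(y in ball z r) \sum_(n <oo) f n y)%E).
  apply: ge0_le_integral => //.
  - by move=> y _; rewrite lee_fin pk_ge0.
  - by apply/measurable_EFinP; exact: measurable_pk.
  - by apply: ge0_emeasurable_sum => [n y _ _|n _]; [exact: f0|exact: mf].
  move=> y /ball_normP yr.
  have [->|yz] := eqVneq y z.
    by rewrite /pk subrr normr0 invr0; apply: nneseries_ge0.
  have yz0 : 0 < `|z - y| by rewrite normr_gt0 subr_eq0 eq_sym.
  have [n /andP[n1 n2]] := @dyadic_scale `|z - y| r ltac:(by rewrite yz0).
  apply: (@le_trans _ _ (\sum_(0 <= i < n.+1) f i y)%E); last exact: nneseries_lim_ge.
  rewrite big_nat_recr//=; apply: (@le_trans _ _ (f n y)).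
    rewrite /f lee_fin indicE mem_set; last by apply/ball_normP.
    rewrite mulr1 /pk distrC -(invrK (2 ^+ n.+1 / r)) lef_pV2 ?posrE//.
      by rewrite invf_div.
    by rewrite invr_gt0 divr_gt0// exprn_gt0.
  by rewrite leeDr//; apply: sume_ge0.
rewrite integral_nneseries//.
apply: (@le_trans _ _ (\sum_(n <oo) (16 * r / (2 ^ n.+1)%:R)%:E)%E); last first.
  by apply: (epsilon_trick0 xpredT); rewrite mulr_ge0// ltW.
apply: lee_nneseries => // n _.
  by rewrite integral_ge0.
rewrite /f; under eq_integral do rewrite EFinM.
rewrite ge0_integralZl//; last 2 first.
- by apply/measurable_EFinP; apply: measurable_indic; exact: measurable_ballP.
- by rewrite lee_fin divr_ge0 ?exprn_ge0// ltW.
rewrite integral_indic//; last exact: measurable_ballP.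
rewrite setIidl; last first.
  move=> y /ball_normP h; apply/ball_normP; apply: (lt_le_trans h).
  rewrite ler_pdivrMr ?exprn_gt0//.
  have : (1 : R) <= 2 ^+ n by apply: exprn_ege1; rewrite ler1n.
  by nra.
rewrite (lam2_ball z (ltW (rn n))) -EFinM lee_fin natrX exprS.
have p0 : 2 ^+ n != 0 :> R by rewrite expf_neq0.
by rewrite le_eqVlt; apply/orP; left; apply/eqP; field; rewrite p0 gt_eqF.
Qed.

Lemma pk_integrable Y z w (r : R) : measurable Y -> Y `<=` ball w r ->
  lam2.-integrable Y (EFin \o pk z).
Proof.
move=> mY Yr.
pose r' := Num.max 1 (r + `|z - w|).
have r'0 : 0 < r' by rewrite lt_max ltr01.
have sub : Y `<=` ball z r'.
  move=> y /Yr /ball_normP h; apply/ball_normP.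
  apply: (@lt_le_trans _ _ (r + `|z - w|)); last by rewrite le_max lexx orbT.
  rewrite (_ : z - y = (w - y) + (z - w)); last by rewrite [RHS]addrC subrKA.
  by apply: (le_lt_trans (ler_normD _ _)); rewrite ltrD2r.
apply: (@integrableS _ _ _ lam2 (ball z r') Y _ (measurable_ballP z r') mY sub).
apply/integrableP; split.
  by apply/measurable_EFinP; apply: measurable_pk; exact: measurable_ballP.
apply: (@le_lt_trans _ _ (16 * r')%:E); last by rewrite ltry.
apply: le_trans (int_pk z r'0); rewrite le_eqVlt; apply/orP; left; apply/eqP.
by apply: eq_integral => y _; rewrite /= ger0_norm// pk_ge0.
Qed.

Lemma Rint_pk Y z (r : R) : 0 < r -> measurable Y -> Y `<=` ball z r ->
  \int[lam2]_(y in Y) pk z y <= 16 * r.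
Proof.
move=> r0 mY Yr; rewrite -lee_fin /Rintegral fineK; last first.
  by apply: integrable_fin_num => //; exact: pk_integrable Yr.
apply: le_trans (int_pk z r0); apply: ge0_subset_integral => //.
- exact: measurable_ballP.
- by apply/measurable_EFinP; apply: measurable_pk; exact: measurable_ballP.
- by move=> y _; rewrite lee_fin pk_ge0.
Qed.

End Area.
Arguments open_off {R} z.

(** * Dominated convergence with a moving singularity *)

Section SingularDct.
Context {R : realType}.
Local Notation P := (R * R)%type.
Local Notation P2 := (measurableTypeR R * measurableTypeR R)%type.
Local Notation lam2 := (@lam2 R).

Lemma cvg_near_norm (u : nat -> P) (z : P) (r : R) : u @ \oo --> z -> 0 < r ->
  \forall n \near \oo, `|z - u n| < r.
Proof. by move=> /cvgrPdist_lt h r0; exact: h. Qed.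

Lemma Rint_splitB (Y B : set P) (f : P -> R) : measurable Y -> measurable B ->
  lam2.-integrable Y (EFin \o f) ->
  \int[lam2]_(y in Y) f y =
  \int[lam2]_(y in Y `&` B) f y + \int[lam2]_(y in Y `\` B) f y.
Proof.
move=> mY mB iY; rewrite -{1}(setUIDK Y B) Rintegral_setU//.
- exact: measurableI.
- exact: measurableD.
- by rewrite setUIDK.
- by rewrite disj_set2E; apply/eqP; apply/seteqP; split => // y [[_ By] [_]]; exact.
Qed.

Lemma pk_dom (Y : set P) (w : P) (M0 c : R) (z z' : P) (f : P -> R) :
  measurable Y -> Y `<=` ball w M0 -> measurable_fun Y f ->
  (forall y, Y y -> `|f y| <= c * (pk z y + pk z' y)) ->
  lam2.-integrable Y (EFin \o f).
Proof.
move=> mY Yw mf fc.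
have i1 := pk_integrable z mY Yw; have i2 := pk_integrable z' mY Yw.
have mY2 : @measurable _ P2 Y := mY.
exact: (Rle_integrable mY2 mf (RintegrableZ c mY2 (RintegrableD mY2 i1 i2))).
Qed.

(** The 32 is twice the 16 of [int_pk], once for each pole. *)
Lemma pk_small (Y : set P) (w : P) (M0 c : R) (z z' : P) (f : P -> R) (r : R) :
  measurable Y -> Y `<=` ball w M0 -> measurable_fun Y f -> 0 <= c -> 0 < r ->
  Y `<=` ball z r -> Y `<=` ball z' r ->
  (forall y, Y y -> `|f y| <= c * (pk z y + pk z' y)) ->
  `|\int[lam2]_(y in Y) f y| <= c * (32 * r).
Proof.
move=> mY Yw mf c0 r0 Yz Yz' fc.
have i1 := pk_integrable z mY Yw; have i2 := pk_integrable z' mY Yw.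
have i := pk_dom mY Yw mf fc.
have mY2 : @measurable _ P2 Y := mY.
apply: (le_trans (le_normr_Rintegral mY2 i)).
apply: (@le_trans _ _ (\int[lam2]_(y in Y) (c * (pk z y + pk z' y)))).
  apply: le_Rintegral => //; first exact: integrable_norm.
  exact: (RintegrableZ c mY2 (RintegrableD mY2 i1 i2)).
have i3 : lam2.-integrable Y (EFin \o (fun y => pk z y + pk z' y)).
  exact: (RintegrableD mY2 i1 i2).
rewrite RintegralZl// RintegralD//; apply: ler_wpM2l => //.
have := Rint_pk r0 mY Yz; have := Rint_pk r0 mY Yz'; lra.
Qed.

(* The ball of radius [r] around [z] contributes at most a multiple of [r] to every
   integral; off that ball the integrands are bounded. *)
Lemma singular_dct (Y : set P) (w z : P) (M0 c : R) (u : nat -> P)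
    (k : nat -> P -> R) (l : P -> R) :
  measurable Y -> Y `<=` ball w M0 -> 0 <= c -> u @ \oo --> z ->
  (forall n, measurable_fun Y (k n)) -> measurable_fun Y l ->
  (forall n y, Y y -> y != u n -> y != z -> `|k n y| <= c * (pk (u n) y + pk z y)) ->
  (forall y, Y y -> y != z -> k n y @[n --> \oo] --> l y) ->
  \int[lam2]_(y in Y) k n y @[n --> \oo] --> \int[lam2]_(y in Y) l y.
Proof.
move=> mY Yw c0 uz mk ml kc kl.
(* The bound on [k n] is silent at the poles [u n] and [z]; with the value 0 there it holds
   everywhere, and the integrals do not change. *)
pose k' n y := if (y == u n) || (y == z) then 0 else k n y.
pose l' y := if y == z then 0 else l y.
have mk' n : measurable_fun Y (k' n).
  apply: (measurable_off_pt (z := u n)) => //; apply: (measurable_off_pt (z := z)).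
    by apply: measurableD => //; exact: measurable_ptP.
  apply: (eq_measurable_fun (k n)).
    move=> y; rewrite inE => -[[_ /eqP/negPf yu] /eqP/negPf yz].
    by rewrite /k' yu yz.
  by apply: measurable_funS (mk n) => // y [[]].
have ml' : measurable_fun Y l'.
  apply: (measurable_off_pt (z := z)) => //; apply: (eq_measurable_fun l).
    by move=> y; rewrite inE => -[_ /eqP/negPf yz]; rewrite /l' yz.
  by apply: measurable_funS ml => // y [].
have Ek n : \int[lam2]_(y in Y) k n y = \int[lam2]_(y in Y) k' n y.
  apply: (Rint_eq_off2 (a := u n) (b := z)) => // y _ /negPf yu /negPf yz.
  by rewrite /k' yu yz.
have -> : \int[lam2]_(y in Y) l y = \int[lam2]_(y in Y) l' y.
  apply: (Rint_eq_off2 (a := z) (b := z)) => // y _ /negPf yz _.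
  by rewrite /l' yz.
rewrite (eq_cvg _ _ Ek).
have k'c n y : Y y -> `|k' n y| <= c * (pk (u n) y + pk z y).
  move=> Yy; rewrite /k'; case: ifPn => [_|]; last by rewrite negb_or => /andP[] *; exact: kc.
  by rewrite normr0 mulr_ge0// addr_ge0// pk_ge0.
have k'l y : Y y -> k' n y @[n --> \oo] --> l' y.
  move=> Yy; rewrite /l'; case: ifPn => [/eqP ->|yz].
    by under eq_fun do rewrite /k' eqxx orbT; exact: cvg_cst.
  have E : \forall n \near \oo, k n y = k' n y.
    have yz0 : 0 < `|z - y| by rewrite normr_gt0 subr_eq0 eq_sym.
    near=> n; have h : `|z - u n| < `|z - y| by near: n; exact: cvg_near_norm.
    rewrite /k' (negPf yz) orbF; case: eqP => // yu.
    by move: h; rewrite -yu ltxx.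
  exact: (cvg_trans (near_eq_cvg E) (kl y Yy yz)).
have pkc y : y != z -> pk (u n) y @[n --> \oo] --> pk z y.
  move=> yz; apply: cvgV; first by rewrite normr_eq0 subr_eq0.
  by apply: cvg_norm; apply: cvgB => //; exact: cvg_cst.
have l'c y : Y y -> `|l' y| <= c * (pk z y + pk z y).
  move=> Yy; rewrite /l'; case: ifPn => [_|yz].
    by rewrite normr0 mulr_ge0// addr_ge0// pk_ge0.
  have h1 : `|k' n y| @[n --> \oo] --> `|l' y| by apply: cvg_norm; exact: k'l.
  have h2 : c * (pk (u n) y + pk z y) @[n --> \oo] --> c * (pk z y + pk z y).
    by apply: cvgM; [exact: cvg_cst|apply: cvgD; [exact: pkc|exact: cvg_cst]].
  have : `|l' y| <= c * (pk z y + pk z y).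
    rewrite -(cvg_lim _ h1)// -(cvg_lim _ h2)//; apply: ler_lim.
    - by apply/cvg_ex; exists `|l' y|.
    - by apply/cvg_ex; eexists; exact: h2.
    - by apply: nearW => n; exact: k'c.
  by rewrite /l' (negPf yz).
have ik n := pk_dom mY Yw (mk' n) (k'c n).
have il := pk_dom mY Yw ml' l'c.
apply/cvgrPdist_lt => e e0.
(* Once [u n] is within [r/2] of [z], the ball of radius [r] about [z] lies in the one of radius
   [2 * r] about [u n], so [pk_small] costs [c * 32 * (2 * r)]; this choice makes it at most [e/4].
   The [+ 1] covers [c = 0]. *)
pose r := e / (4 * 64 * (c + 1)).
have r0 : 0 < r by rewrite divr_gt0//; lra.
have cr : c * (64 * r) <= e / 4.
  rewrite /r (_ : c * _ = (e / 4) * (c / (c + 1))); last by field; lra.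
  by rewrite ger_pMr ?divr_gt0// ler_pdivrMr; lra.
clearbody r.
pose B := ball z r; have mB : measurable B by exact: measurable_ballP.
have mYB : measurable (Y `&` B) by exact: measurableI.
have mYD : measurable (Y `\` B) by exact: measurableD.
have YBw : (Y `&` B) `<=` ball w M0 by move=> y [/Yw].
have near1 : \forall n \near \oo, `|z - u n| < r / 2.
  have r20 : 0 < r / 2 by rewrite divr_gt0.
  exact: cvg_near_norm.
have smallk n : `|z - u n| < r / 2 -> `|\int[lam2]_(y in Y `&` B) k' n y| <= e / 4.
  move=> h; apply: le_trans cr.
  rewrite (_ : 64 * r = 32 * (2 * r)); last by ring.
  apply: (@pk_small _ w M0 c (u n) z (k' n)) => //; rewrite ?mulr_gt0//.
  - by apply: measurable_funS (mk' n) => // y [].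
  - move=> y [_ /ball_normP yB]; apply/ball_normP.
    rewrite (_ : u n - y = - (z - u n) + (z - y)); last by rewrite opprB subrKA.
    by apply: (le_lt_trans (ler_normD _ _)); rewrite normrN; lra.
  - by move=> y [_ /ball_normP yB]; apply/ball_normP; lra.
  - by move=> y [Yy _]; exact: k'c.
have smalll : `|\int[lam2]_(y in Y `&` B) l' y| <= e / 4.
  apply: (@le_trans _ _ (c * (32 * r))); last by apply: le_trans cr; apply: ler_wpM2l => //; lra.
  have YBB : (Y `&` B) `<=` ball z r by move=> y [].
  apply: (@pk_small _ w M0 c z z l' r mYB YBw _ c0 r0 YBB YBB).
  - by apply: measurable_funS ml' => // y [].
  - by move=> y [Yy _]; exact: l'c.
have far : \forall n \near \oo,
   `|\int[lam2]_(y in Y `\` B) l' y - \int[lam2]_(y in Y `\` B) k' n y| < e / 4.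
  suff : \int[lam2]_(y in Y `\` B) k' n y @[n --> \oo] --> \int[lam2]_(y in Y `\` B) l' y.
    by move=> /cvgrPdist_lt; apply; rewrite divr_gt0.
  (* Dropping the first [N] terms makes the poles stay within [r/2] of [z] for every index, so that
     off the ball one constant dominates the whole sequence. *)
  case: near1 => N _ hN; rewrite -(cvg_shiftn N).
  have YDoo : (lam2 (Y `\` B) < +oo)%E by apply: (lam2_fin (z := w) (r := M0)) => // y [/Yw].
  apply: (proj2 (@Rdct _ _ _ lam2 (Y `\` B) (fun n => k' (n + N)%N) l'
    (cst (c * (2 / r + 1 / r))) mYD _ _ _ _)).
  - by move=> n; apply: measurable_funS (mk' _) => // y [].
  - by move=> y [Yy _]; rewrite (cvg_shiftn N (k' ^~ y)); exact: k'l.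
  - have := @Rbounded_integrable _ _ _ lam2 (Y `\` B) (cst (c * (2 / r + 1 / r))) `|c * (2 / r + 1 / r)| mYD YDoo.
    by apply => // y _; exact: lexx.
  - move=> n y [Yy yB]; apply: (le_trans (k'c _ _ Yy)); apply: ler_wpM2l => //.
    have zy : r <= `|z - y| by rewrite leNgt; apply/negP => h; apply: yB; apply/ball_normP.
    have uy : r / 2 <= `|u (n + N)%N - y|.
      have h2 := hN (n + N)%N (leq_addl _ _); rewrite /= in h2.
      have : `|z - y| <= `|z - u (n + N)%N| + `|u (n + N)%N - y|.
        by rewrite -{1}(subrKA (u (n + N)%N) z (- y)); exact: ler_normD.
      by lra.
    apply: lerD; rewrite /pk distrC.
      by rewrite -[2 / r]invf_div lef_pV2 ?posrE; lra.
    by rewrite div1r lef_pV2 ?posrE; lra.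
near=> n.
rewrite (Rint_splitB mY mB il) (Rint_splitB mY mB (ik n)).
have a1 : `|\int[lam2]_(y in Y `&` B) k' n y| <= e / 4.
  by apply: smallk; near: n.
have a2 : `|\int[lam2]_(y in Y `\` B) l' y - \int[lam2]_(y in Y `\` B) k' n y| < e / 4.
  by near: n.
move: a1 smalll a2; rewrite !ler_norml !ltr_norml.
by move=> /andP[? ?] /andP[? ?] /andP[? ?]; apply/andP; split; lra.
Unshelve. all: by end_near. Qed.

End SingularDct.

(** * Newton potentials of bounded densities are C^1 *)

Section NewtonC1.
Context {R : realType}.
Local Notation P := (R * R)%type.
Local Notation P2 := (measurableTypeR R * measurableTypeR R)%type.
Local Notation dirv := (@dirv R).
Local Notation lam2 := (@lam2 R).

Lemma offP (y t : P) : (~` [set y]) t -> t != y.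
Proof. by move=> /= /eqP. Qed.

Lemma L_contl (z y : P) : z != y -> {for z, continuous (L^~ y)}.
Proof.
move=> zy; have [[c1 _] _ _ _] := L_C2 (open_off y) (@offP _).
by apply: (C1_cont c1) => /= /eqP; exact/negP.
Qed.

Lemma L_derive (z y : P) b : z != y -> is_derive z (dirv b) (L^~ y) (dL b z y).
Proof.
move=> zy; have [[c1 _] p _ _] := L_C2 (open_off y) (@offP _).
have h : (~` [set y]) z by move=> /eqP; exact/negP.
by rewrite -p//; exact: (C1_derive b c1 h).
Qed.

Lemma dL_contl b (z y : P) : z != y -> {for z, continuous (dL b ^~ y)}.
Proof.
move=> zy; have [[c1 c2] p _ _] := L_C2 (open_off y) (@offP _).
have h : (~` [set y]) z by move=> /eqP; exact/negP.
apply: (for_cont_ext (open_off y) h _ (C1_pcont b c1 h)) => t ty; exact: p.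
Qed.

Lemma dLC b (z y : P) : dL b z y = - dL b y z.
Proof. by rewrite /dL sqC -mulNr opprB. Qed.

Lemma L_off_cont (z y : P) : y != z -> {for y, continuous (L z)}.
Proof.
move=> yz; rewrite (_ : L z = L^~ z); last by apply/funext => t; rewrite LC.
exact: L_contl.
Qed.

Lemma dL_off_cont b (z y : P) : y != z -> {for y, continuous (dL b z)}.
Proof.
move=> yz; rewrite (_ : dL b z = fun t => - dL b t z); last by apply/funext => t; rewrite dLC.
by apply: cvgN; exact: dL_contl.
Qed.

Lemma measurable_L (Y : set P) (z : P) : measurable Y -> measurable_fun Y (L z).
Proof. by move=> mY; apply: (measurable_off_cont (z := z)) => // y; exact: L_off_cont. Qed.

Lemma measurable_dL b (Y : set P) (z : P) : measurable Y -> measurable_fun Y (dL b z).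
Proof. by move=> mY; apply: (measurable_off_cont (z := z)) => // y; exact: dL_off_cont. Qed.

Lemma L_pk (z y : P) (M : R) : 0 <= M -> z != y -> `|z - y| <= M -> `|L z y| <= (M ^+ 2 + 1) * pk z y.
Proof.
move=> M0 zy zM; apply: (le_trans (L_bound zy)).
have n0 : 0 < `|z - y| by rewrite normr_gt0 subr_eq0.
rewrite /pk (distrC y z) mulrDl mul1r lerD2r ler_pdivlMr// -expr2.
by rewrite lerXn2r ?nnegrE.
Qed.

Variables (Y : set P) (w : P) (M0 K : R) (f : P -> R).
Hypothesis (mY : measurable Y) (Yw : Y `<=` ball w M0) (mf : measurable_fun Y f).
Hypothesis (K0 : 0 <= K) (fK : forall y, Y y -> `|f y| <= K).

(** The logarithmic potential without its factor [1/(2 pi)], which reappears in [Gop_split]. *)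
Definition newt z : R := \int[lam2]_(y in Y) (L z y * f y).
Definition dnewt b z : R := \int[lam2]_(y in Y) (dL b z y * f y).

Let mY2 : @measurable _ P2 Y := mY.

Let bnd (z u y : P) : `|z - u| < 1 -> Y y -> `|u - y| <= 1 + `|z - w| + `|M0|.
Proof.
move=> zu /Yw/ball_normP wy.
have -> : u - y = - (z - u) + ((z - w) + (w - y)) by rewrite subrKA opprB subrKA.
have h1 := ler_normD (- (z - u)) ((z - w) + (w - y)).
have h2 := ler_normD (z - w) (w - y); have h3 := ler_norm M0.
by rewrite normrN in h1; lra.
Qed.

Let Lf_bnd (z u y : P) : `|z - u| < 1 -> Y y -> y != u ->
  `|L u y * f y| <= ((1 + `|z - w| + `|M0|) ^+ 2 + 1) * K * (pk u y + pk z y).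
Proof.
move=> zu Yy yu; rewrite normrM; set A := (_ ^+ 2 + 1).
have A0 : 0 <= A by rewrite addr_ge0 ?sqr_ge0.
have h : `|L u y| <= A * pk u y.
  by apply: L_pk; [rewrite !addr_ge0|rewrite eq_sym|exact: bnd].
apply: (@le_trans _ _ ((A * pk u y) * K)); first by apply: ler_pM => //; exact: fK.
by rewrite mulrAC; apply: ler_wpM2l; rewrite ?mulr_ge0// lerDl pk_ge0.
Qed.

Let dLf_bnd b (z u y : P) : Y y -> y != u ->
  `|dL b u y * f y| <= K * (pk u y + pk z y).
Proof.
move=> Yy yu; rewrite normrM mulrC mulrDr.
apply: (@le_trans _ _ (K * pk u y)); last by rewrite lerDl mulr_ge0 ?pk_ge0.
by apply: ler_pM => //; [exact: fK|rewrite /pk distrC; apply: dL_bound; rewrite eq_sym].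
Qed.

Lemma measurable_Lf z : measurable_fun Y (fun y => L z y * f y).
Proof. by apply: measurable_funM => //; exact: measurable_L. Qed.

Lemma measurable_dLf b z : measurable_fun Y (fun y => dL b z y * f y).
Proof. by apply: measurable_funM => //; exact: measurable_dL. Qed.

Lemma integrable_Lf z : lam2.-integrable Y (EFin \o (fun y => L z y * f y)).
Proof.
apply: (pk_dom mY Yw (c := ((1 + `|z - w| + `|M0|) ^+ 2 + 1) * K) (z := z) (z' := z)).
  exact: measurable_Lf.
move=> y Yy; have [->|yz] := eqVneq y z; last by apply: Lf_bnd => //; rewrite subrr normr0.
rewrite /L /sq !subrr expr0n /= addr0 (@ln0 _ 0)// !mul0r normr0.
by rewrite !mulr_ge0 ?addr_ge0 ?sqr_ge0 ?pk_ge0.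
Qed.

Lemma integrable_dLf b z : lam2.-integrable Y (EFin \o (fun y => dL b z y * f y)).
Proof.
apply: (pk_dom mY Yw (c := K) (z := z) (z' := z)); first exact: measurable_dLf.
move=> y Yy; have [->|yz] := eqVneq y z; last exact: dLf_bnd.
rewrite /dL subrr !mul0r normr0.
by rewrite !mulr_ge0 ?addr_ge0 ?pk_ge0.
Qed.

(** The gradient of the kernel is of size [1/|z - y|], still integrable in the plane, so one
    differentiation passes through the singularity. [singular_dct] does continuity, continuity of
    the gradient and, through [L_lip2], the difference quotients. *)
Lemma newt_C1 : C1 setT newt /\ (forall z b, partial b newt z = dnewt b z).
Proof.
have [c1 p1] : C1 setT newt /\ (forall z b, setT z -> partial b newt z = dnewt b z).
  have ob (z : P) : open (ball z (1 : R)) by apply: ball_open.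
  have bz (z : P) : ball z (1 : R) z by apply: ballxx.
  apply: (C1_intro (df := dnewt) openT).
  - move=> z _; apply: (cvg_seq_open (ob z) (bz z)) => u uz1 uz.
    apply: (singular_dct mY Yw (c := ((1 + `|z - w| + `|M0|) ^+ 2 + 1) * K) _ uz) => //.
    + by rewrite mulr_ge0// addr_ge0// sqr_ge0.
    + by move=> n; exact: measurable_Lf.
    + exact: measurable_Lf.
    + by move=> n y Yy yu _; apply: Lf_bnd => //; apply/ball_normP; exact: uz1.
    + move=> y Yy yz; apply: cvgM; last exact: cvg_cst.
      have := @L_contl z y; rewrite eq_sym => /(_ yz); rewrite /prop_for /continuous_at => h.
      exact: (cvg_comp _ _ uz h).
  - move=> z b _; apply: (cvg_seq_open (ob z) (bz z)) => u uz1 uz.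
    apply: (singular_dct mY Yw (c := K) _ uz) => //.
    + by move=> n; exact: measurable_dLf.
    + exact: measurable_dLf.
    + by move=> n y Yy yu _; exact: dLf_bnd.
    + move=> y Yy yz; apply: cvgM; last exact: cvg_cst.
      have := @dL_contl b z y; rewrite eq_sym => /(_ yz); rewrite /prop_for /continuous_at => h.
      exact: (cvg_comp _ _ uz h).
  - move=> z b _; apply: (is_derive_seq_small ltr01) => t t0 t1 tc.
    have E n : (t n)^-1 * (newt (z + t n *: dirv b) - newt z) =
        \int[lam2]_(y in Y) ((t n)^-1 * (L (z + t n *: dirv b) y * f y - L z y * f y)).
      rewrite /newt -RintegralB//; [|exact: integrable_Lf|exact: integrable_Lf].
      rewrite RintegralZl//; exact: (RintegrableB mY2 (integrable_Lf _) (integrable_Lf _)).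
    rewrite (eq_cvg _ _ E).
    have tdc : z + t n *: dirv b @[n --> \oo] --> z.
      rewrite -{2}(addr0 z) -(scale0r (dirv b)); apply: cvgD; first exact: cvg_cst.
      by apply: cvgZ; [exact: tc|exact: cvg_cst].
    apply: (singular_dct mY Yw (c := 2 * K) _ tdc).
    + by rewrite mulr_ge0.
    + move=> n; apply: measurable_funM => //; apply: measurable_funB; exact: measurable_Lf.
    + exact: measurable_dLf.
    + move=> n y Yy yu yz; rewrite -mulrBl mulrA normrM mulrAC [leLHS]mulrC [leRHS]mulrC.
      rewrite mulrC [leRHS]mulrC; apply: ler_pM => //; last exact: fK.
      rewrite normrM normfV mulrC ler_pdivrMr ?normr_gt0//.
      have := @L_lip2 _ (z + t n *: dirv b) z y; rewrite eq_sym yu eq_sym yz => /(_ isT isT) h.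
      apply: (le_trans h); rewrite /pk !(distrC y) addrAC subrr add0r normrZ norm_dirv mulr1.
      by rewrite mulrAC.
    + move=> y Yy yz; under eq_fun do rewrite -mulrBl mulrA.
      apply: cvgM; last exact: cvg_cst.
      have h : is_derive z (dirv b) (L^~ y) (dL b z y) by apply: L_derive; rewrite eq_sym.
      exact: (cvg_comp _ _ (cvg_dnbhs0 t0 tc) (cvg_is_derive h)).
by split => // z b; exact: p1.
Qed.

End NewtonC1.

(** * Integrating a derivative over a square *)

Section BoxFTC.
Context {R : realType}.
Local Notation P := (R * R)%type.
Local Notation P2 := (measurableTypeR R * measurableTypeR R)%type.
Local Notation dirv := (@dirv R).
Local Notation lam2 := (@lam2 R).
Local Notation lam := (@lebesgue_measure R).

Lemma itv_FTC (G g : R -> R) (a b : R) : a < b ->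
  (forall s, a <= s <= b -> is_derive s 1 G (g s)) ->
  (forall s, a <= s <= b -> {for s, continuous g}) ->
  (\int[lam]_(s in `[a, b]) (g s)%:E = (G b - G a)%:E)%E.
Proof.
move=> ab dG cg.
have cG s : a <= s <= b -> {for s, continuous G}.
  by move=> sab; apply/differentiable_continuous/derivable1_diffP; have [] := dG s sab.
rewrite (@continuous_FTC2 R g G a b ab) ?EFinB//.
- by apply: continuous_in_subspaceT => s; rewrite inE/= in_itv/=; exact: cg.
- split.
  + move=> s; rewrite in_itv/= => /andP[as_ sb].
    by have [] := dG s ltac:(by rewrite !ltW).
  + by apply: cvg_at_right_filter; apply: cG; rewrite lexx ltW.
  + by apply: cvg_at_left_filter; apply: cG; rewrite lexx ltW.
- move=> s; rewrite in_itv/= => /andP[as_ sb]; rewrite derive1E.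
  by have [] := dG s ltac:(by rewrite !ltW).
Qed.

(** [s] is the coordinate along [dirv b] and [t] the other one, so that a single argument covers
    both directions. *)
Definition pt (b : bool) (s t : R) : P := if b then (s, t) else (t, s).

Lemma pt_line b s t : pt b s t = pt b 0 t + s *: dirv b.
Proof.
by case: b; congr pair; rewrite /= ?scaler0 ?addr0 ?add0r// [_%:A]mulr1.
Qed.

Lemma co_pt b s t : co b (pt b s t) = s. Proof. by case: b. Qed.
Lemma co_ptN b s t : co (~~ b) (pt b s t) = t. Proof. by case: b. Qed.
Lemma pt_cont b t : continuous (fun s => pt b s t).
Proof.
rewrite (_ : (fun s => _) = fun s => pt b 0 t + s *: dirv b); last first.
  by apply/funext => s; rewrite pt_line.
by move=> s; apply: cvgD; [exact: cvg_cst|apply: cvgZ; [exact: cvg_id|exact: cvg_cst]].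
Qed.

(** The closed counterpart of [ball]: its sections are the closed segments on which [itv_FTC] is
    stated. *)
Definition box (z : P) (l : R) : set P :=
  `[z.1 - l, z.1 + l]%classic `*` `[z.2 - l, z.2 + l]%classic.

Lemma boxP z l y : box z l y <-> forall b, co b z - l <= co b y <= co b z + l.
Proof.
split => [[] /=|h]; rewrite ?in_itv/=; first by move=> h1 h2 [].
by split => /=; rewrite in_itv/=; [exact: (h true)|exact: (h false)].
Qed.

Lemma box_norm z l y : box z l y <-> `|z - y| <= l.
Proof.
rewrite boxP prodnE/=; split => [h|].
  have := h true; have := h false; rewrite /= => /andP[h1 h2] /andP[h3 h4].
  by rewrite ge_max !ler_norml; apply/andP; split; apply/andP; split; lra.
rewrite ge_max !ler_norml => /andP[/andP[h1 h2] /andP[h3 h4]] [] /=; apply/andP; split; lra.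
Qed.

Lemma measurable_box z l : measurable (box z l).
Proof. by apply: measurableX; exact: measurable_itv. Qed.

Lemma box_ball z l : box z l `<=` ball z (l + 1).
Proof. by move=> y /box_norm h; apply/ball_normP; lra. Qed.

Lemma box_pt z l b s t : box z l (pt b s t) <->
  (co b z - l <= s <= co b z + l) /\ (co (~~ b) z - l <= t <= co (~~ b) z + l).
Proof.
rewrite boxP; split => [h|[h1 h2] b'].
  by have := h b; have := h (~~ b); rewrite co_pt co_ptN.
by case: b b' h1 h2 => -[].
Qed.

(* Integrating first along direction [b] avoids the singularity at [z] on all lines
   but one, so no neighbourhood of [z] has to be excised. *)
Lemma box_FTC (z : P) (l : R) b (W H : P -> R) : 0 < l ->
  lam2.-integrable (box z l) (EFin \o H) ->
  (forall y, box z l y -> co (~~ b) y != co (~~ b) z ->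
     is_derive y (dirv b) W (H y) /\ {for y, continuous H}) ->
  measurable_fun `[co (~~ b) z - l, co (~~ b) z + l]
    (fun t => W (pt b (co b z + l) t) - W (pt b (co b z - l) t)) ->
  \int[lam2]_(y in box z l) H y =
  \int[lam]_(t in `[co (~~ b) z - l, co (~~ b) z + l])
    (W (pt b (co b z + l) t) - W (pt b (co b z - l) t)).
Proof.
move=> l0 iH dW mW.
set a := co b z; set c := co (~~ b) z.
set Wd := fun t => _ - _.
have mB2 : @measurable _ P2 (box z l) := measurable_box z l.
pose f := EFin \o (H \_ (box z l)).
have intf : lam2.-integrable setT f.
  rewrite /f -restrict_EFin; apply/integrable_restrict => //.
  by rewrite setTI.
have inner t : t != c ->
    (\int[lam]_s f (pt b s t) = ((Wd \_ `[c - l, c + l]) t)%:E)%E.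
  move=> tc; rewrite [in RHS]patchE; case: ifPn => [|tI].
    rewrite inE/= in_itv/= => tI.
    have ab : a - l < a + l by lra.
    have bx s : a - l <= s <= a + l -> box z l (pt b s t) by move=> sI; apply/box_pt.
    have nx s : co (~~ b) (pt b s t) != co (~~ b) z by rewrite co_ptN.
    have h1 (s : R) : a - l <= s <= a + l -> is_derive s 1 (fun s => W (pt b s t)) (H (pt b s t)).
      move=> sI; rewrite (_ : (fun s => _) = fun s => W (pt b 0 t + s *: dirv b)); last first.
        by apply/funext => s'; rewrite pt_line.
      apply: is_derive_line; rewrite -pt_line.
      by have [] := dW (pt b s t) (bx s sI) (nx s).
    have h2 (s : R) : a - l <= s <= a + l -> {for s, continuous (fun s => H (pt b s t))}.
      move=> sI; apply: (@continuous_comp _ _ _ (fun s => pt b s t) H); first exact: pt_cont.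
      by have [] := dW (pt b s t) (bx s sI) (nx s).
    have E := itv_FTC ab h1 h2.
    transitivity (\int[lam]_(s in `[(a - l)%R, (a + l)%R]) (H (pt b s t))%:E)%E; last exact: E.
    rewrite [RHS]integral_mkcond; apply: eq_integral => s _ /=.
    rewrite /f /= !patchE.
    have -> : (pt b s t \in box z l) = (s \in `[a - l, a + l]%classic).
      apply/idP/idP; rewrite !inE => h.
        by have [h3 _] := (box_pt z l b s t).1 h; rewrite /= in_itv.
      by apply/box_pt; split => //; move: h; rewrite /= in_itv.
    by case: ifP.
  apply: integral0_eq => s _ /=; rewrite /f/= patchE; case: ifPn => //.
  rewrite inE => /box_pt[_ h]; exfalso; move/negP: tI; apply.
  by rewrite inE/= in_itv/=.
(* The inner variable runs along [dirv b], so [b] decides which order of Fubini's theorem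
   applies. *)
have fub : \int[lam2]_(y in box z l) H y = fine (\int[lam]_t \int[lam]_s f (pt b s t))%E.
  rewrite Rintegral_mkcond /Rintegral; congr fine; symmetry; clear inner.
  by case: b {dW mW a c Wd}; [exact: (integral21_prod_meas1 intf)|exact: (integral12_prod_meas1 intf)].
rewrite fub Rintegral_mkcond; congr fine.
apply: ae_eq_integral => //.
- clear inner fub; case: b {dW mW a c Wd};
   by [exact: (measurable_fubini_G intf)|exact: (measurable_fubini_F intf)].
- apply/measurable_EFinP.
  by apply/(measurable_restrictT _ _).1 => //; exact: measurable_itv.
exists [set c]; split; [exact: measurable_set1|exact: lebesgue_measure_set1|].
move=> t /= /not_implyP[_] h; apply: contrapT => /eqP tc; apply: h.
by rewrite inner.
Qed.

End BoxFTC.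

(** * Newton potentials of compactly supported C^1 densities are C^2 *)

Section NewtonC2.
Context {R : realType}.
Local Notation P := (R * R)%type.
Local Notation P2 := (measurableTypeR R * measurableTypeR R)%type.
Local Notation dirv := (@dirv R).
Local Notation lam2 := (@lam2 R).
Local Notation lam := (@lebesgue_measure R).

Lemma dL_derive b b' (y z : P) : y != z -> is_derive y (dirv b') (dL b ^~ z) (ddL b b' y z).
Proof.
move=> yz; have [[_ c2] p q _] := L_C2 (@open_off R z) (@offP _ _).
have h : (~` [set z]) y by move=> /eqP; exact/negP.
rewrite -q//; apply: (is_derive_ext (@open_off R z) h _ (C1_derive b' (c2 b) h)) => t tz; exact: p.
Qed.

Lemma ddL_cont b b' (y z : P) : y != z -> {for y, continuous (ddL b b' ^~ z)}.
Proof.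
move=> yz; have [[_ c2] p q _] := L_C2 (@open_off R z) (@offP _ _).
have h : (~` [set z]) y by move=> /eqP; exact/negP.
apply: (for_cont_ext (@open_off R z) h _ (C1_pcont b' (c2 b) h)) => t tz; exact: q.
Qed.

Lemma measurable_ddL b b' (S : set P) (z : P) : measurable S -> measurable_fun S (ddL b b' ^~ z).
Proof. by move=> mS; apply: (measurable_off_cont (z := z)) => // y; exact: ddL_cont. Qed.

(** An antiderivative is [2 atan ((t - c) / l)], equal to [pi/2] and [- pi/2] at the ends. The
    integral is the flux of [(y - z)/|y - z|^2] through one pair of opposite sides of a square about
    [z]; the two pairs give the [2 pi] of the Laplacian. *)
Lemma atan_flux (c l : R) : 0 < l ->
  \int[lam]_(t in `[c - l, c + l]) (2 * l / (l ^+ 2 + (t - c) ^+ 2)) = pi.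
Proof.
move=> l0; have cl : c - l < c + l by lra.
have ln0 : l != 0 by rewrite gt_eqF.
have den t : l ^+ 2 + (t - c) ^+ 2 != 0.
  by rewrite gt_eqF// ltr_pwDl ?exprn_gt0// sqr_ge0.
have dG (s : R) : c - l <= s <= c + l ->
    is_derive s 1 (fun t => 2 * atan ((t - c) / l)) (2 * l / (l ^+ 2 + (s - c) ^+ 2)).
  move=> _.
  have h1 : is_derive s 1 (fun t : R => (t - c) / l) l^-1.
    have h0 : is_derive s 1 (fun t : R => t - c) 1.
      by apply: is_derive_eq; rewrite subr0.
    have h2 := @is_deriveM _ _ _ _ _ _ _ _ h0 (is_derive_cst (l^-1) s (1 : R)).
    apply: is_derive_eq h2 _; by rewrite scaler0 add0r /GRing.scale/= mulr1.
  have h3 := is_derive_comp1 h1 (is_derive1_atan ((s - c) / l)).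
  have h4 := @is_deriveZ _ _ _ _ 2 _ _ _ h3.
  apply: is_derive_eq h4 _; rewrite /GRing.scale/=.
  have d1 : 1 + ((s - c) / l) ^+ 2 != 0.
    by rewrite gt_eqF// ltr_pwDl// sqr_ge0.
  have d2 := den s.
  rewrite (_ : 1 + ((s - c) / l) ^+ 2 = (l ^+ 2 + (s - c) ^+ 2) / l ^+ 2); last by field.
  by field; rewrite d2 ln0.
have cg (s : R) : c - l <= s <= c + l ->
    {for s, continuous (fun t => 2 * l / (l ^+ 2 + (t - c) ^+ 2))}.
  move=> _; apply: cvgM; first exact: cvg_cst.
  apply: cvgV; first exact: den.
  apply: cvgD; first exact: cvg_cst.
  have h : t - c @[t --> s] --> s - c by apply: cvgB; [exact: cvg_id|exact: cvg_cst].
  exact: (cvgM h h).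
rewrite /Rintegral (itv_FTC cl dG cg) /=.
rewrite addrAC subrr add0r addrAC subrr add0r divff// mulNr divff// atanN atan1.
by field.
Qed.

Variables (F : P -> R) (c : P) (rho rho' K : R).
Hypothesis (rho0 : 0 < rho) (rr : rho < rho').
Hypothesis (cF : C1 setT F).
Hypothesis (FK : forall y, `|F y| <= K) (dFK : forall b y, `|partial b F y| <= K).
Hypothesis F0 : forall y : P, rho <= `|c - y| -> F y = 0.

Let Y : set P := ball c rho'.
Let mY : measurable Y := measurable_ballP c rho'.
Let Yc : Y `<=` ball c rho'. Proof. by []. Qed.
Let K0 : 0 <= K. Proof. exact: le_trans (FK c). Qed.

Let Fcont y : {for y, continuous F}. Proof. exact: (C1_cont cF). Qed.
Let dFcont b y : {for y, continuous (partial b F)}. Proof. exact: (C1_pcont b cF). Qed.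
Let mF S : measurable_fun S F. Proof. exact: contT_measurable. Qed.
Let mdF b S : measurable_fun S (partial b F). Proof. exact: contT_measurable. Qed.

(** Strictly beyond [rho] the function vanishes on a neighbourhood. Hence the integration domain has
    a radius [rho'] larger than that of the support: off it the partials vanish too. *)
Lemma dF_out b y : rho < `|c - y| -> partial b F y = 0.
Proof.
move=> h; have oV : open [set y : P | rho < `|c - y|].
  rewrite (_ : [set _ | _] = (fun y : P => `|c - y|) @^-1` [set t : R | rho < t]); last by [].
  apply: open_comp => [t _|]; last exact: open_gt.
  by apply: cvg_norm; apply: cvgB; [exact: cvg_cst|exact: cvg_id].
have [_ p0] := @C1_cst R setT 0 openT.
rewrite (partial_ext (g := fun=> 0) b oV h) ?p0// => t /ltW; exact: F0.
Qed.

Lemma F_lip y z : `|F y - F z| <= 2 * K * `|z - y|.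
Proof.
have D b x : is_derive x (dirv b) F (partial b F x) by exact: (C1_derive b cF).
(* The path from [z] to [y] follows the axes, one mean value estimate per leg; this is the factor
   2. *)
pose m : P := (y.1, z.2).
have h1 : `|F (z + (y.1 - z.1) *: dirv true) - F z| <= K * `|y.1 - z.1|.
  exact: (@line_MVT R _ F (partial true F) z _ _ K (fun s _ => D true _) (fun s _ => dFK true _)).
have h2 : `|F (m + (y.2 - z.2) *: dirv false) - F m| <= K * `|y.2 - z.2|.
  exact: (@line_MVT R _ F (partial false F) m _ _ K (fun s _ => D false _) (fun s _ => dFK false _)).
have e1 : z + (y.1 - z.1) *: dirv true = m.
  by rewrite /m /Defs.dirv; congr pair; rewrite /= ?scaler0 ?addr0// [_%:A]mulr1 addrC subrK.
have e2 : m + (y.2 - z.2) *: dirv false = y.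
  by rewrite [RHS]surjective_pairing /m /Defs.dirv; congr pair; rewrite /= ?scaler0 ?addr0// [_%:A]mulr1 addrC subrK.
rewrite e1 in h1; rewrite e2 in h2.
have n1 : `|y.1 - z.1| <= `|z - y| by rewrite distrC; exact: (co_norm true z y).
have n2 : `|y.2 - z.2| <= `|z - y| by rewrite distrC; exact: (co_norm false z y).
have k1 : K * `|y.1 - z.1| <= K * `|z - y| by exact: ler_wpM2l.
have k2 : K * `|y.2 - z.2| <= K * `|z - y| by exact: ler_wpM2l.
have := ler_normD (F y - F m) (F m - F z); rewrite subrKA => h.
by apply: (le_trans h); lra.
Qed.

Lemma Rint_box_eq z l (H : P -> R) : Y `<=` box z l ->
  (forall y, ~ Y y -> H y = 0) ->
  \int[lam2]_(y in Y) H y = \int[lam2]_(y in box z l) H y.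
Proof.
move=> Yb H0; rewrite Rintegral_mkcond [RHS]Rintegral_mkcond; congr fine.
apply: eq_integral => y _; congr (_%:E); rewrite !patchE.
case: ifPn => [|yY].
  by rewrite inE => /Yb yb; rewrite mem_set.
by rewrite H0; [case: ifP|move=> h; move/negP: yY; apply; rewrite inE].
Qed.

Let outY y : ~ Y y -> rho < `|c - y|.
Proof. by move=> h; apply: (lt_le_trans rr); rewrite leNgt; apply/negP => h'; apply: h; apply/ball_normP. Qed.

Let big_box (z : P) : exists l : R, [/\ 0 < l, Y `<=` box z l & forall y : P, l <= `|z - y| -> F y = 0].
Proof.
exists (rho' + `|z - c|); split.
- by apply: ltr_pwDl; [exact: lt_trans rr|exact: normr_ge0].
- move=> y /ball_normP h; apply/box_norm.
  by have := ler_normD (z - c) (c - y); rewrite subrKA; lra.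
- move=> y h; apply: F0; have := rr.
  by have := ler_normD (z - c) (c - y); rewrite subrKA; lra.
Qed.

Let end_norm (z : P) (l : R) b (t e : R) : 0 < l -> e = l \/ e = - l -> l <= `|z - pt b (co b z + e) t|.
Proof.
move=> l0 el; apply: (le_trans _ (co_norm b z _)).
rewrite co_pt opprD addrA subrr add0r normrN.
by case: el => ->; rewrite ?normrN gtr0_norm.
Qed.

Let F_end (z : P) (l : R) b (t e : R) : 0 < l -> (forall y : P, l <= `|z - y| -> F y = 0) -> e = l \/ e = - l ->
  F (pt b (co b z + e) t) = 0.
Proof. by move=> l0 h el; apply: h; exact: end_norm. Qed.

Let neq_co b (z y : P) : co (~~ b) y != co (~~ b) z -> y != z.
Proof. by apply: contra => /eqP ->. Qed.

(** Integration by parts on a square centred at the pole and so large that [F] vanishes on its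
    sides. The derivative passes from kernel to density, so a second derivative of the potential is
    a first derivative of the potential of [partial b F], within reach of [newt_C1]. *)
Lemma newt_ibp b z : dnewt Y F b z = newt Y (partial b F) z.
Proof.
have [l [l0 Yl Fl]] := big_box z.
rewrite /dnewt /newt (Rint_box_eq Yl); last first.
  by move=> y /outY /ltW /F0 ->; rewrite mulr0.
rewrite (Rint_box_eq Yl); last first.
  by move=> y /outY h; rewrite dF_out// mulr0.
have mB := @measurable_box R z l.
have mB2 : @measurable _ P2 (box z l) := mB.
have Bb := @box_ball R z l.
have mFb : measurable_fun (box z l) F by exact: mF.
have mdFb b' : measurable_fun (box z l) (partial b' F) by exact: mdF.
have i1 : lam2.-integrable (box z l) (EFin \o (fun y => dL b z y * F y)).
  exact: (integrable_dLf mB Bb mFb K0 (fun y _ => FK y)).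
have i2 : lam2.-integrable (box z l) (EFin \o (fun y => L z y * partial b F y)).
  exact: (integrable_Lf mB Bb (mdFb b) K0 (fun y _ => dFK b y)).
apply/eqP; rewrite -subr_eq0 -opprB oppr_eq0 -RintegralB//; apply/eqP.
pose W y := L y z * F y.
rewrite (@box_FTC R z l b W _ l0).
- rewrite (_ : (fun t => _) = fun=> 0).
    by rewrite Rintegral_cst ?mul0r//; exact: measurable_itv.
  apply/funext => t; rewrite /W (F_end b t l0 Fl (or_introl erefl)).
  by rewrite (F_end b t l0 Fl (or_intror erefl)) !mulr0 subrr.
- exact: (RintegrableB mB2 i2 i1).
- move=> y _ /neq_co yz; split.
    have h1 := L_derive b yz; have h2 := C1_derive b cF (I : setT y).
    apply: is_derive_eq (is_deriveM h1 h2) _.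
    rewrite dLC /GRing.scale/= (LC z y); ring.
  apply: cvgB; apply: cvgM; by [exact: L_off_cont|exact: dL_off_cont|exact: Fcont|exact: dFcont].
- rewrite (_ : (fun t => _) = fun=> 0); first exact: measurable_cst.
  apply/funext => t; rewrite /W (F_end b t l0 Fl (or_introl erefl)).
  by rewrite (F_end b t l0 Fl (or_intror erefl)) !mulr0 subrr.
Qed.

(* The [b]-component of the divergence of (F - F z) V, where V(y) = (y - z) / |y - z|^2
   is divergence free; F vanishes on the sides of the box, so the flux is that of - F z V,
   namely - pi F z through each pair of opposite sides. *)
Let H b z (y : P) := dL b y z * partial b F y + (F y - F z) * ddL b b y z.

(** Subtracting [F z] gains a factor [|y - z|] by [F_lip] and turns the non-integrable [1/|y - z|^2]
    into [1/|y - z|]; [6 = 2 * 3] from [F_lip] and [ddL_bound]. *)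
Let Fz_bnd b z y : `|(F y - F z) * ddL b b y z| <= 6 * K * pk z y.
Proof.
have [->|yz] := eqVneq y z; first by rewrite subrr mul0r normr0 !mulr_ge0 ?pk_ge0.
have n0 : 0 < `|y - z| by rewrite normr_gt0 subr_eq0.
rewrite normrM; apply: (@le_trans _ _ ((2 * K * `|z - y|) * (3 / `|y - z| ^+ 2))).
  by apply: ler_pM => //; [exact: F_lip|exact: ddL_bound].
rewrite le_eqVlt; apply/orP; left; apply/eqP; rewrite /pk (distrC z y); field.
by rewrite gt_eqF.
Qed.

Let integrable_Fz b z l : lam2.-integrable (box z l) (EFin \o (fun y => (F y - F z) * ddL b b y z)).
Proof.
have mB := @measurable_box R z l.
apply: (pk_dom mB (@box_ball R z l) (c := 6 * K) (z := z) (z' := z)).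
  apply: measurable_funM; last exact: measurable_ddL.
  by apply: measurable_funB => //; exact: mF.
by move=> y _; apply: (le_trans (Fz_bnd b z y)); apply: ler_wpM2l; rewrite ?mulr_ge0// lerDl pk_ge0.
Qed.

Let integrable_dLdF b z l : lam2.-integrable (box z l) (EFin \o (fun y => dL b z y * partial b F y)).
Proof.
have mB := @measurable_box R z l.
apply: (integrable_dLf mB (@box_ball R z l) _ K0 (fun y _ => dFK b y)); exact: mdF.
Qed.

Let sq_pt b (s t : R) (z : P) : sq (pt b s t) z = (s - co b z) ^+ 2 + (t - co (~~ b) z) ^+ 2.
Proof. by case: b; rewrite /sq //= addrC. Qed.

Let flux b (z : P) (l : R) : 0 < l -> (forall y : P, l <= `|z - y| -> F y = 0) ->
  \int[lam2]_(y in box z l) H b z y = - (pi * F z).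
Proof.
move=> l0 Fl.
have mB := @measurable_box R z l.
have mB2 : @measurable _ P2 (box z l) := mB.
pose W y := dL b y z * (F y - F z).
pose k t : R := 2 * l / (l ^+ 2 + (t - co (~~ b) z) ^+ 2).
have WE t : W (pt b (co b z + l) t) - W (pt b (co b z - l) t) = k t * - F z.
  rewrite /W (F_end b t l0 Fl (or_introl erefl)) (F_end b t l0 Fl (or_intror erefl)).
  rewrite /dL !sq_pt !co_pt /k (_ : co b z + l - co b z = l); last by ring.
  rewrite (_ : co b z - l - co b z = - l); last by ring.
  by rewrite sqrrN; ring.
have den t : l ^+ 2 + (t - co (~~ b) z) ^+ 2 != 0.
  by rewrite gt_eqF// ltr_pwDl ?exprn_gt0// sqr_ge0.
have ck : continuous k.
  move=> s; apply: cvgM; first exact: cvg_cst.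
  apply: cvgV; first exact: den.
  apply: cvgD; first exact: cvg_cst.
  have h : t - co (~~ b) z @[t --> s] --> s - co (~~ b) z.
    by apply: cvgB; [exact: cvg_id|exact: cvg_cst].
  exact: (cvgM h h).
have WE' : (fun t => W (pt b (co b z + l) t) - W (pt b (co b z - l) t)) = fun t => k t * - F z.
  by apply/funext => t; rewrite WE.
rewrite (@box_FTC R z l b W (H b z) l0).
- rewrite WE' RintegralZr//; first by rewrite atan_flux// mulrN.
  apply: continuous_compact_integrable; first exact: segment_compact.
  exact: continuous_subspaceT.
- apply: (RintegrableD mB2); last exact: integrable_Fz.
  have := RintegrableZ (-1) mB2 (integrable_dLdF b z l).
  by apply: eq_integrable => // y _ /=; rewrite mulN1r dLC mulNr opprK.
- move=> y _ /neq_co yz; split.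
    have h1 := dL_derive b b yz; have h2 := C1_derive b cF (I : setT y).
    have h3 : is_derive y (dirv b) (fun y => F y - F z) (partial b F y).
      by apply: is_derive_eq (is_deriveB h2 (is_derive_cst (F z) y (dirv b))) _; rewrite subr0.
    exact: is_derive_eq (is_deriveM h1 h3) _.
  apply: cvgD; apply: cvgM.
  + exact: dL_contl.
  + exact: dFcont.
  + by apply: cvgB; [exact: Fcont|exact: cvg_cst].
  + exact: ddL_cont.
- by rewrite WE'; apply: measurable_funTS; apply: measurable_funM => //; exact: continuous_measurable_fun.
Qed.

(** Adding the two directions cancels the terms in [ddL], since the logarithm is harmonic; what is
    left on one side are the two fluxes [- (pi * F z)]. *)
Lemma newt_grad z : dnewt Y (partial true F) true z + dnewt Y (partial false F) false z = 2 * pi * F z.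
Proof.
have [l [l0 Yl Fl]] := big_box z.
have mB := @measurable_box R z l.
have mB2 : @measurable _ P2 (box z l) := mB.
have E b : dnewt Y (partial b F) b z = \int[lam2]_(y in box z l) (dL b z y * partial b F y).
  by rewrite /dnewt (Rint_box_eq Yl)// => y /outY h; rewrite dF_out// mulr0.
have A b : \int[lam2]_(y in box z l) H b z y = - dnewt Y (partial b F) b z +
    \int[lam2]_(y in box z l) ((F y - F z) * ddL b b y z).
  rewrite E -mulN1r -RintegralZl//.
  rewrite -RintegralD//; first by apply: eq_Rintegral => y _; rewrite /H dLC mulN1r mulNr.
    exact: (RintegrableZ (-1) mB2 (integrable_dLdF b z l)).
have Z : \int[lam2]_(y in box z l) ((F y - F z) * ddL true true y z) +
         \int[lam2]_(y in box z l) ((F y - F z) * ddL false false y z) = 0.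
  rewrite -RintegralD//.
  rewrite (_ : (fun y => _) = fun=> 0); first by rewrite Rintegral_cst ?mul0r.
  apply/funext => y; rewrite -mulrDr.
  have [->|yz] := eqVneq y z; first by rewrite subrr mul0r.
  suff -> : ddL true true y z + ddL false false y z = 0 by rewrite mulr0.
  have := sq_gt0 yz; rewrite /ddL /sq /= => s0.
  by field; rewrite gt_eqF.
have f1 := flux true l0 Fl; have f2 := flux false l0 Fl.
rewrite (A true) in f1; rewrite (A false) in f2.
move: Z f1 f2; move: (dnewt _ _ true z) (dnewt _ _ false z) (Rintegral _ _ _) (Rintegral _ _ _).
by move=> a1 a2 a3 a4 Z f1 f2; lra.
Qed.

Lemma newt_C2 : C2 setT (newt Y F) /\ (forall z, lap (newt Y F) z = 2 * pi * F z).
Proof.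
have [c1 p1] := newt_C1 mY Yc (@mF Y) K0 (fun y _ => FK y).
have C b := newt_C1 mY Yc (@mdF b Y) K0 (fun y _ => dFK b y).
have p b z : partial b (newt Y F) z = newt Y (partial b F) z by rewrite p1 newt_ibp.
split.
  split; first exact: c1.
  by move=> b; apply: (C1_ext openT _ (proj1 (C b))) => z _; rewrite p.
move=> z.
have q b : partial b (partial b (newt Y F)) z = dnewt Y (partial b F) b z.
  rewrite -(proj2 (C b)); apply: (partial_ext b openT I) => t _; exact: p.
by rewrite /lap (q true) (q false) newt_grad.
Qed.

End NewtonC2.

(** * Exterior points of a C^1 domain *)

Section DomainGeometry.
Context {R : realType}.
Local Notation P := (R * R)%type.
Implicit Types (D : set P).

Lemma sq_cont (p : P) : continuous (sq p).
Proof.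
move=> x; have h b : co b p - co b y @[y --> x] --> co b p - co b x.
  by apply: cvgB; [exact: cvg_cst|exact: co_cont].
by apply: cvgD; [exact: (cvgM (h true) (h true))|exact: (cvgM (h false) (h false))].
Qed.

Lemma not_closure_ball D (x : P) : ~ closure D x -> exists d : R, 0 < d /\ forall y, closure D y -> d <= `|x - y|.
Proof.
move=> nx; have oU : open (~` closure D) by apply: closed_openC; exact: closed_closure.
have [d [d0 dU]] := open_ball_sub oU nx.
exists d; split => // y Dy; rewrite leNgt; apply/negP => h.
by have := dU y; rewrite ball_normP => /(_ h); exact.
Qed.

Lemma open_not_closure D (U : set P) (x : P) : open U -> U x ->
  (forall y, U y -> ~ D y) -> ~ closure D x.
Proof.
move=> oU Ux UD cx; have [y [Dy Uy]] := cx U (open_near oU Ux); exact: (UD y).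
Qed.

Lemma edist_sq (p x : P) (r : R) : 0 < r -> Defs.edist p x < r <-> sq p x < r ^+ 2.
Proof.
move=> r0; have -> : Defs.edist p x = Num.sqrt (sq p x) by rewrite sqC.
have s0 : 0 <= sq p x by rewrite addr_ge0 ?sqr_ge0.
split => h.
  by rewrite -(sqr_sqrtr s0) ltrXn2r ?nnegrE ?sqrtr_ge0// ltW.
by rewrite -(gtr0_norm r0) -sqrtr_sqr ltr_sqrt// exprn_gt0.
Qed.

Lemma open_lt2 (f h : P -> R) : continuous f -> continuous h -> open [set x | f x < h x].
Proof.
move=> cf ch; rewrite (_ : [set _ | _] = (fun x => h x - f x) @^-1` [set t : R | 0 < t]).
  apply: open_comp => [x _|]; last exact: open_gt.
  by apply: cvgB; [exact: ch|exact: cf].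
by apply/seteqP; split => x /=; rewrite subr_gt0.
Qed.

(* The exterior points [e n] approach [p] along the normal; the cone condition
   bounds the distance to [p] by the distance to [e n], uniformly in [n]. *)
Lemma exterior_cone D (p : P) : C1_domain D -> boundary D p ->
  exists (C : R) (e : nat -> P), [/\ 0 < C, e @ \oo --> p,
    forall n, ~ closure D (e n), forall n, e n != p &
    forall n x, boundary D x -> sq p x <= C * sq (e n) x].
Proof.
move=> [oD [_ [_ [_ H]]]] bp; have [a [b [r [gam [ab r0 dg cg DE]]]]] := H p bp.
(* Rotated orthonormal coordinates in which [D] near [p] is the region [t > gam s]. *)
pose s (x : P) := a * x.1 + b * x.2; pose t (x : P) := - b * x.1 + a * x.2.
have cs : continuous s.
  move=> x; apply: cvgD; (apply: cvgM; first exact: cvg_cst).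
    exact: (@co_cont R true x).
  exact: (@co_cont R false x).
have ct : continuous t.
  move=> x; apply: cvgD; (apply: cvgM; first exact: cvg_cst).
    exact: (@co_cont R true x).
  exact: (@co_cont R false x).
have cgam : continuous gam.
  by move=> x; apply/differentiable_continuous/derivable1_diffP; exact: dg.
have cgs : continuous (gam \o s) by move=> x; apply: continuous_comp; [exact: cs|exact: cgam].
have sqE x y : sq x y = (s x - s y) ^+ 2 + (t x - t y) ^+ 2.
  rewrite /sq /s /t; transitivity ((a ^+ 2 + b ^+ 2) * ((x.1 - y.1) ^+ 2 + (x.2 - y.2) ^+ 2)).
    by rewrite ab mul1r.
  ring.
have below x : sq p x < r ^+ 2 -> t x < gam (s x) -> ~ closure D x.
  move=> px tx.
  apply: (@open_not_closure D ([set x | sq p x < r ^+ 2] `&` [set x | t x < gam (s x)])) => //.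
    apply: openI; last exact: (open_lt2 ct cgs).
    by apply: (@open_lt2 (sq p) (fun=> r ^+ 2)) => y; [exact: sq_cont|exact: cvg_cst].
  move=> y [/= /(edist_sq p y r0)/DE Dy ty] /Dy; rewrite -/(t y) -/(s y) => ty'.
  by have := lt_trans ty ty'; rewrite ltxx.
have on_graph x : boundary D x -> sq p x < r ^+ 2 -> t x = gam (s x).
  move=> [cx nx] px; apply/eqP; rewrite eq_le; apply/andP; split; rewrite leNgt; apply/negP => h.
    by apply: nx; apply/(DE x) => //; apply/edist_sq.
  exact: (below x px h).
have pp : sq p p < r ^+ 2 by rewrite sqE !subrr expr0n /= addr0 exprn_gt0.
(* Near [s p] the difference quotient of [gam] is within 1 of the derivative [d], which gives the
   slope [K = |d| + 1] of the cone. *)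
have [K [eta [K0 eta0 lip]]] : exists K eta : R, [/\ 0 <= K, 0 < eta &
    forall x, `|x - s p| < eta -> `|gam x - gam (s p)| <= K * `|x - s p|].
  have dg0 : is_derive (s p) 1 gam ('D_1 gam (s p)) by split => //; exact: dg.
  have := cvg_is_derive dg0; set d := 'D_1 gam (s p) => /cvgrPdist_lt /(_ 1 ltr01).
  rewrite near_withinE => /nbhs_ballP[eta /= eta0 h].
  exists (`|d| + 1), eta; split => //.
  move=> x xe; have [->|xp] := eqVneq x (s p); first by rewrite !subrr !normr0 mulr0.
  have xp0 : x - s p != 0 by rewrite subr_eq0.
  have := h (x - s p); rewrite -ball_normE /= sub0r normrN => /(_ xe xp0).
  rewrite [_%:A]mulr1 (addrC (s p)) subrK => h1.
  have h2 : `|(x - s p)^-1 * (gam x - gam (s p))| <= `|d| + 1.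
    rewrite -lerBlDl; apply: (le_trans _ (ltW h1)).
    by rewrite distrC; exact: (le_trans (ler_norm _) (ler_dist_dist _ _)).
  by move: h2; rewrite normrM normfV mulrC ler_pdivrMr ?normr_gt0.
pose r' := Num.min r eta.
have r'0 : 0 < r' by rewrite lt_min r0 eta0.
have r'r : r' <= r by rewrite ge_min lexx.
have r'e : r' <= eta by rewrite ge_min lexx orbT.
clearbody r'.
pose q n : R := r' / 2 / n.+1%:R.
have q0 n : 0 < q n by rewrite !divr_gt0.
have qr n : q n <= r' / 2.
  rewrite ler_pdivrMr// ler_peMr ?ler1n// divr_ge0// ltW//.
(* [p] moved by [q n] against the normal [(- b, a)]: [s] is unchanged and [t] drops by [q n], so the
   point lies below the graph. *)
pose e n : P := (p.1 + b * q n, p.2 - a * q n).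
have se n : s (e n) = s p by rewrite /s /e /=; ring.
have te n : t (e n) = t p - q n.
  by rewrite /t /e /= -[q n in RHS]mul1r -ab; ring.
have qc : q @ \oo --> (0 : R).
  rewrite -(mulr0 (r' / 2)); apply: cvgM; first exact: cvg_cst.
  exact: cvg_harmonic.
(* For [x] within [r'] of [p] the graph has slope at most [K] seen from [p], and [1 + K^2] works.
   Farther away [q n <= r'/2] is at most half the distance from [p] to [x], and 4 works. *)
exists (4 + K ^+ 2), e; split.
- by rewrite ltr_pwDl// sqr_ge0.
- rewrite [X in _ --> X](_ : p = (p.1 + b * 0, p.2 - a * 0)); last first.
    by rewrite !mulr0 subr0 addr0 -surjective_pairing.
  apply: (@cvg_pair _ _ _ _ (nbhs (p.1 + b * 0)) (nbhs (p.2 - a * 0))).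
    by apply: cvgD; [exact: cvg_cst|apply: cvgM; [exact: cvg_cst|exact: qc]].
  by apply: cvgB; [exact: cvg_cst|apply: cvgM; [exact: cvg_cst|exact: qc]].
- move=> n; apply: below.
    rewrite sqE se te subrr expr0n /= add0r opprB addrC subrK.
    have h1 := q0 n; have h2 := qr n.
    have hq : q n < r by move: h2 r'r r'0; clear; move: (q n) => u *; lra.
    by rewrite ltr_pXn2r ?nnegrE ?(ltW (q0 n)) ?(ltW r0).
  by rewrite se te (on_graph p bp pp) ltrBlDr ltrDl.
- move=> n; apply/eqP => h; have := te n; rewrite h => h'.
  by have := q0 n; lra.
- move=> n x bx.
  have [px|px] := ltP (sq p x) (r' ^+ 2).
    have pxr : sq p x < r ^+ 2.
      by apply: (lt_le_trans px); rewrite lerXn2r ?nnegrE// ltW.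
    have sx : `|s x - s p| < eta.
      apply: lt_le_trans r'e.
      rewrite -(ltr_pXn2r (_ : 0 < 2)%N) ?nnegrE ?(ltW r'0)// real_normK ?num_real//.
      by apply: le_lt_trans px; rewrite sqE -(sqrrN (s p - s x)) opprB lerDl sqr_ge0.
    have l := lip _ sx; rewrite -(on_graph x bx pxr) -(on_graph p bp pp) in l.
    have l2 : (t p - t x) ^+ 2 <= K ^+ 2 * (s p - s x) ^+ 2.
      rewrite -exprMn -(real_normK (num_real (t p - t x))) -(real_normK (num_real (K * _))).
      by rewrite lerXn2r ?nnegrE// normrM (ger0_norm K0) distrC (distrC (s p)).
    rewrite !sqE se; have h1 := sqr_ge0 (s p - s x); have h2 := sqr_ge0 (t (e n) - t x).
    have h3 := sqr_ge0 K.
    have h4 : 0 <= K ^+ 2 * (t (e n) - t x) ^+ 2 by rewrite mulr_ge0.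
    by rewrite mulrDr !mulrDl; lra.
  have h1 : sq p x <= 2 * sq (e n) x + 2 * q n ^+ 2.
    rewrite !sqE se te.
    have -> : t p - q n - t x = (t p - t x) - q n by ring.
    set u := s p - s x; set v := t p - t x.
    have := sqr_ge0 u; have := sqr_ge0 (v - 2 * q n); nra.
  have h2 : q n ^+ 2 <= sq p x / 4.
    have : q n ^+ 2 <= (r' / 2) ^+ 2 by rewrite lerXn2r ?nnegrE ?divr_ge0 ?(ltW (q0 n)) ?(ltW r'0).
    have e4 : (r' / 2) ^+ 2 = r' ^+ 2 / 4 by field.
    by rewrite e4 => h; apply: (le_trans h); rewrite ler_pM2r// invr_gt0.
  have h3 : 0 <= sq (e n) x by rewrite addr_ge0 ?sqr_ge0.
  have h4 : 0 <= K ^+ 2 * sq (e n) x by rewrite mulr_ge0 ?sqr_ge0.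
  by rewrite mulrDl; lra.
Qed.

End DomainGeometry.

(** * Tools for the maximum principle *)

Section MaxPrinciple.
Context {R : realType}.
Local Notation P := (R * R)%type.
Local Notation dirv := (@dirv R).

(** On the line through [x] the first derivative vanishes at 0. Were the second one positive, the
    first would be positive on some []0, t]], and by the mean value theorem the function would
    exceed its maximum at [t]. *)
Lemma second_derivative_max (U : set P) (f : P -> R) (x : P) b : open U -> U x ->
  C2 U f -> (forall y, U y -> f y <= f x) -> partial b (partial b f) x <= 0.
Proof.
move=> oU Ux [cf ccf] fmax; have [r [r0 rU]] := open_ball_sub oU Ux.
pose phi (t : R) := f (x + t *: dirv b); pose dphi (t : R) := partial b f (x + t *: dirv b).
have tU (t : R) : `|t| < r -> U (x + t *: dirv b) by move=> tr; apply: rU; exact: ball_line.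
have dp (t : R) : `|t| < r -> is_derive t 1 phi (dphi t).
  by move=> tr; apply: is_derive_line; exact: (C1_derive b cf (tU t tr)).
have phi0 : phi 0 = f x by rewrite /phi scale0r addr0.
have dphi0 : dphi 0 = 0.
  have h : is_derive (0:R) 1 phi 0.
    apply: (@derive1_at_max R phi (- r) r 0).
    - by lra.
    - by move=> t; rewrite in_itv/= -ltr_norml => tr; have [] := dp t tr.
    - by rewrite in_itv/=; lra.
    - by move=> t; rewrite in_itv/= -ltr_norml => tr; rewrite phi0; apply: fmax; exact: tU.
  have [_ e1] := h; have [_ e2] := dp 0 ltac:(by rewrite normr0).
  by rewrite -e2 e1.
rewrite leNgt; apply/negP => A0; set A := partial b (partial b f) x in A0.
have := cvg_is_derive (C1_derive b (ccf b) Ux).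
move=> /cvgrPdist_lt /(_ A A0); rewrite near_withinE => /nbhs_ballP[eta /= eta0 h].
pose t := Num.min r eta / 2.
have m0 : 0 < Num.min r eta by rewrite lt_min r0 eta0.
have mr : Num.min r eta <= r by rewrite ge_min lexx.
have me : Num.min r eta <= eta by rewrite ge_min lexx orbT.
have t0 : 0 < t by rewrite divr_gt0.
have tr : t < r by rewrite /t; move: m0 mr; clear; move: (Num.min _ _) => u *; lra.
have te : t < eta by rewrite /t; move: m0 me; clear; move: (Num.min _ _) => u *; lra.
clearbody t.
have dpos (s : R) : 0 < s <= t -> 0 < dphi s.
  move=> /andP[s0 st]; have := h s; rewrite -ball_normE /= sub0r normrN gtr0_norm//.
  rewrite (gt_eqF s0) => /(_ (le_lt_trans st te) isT).
  have -> : partial b f x = 0 by rewrite -dphi0 /dphi scale0r addr0.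
  rewrite subr0 -/A -/(dphi s) ltr_norml => /andP[_ h1].
  have : 0 < s^-1 * dphi s by lra.
  by rewrite pmulr_rgt0// invr_gt0.
have [||c] := @MVT R phi dphi 0 t t0.
- move=> s; rewrite in_itv/= => /andP[s0 st]; apply: dp; rewrite gtr0_norm//; exact: lt_trans tr.
- apply: continuous_in_subspaceT => s; rewrite inE/= in_itv/= => /andP[s0 st].
  apply/differentiable_continuous/derivable1_diffP.
  by have [] := dp s ltac:(by rewrite ger0_norm//; exact: le_lt_trans tr).
rewrite in_itv/= => /andP[c0 ct]; rewrite subr0 phi0 => E.
have h1 : 0 < dphi c * t by rewrite mulr_gt0// dpos// c0 ltW.
have h2 : phi t <= f x by apply: fmax; apply: tU; rewrite gtr0_norm.
by move: h1 h2; rewrite -E; lra.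
Qed.

Lemma closure_bounded (D : set P) (M : R) : (forall x, D x -> `|x| <= M) ->
  forall x, closure D x -> `|x| <= M.
Proof.
move=> DM x cx; apply/ler_addgt0Pr => e e0.
have [y [Dy /ball_normP xy]] := cx _ (nbhsx_ballx x e e0).
have := ler_normD (x - y) y; rewrite subrK; have := DM y Dy; lra.
Qed.

Lemma bounded_closure_compact (D : set P) (M : R) : (forall x, D x -> `|x| <= M) ->
  compact (closure D).
Proof.
move=> DM; apply: (@subclosed_compact _ _ (`[- M, M]%classic `*` `[- M, M]%classic)).
- exact: closed_closure.
- by apply: compact_setX; exact: segment_compact.
- move=> x /(closure_bounded DM); rewrite prodnE ge_max !ler_norml => /andP[h1 h2].
  by split; rewrite /= in_itv.
Qed.

(** The strictly subharmonic perturbation used for the sign of the Green function. *)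
Lemma lap_sqr (U : set P) (x : P) : open U -> U x -> C2 U (fun y : P => co true y * co true y) /\
  lap (fun y : P => co true y * co true y) x = 2.
Proof.
move=> oU Ux; have [c1 p1] := C1_co true oU.
have p2 b : C1 U (fun y : P => (true == b)%:R : R) /\ _ := C1_cst ((true == b)%:R : R) oU.
have cc : C2 U (co true).
  by split => // b; apply: (C1_ext oU _ (proj1 (p2 b))) => y Uy; rewrite p1.
split; first exact: C2M.
have [c3 p3] := C1M oU c1 c1.
have q b : partial b (partial b (fun y : P => co true y * co true y)) x = 2 * (true == b)%:R.
  have [c4 p4] := C1Z (2 * (true == b)%:R) oU c1.
  rewrite (partial_ext (g := fun y => 2 * (true == b)%:R * co true y) b oU Ux).
    by rewrite p4// p1//; case: b {p4 c4} => /=; ring.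
  by move=> y Uy; rewrite p3// p1//; ring.
by rewrite /lap (q true) (q false) /= mulr0 addr0 mulr1.
Qed.

End MaxPrinciple.

(** * Potentials with a smooth harmonic kernel *)

Section KernelC2.
Context {R : realType} d (T : measurableType d).
Local Notation P := (R * R)%type.
Variable nu : {measure set T -> \bar R}.

(** Stated for any finite measure, because it serves the harmonic measures on the boundary as well
    as area, and any kernel, because it serves both the logarithm and the regular part of the Green
    function. All differentiations fall on the kernel, so a bounded measurable density is enough. *)
Lemma kernel_C2 (U : set P) (Y : set T) (k : P -> T -> R) (f : T -> R) (K B : R) :
  open U -> measurable Y -> (nu Y < +oo)%E -> measurable_fun Y f ->
  (forall y, Y y -> `|f y| <= K) ->
  (forall z, U z -> measurable_fun Y (k z)) ->
  (forall y, Y y -> C2 U (k^~ y)) ->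
  (forall z y, U z -> Y y -> `|k z y| <= B) ->
  (forall z y b, U z -> Y y -> `|partial b (k^~ y) z| <= B) ->
  (forall z y b b', U z -> Y y -> `|partial b' (partial b (k^~ y)) z| <= B) ->
  (forall z y, U z -> Y y -> lap (k^~ y) z = 0) ->
  [/\ C2 U (fun z => \int[nu]_(y in Y) (f y * k z y)),
   forall z, U z -> lap (fun z => \int[nu]_(y in Y) (f y * k z y)) z = 0,
   forall z, U z -> `|\int[nu]_(y in Y) (f y * k z y)| <= K * B * fine (nu Y),
   forall z b, U z -> `|partial b (fun z => \int[nu]_(y in Y) (f y * k z y)) z| <= K * B * fine (nu Y) &
   forall z b b', U z -> `|partial b' (partial b (fun z => \int[nu]_(y in Y) (f y * k z y))) z| <= K * B * fine (nu Y)].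
Proof.
move=> oU mY Yoo mf fK mk ck kB dkB ddkB lk.
pose h z y := f y * k z y.
have mh z : U z -> measurable_fun Y (h z).
  by move=> Uz; apply: measurable_funM => //; exact: mk.
have ch y : Y y -> C2 U (h^~ y).
  by move=> Yy; have [c _] := C2Z (f y) oU (ck y Yy).
have ph z y b : U z -> Y y -> partial b (h^~ y) z = f y * partial b (k^~ y) z.
  by move=> Uz Yy; have [_ p] := C1Z (f y) oU (C2_C1 (ck y Yy)); exact: p.
have pph z y b b' : U z -> Y y ->
    partial b' (partial b (h^~ y)) z = f y * partial b' (partial b (k^~ y)) z.
  move=> Uz Yy; have [_ p] := C1Z (f y) oU (C2_p (ck y Yy) b).
  rewrite -p//; apply: (partial_ext b' oU Uz) => t Ut; exact: ph.
have K0 y : Y y -> 0 <= K by move=> Yy; apply: le_trans (fK y Yy).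
have bnd z y (a : R) : Y y -> `|a| <= B -> `|f y * a| <= K * B.
  by move=> Yy aB; rewrite normrM; apply: ler_pM => //; exact: fK.
have hB z y : U z -> Y y -> `|h z y| <= K * B by move=> Uz Yy; apply: bnd => //; exact: kB.
have dhB z y b : U z -> Y y -> `|partial b (h^~ y) z| <= K * B.
  by move=> Uz Yy; rewrite ph//; apply: bnd => //; exact: dkB.
have ddhB z y b b' : U z -> Y y -> `|partial b' (partial b (h^~ y)) z| <= K * B.
  by move=> Uz Yy; rewrite pph//; apply: bnd => //; exact: ddkB.
have [c2 [pp [p mpp]]] := param_C2 oU mY Yoo mh ch hB dhB ddhB.
have [c1 _ mp] := param_C1 oU mY Yoo mh (fun y Yy => C2_C1 (ch y Yy)) hB dhB.
have ipp z b b' : U z -> nu.-integrable Y (EFin \o (fun y => partial b' (partial b (h^~ y)) z)).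
  by move=> Uz; apply: (Rbounded_integrable mY Yoo (mpp z b b' Uz)) => y Yy; exact: ddhB.
split.
- exact: c2.
- move=> z Uz; rewrite /lap (pp z true true Uz) (pp z false false Uz) -RintegralD//; [|exact: ipp|exact: ipp].
  rewrite (@eq_Rintegral _ _ _ _ _ (fun=> 0)); first by rewrite Rintegral_cst ?mul0r.
  move=> y; rewrite inE => Yy; rewrite (pph z y true true Uz Yy) (pph z y false false Uz Yy) -mulrDr.
  by have := lk z y Uz Yy; rewrite /lap => ->; rewrite mulr0.
- by move=> z Uz; apply: Rbounded_le => //; [exact: mh|move=> y Yy; exact: hB].
- by move=> z b Uz; rewrite (p z b Uz); apply: Rbounded_le => //; [exact: mp|move=> y Yy; exact: dhB].
- by move=> z b b' Uz; rewrite (pp z b b' Uz); apply: Rbounded_le => //; [exact: mpp|move=> y Yy; exact: ddhB].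
Qed.

Lemma log_kernel_bounds (r M : R) (z y : P) : 0 < r -> r <= `|z - y| -> `|z - y| <= M ->
  [/\ `|L z y| <= M + r^-1 + 3 / r ^+ 2, forall b, `|dL b z y| <= M + r^-1 + 3 / r ^+ 2 &
     forall b b', `|ddL b b' z y| <= M + r^-1 + 3 / r ^+ 2].
Proof.
move=> r0 h1 h2; have zy : z != y.
  by apply/eqP => E; move: h1; rewrite E subrr normr0 leNgt r0.
have n0 : 0 < `|z - y| by apply: lt_le_trans h1.
have M0 : 0 <= M by apply: le_trans h2.
have i0 : 0 < r^-1 by rewrite invr_gt0.
have i1 : `|z - y|^-1 <= r^-1 by rewrite lef_pV2.
have i2 : 0 <= 3 / r ^+ 2 by rewrite divr_ge0// exprn_ge0// ltW.
have i3 : 3 / `|z - y| ^+ 2 <= 3 / r ^+ 2.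
  by rewrite ler_pM2l// lef_pV2 ?posrE ?exprn_gt0// lerXn2r ?nnegrE ?(ltW r0).
split.
- by have := L_bound zy; lra.
- by move=> b; have := dL_bound b zy; lra.
- by move=> b b'; have := ddL_bound b b' zy; lra.
Qed.

(* [h] only transports points between two displays of the plane. *)
Lemma log_kernel_C2 (U : set P) (Y : set T) (h : T -> P) (f : T -> R) (K r M : R) :
  open U -> measurable Y -> (nu Y < +oo)%E -> measurable_fun Y f ->
  (forall y, Y y -> `|f y| <= K) ->
  (forall z, U z -> measurable_fun Y (fun y => L z (h y))) -> 0 < r ->
  (forall z y, U z -> Y y -> r <= `|z - h y| <= M) ->
  let N z := \int[nu]_(y in Y) (f y * L z (h y)) in
  let B := K * (M + r^-1 + 3 / r ^+ 2) * fine (nu Y) in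
  [/\ C2 U N, forall z, U z -> lap N z = 0, forall z, U z -> `|N z| <= B,
   forall z b, U z -> `|partial b N z| <= B &
   forall z b b', U z -> `|partial b' (partial b N) z| <= B].
Proof.
move=> oU mY Yoo mf fK mL r0 rM.
have off y : Y y -> forall z, U z -> z != h y.
  move=> Yy z Uz; apply/eqP => E; have /andP[] := rM z y Uz Yy.
  by rewrite {1}E subrr normr0 leNgt r0.
have LC2 y (Yy : Y y) := L_C2 oU (off y Yy).
have bnd z y Uz Yy := let: conj a b := andP (rM z y Uz Yy) in log_kernel_bounds r0 a b.
apply: (kernel_C2 (k := fun z y => L z (h y))) => //.
- by move=> y Yy; have [] := LC2 y Yy.
- by move=> z y Uz Yy; have [] := bnd z y Uz Yy.
- move=> z y b Uz Yy; have [_ p _ _] := LC2 y Yy.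
  by rewrite p//; have [_ k _] := bnd z y Uz Yy; exact: k.
- move=> z y b b' Uz Yy; have [_ _ p _] := LC2 y Yy.
  by rewrite p//; have [_ _ k] := bnd z y Uz Yy; exact: k.
- by move=> z y Uz Yy; have [_ _ _ l] := LC2 y Yy; exact: l.
Qed.

End KernelC2.

(** * A C^1 cutoff function *)

Section Cutoff.
Context {R : realType}.
Local Notation P := (R * R)%type.

(** The square makes the truncation C^1, which is the regularity that [newt_C2] asks of a
    density. *)
Definition pos2 (x : R) : R := Num.max x 0 ^+ 2.

Lemma pos2_derive (x : R) : is_derive x 1 pos2 (2 * Num.max x 0).
Proof.
have [x0|x0|x0] := ltgtP x 0.
- have h : is_derive x 1 (cst (0 : R)) 0 by exact: is_derive_cst.
  rewrite mulr0; apply: near_eq_is_derive h; near=> y.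
  by rewrite /pos2 max_r ?expr0n//=; apply: ltW; near: y; exact: lt_nbhsl.
- have hid := is_derive_id x (1 : R).
  have h : is_derive x 1 (fun y : R => y * y) (2 * x).
    apply: is_derive_eq (is_deriveM hid hid) _.
    by rewrite /GRing.scale/=; ring.
  apply: near_eq_is_derive h; near=> y.
  by rewrite /pos2 max_l ?expr2//; apply: ltW; near: y; exact: lt_nbhsr.
- rewrite x0 mulr0; apply: is_derive_cvg; apply/cvgrPdist_lt => e e0.
  rewrite near_withinE; near=> h => h0.
  rewrite sub0r normrN add0r [_%:A]mulr1 /pos2 maxxx expr0n/= subr0 normrM normfV.
  rewrite mulrC ltr_pdivrMr ?normr_gt0//.
  have hm : `|Num.max h 0| <= `|h|.
    by case: (leP h 0) => _; rewrite ?normr0.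
  have he : `|h| < e.
    near: h; apply/nbhs_ballP; exists e => //= h; rewrite -ball_normE /= sub0r normrN; exact.
  rewrite normrX expr2; apply: (@le_lt_trans _ _ (`|h| * `|h|)); first exact: ler_pM.
  by rewrite ltr_pM2r// normr_gt0.
Unshelve. all: by end_near. Qed.

Lemma pos2_dcont (x : R) : {for x, continuous (fun x : R => 2 * Num.max x 0)}.
Proof.
apply: cvgM; first exact: cvg_cst.
by apply: (@continuous_max _ _ id (fun=> 0)); [exact: cvg_id|exact: cvg_cst].
Qed.

Lemma C1_pos2 (U : set P) f : open U -> C1 U f -> C1 U (fun x => pos2 (f x)).
Proof.
move=> oU cf; apply: (proj1 (@C1_comp R U f pos2 (fun x => 2 * Num.max x 0) oU cf _ _)).
- by move=> x _; exact: pos2_derive.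
- by move=> x _; exact: pos2_dcont.
Qed.

(** The inner fraction is at most 0 where [sq y z <= 2 r^2], in particular within sup distance [r],
    and at least 1 where [sq y z >= 4 r^2], in particular beyond [2 r]; so the value passes from 1
    to 0 between these radii. *)
Definition cutoff (z : P) (r : R) (y : P) : R :=
  pos2 (1 - pos2 ((sq y z - 2 * r ^+ 2) / (2 * r ^+ 2))).

Lemma cutoff_C1 z r : C1 setT (cutoff z r).
Proof.
have [c1 _] := @C1_sq R setT z openT.
have [c2 _] := C1D openT c1 (proj1 (C1_cst (- (2 * r ^+ 2)) openT)).
have [c3 _] := C1Z (2 * r ^+ 2)^-1 openT c2.
have c4 := C1_pos2 openT c3.
have [c5 _] := C1Z (-1) openT c4.
have [c6 _] := C1D openT (proj1 (C1_cst 1 openT)) c5.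
have c7 := C1_pos2 openT c6.
apply: (C1_ext openT _ c7) => y _; rewrite /cutoff mulN1r.
by rewrite [_ / _]mulrC.
Qed.

Lemma pos2_01 (x : R) : x <= 1 -> 0 <= pos2 x <= 1.
Proof.
move=> x1; rewrite /pos2 sqr_ge0/= -(expr1n R 2) lerXn2r ?nnegrE ?le_max ?lexx ?orbT//.
by rewrite ge_max x1 ler01.
Qed.

Lemma cutoff_01 z r y : 0 <= cutoff z r y <= 1.
Proof. by apply: pos2_01; rewrite gerBl sqr_ge0. Qed.

Lemma cutoff1 z r y : 0 < r -> `|z - y| <= r -> cutoff z r y = 1.
Proof.
move=> r0 zy; have r20 : 0 < 2 * r ^+ 2 by rewrite mulr_gt0// exprn_gt0.
have h : sq y z <= 2 * r ^+ 2.
  apply: (le_trans (sq_le y z)); rewrite ler_pM2l// lerXn2r ?nnegrE ?(ltW r0)//.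
  by rewrite distrC.
rewrite /cutoff {2}/pos2 max_r; last by rewrite ler_pdivrMr// mul0r subr_le0.
by rewrite expr0n/= subr0 /pos2 max_l ?expr1n.
Qed.

Lemma cutoff0 z r y : 0 < r -> 2 * r <= `|z - y| -> cutoff z r y = 0.
Proof.
move=> r0 zy; have r20 : 0 < 2 * r ^+ 2 by rewrite mulr_gt0// exprn_gt0.
have h : 4 * r ^+ 2 <= sq y z.
  apply: le_trans (sq_ge y z); rewrite distrC (_ : 4 * r ^+ 2 = (2 * r) ^+ 2); last by ring.
  by rewrite lerXn2r ?nnegrE// mulr_ge0// ltW.
have h1 : 1 <= (sq y z - 2 * r ^+ 2) / (2 * r ^+ 2) by rewrite ler_pdivlMr// mul1r; lra.
have h2 : 1 <= pos2 ((sq y z - 2 * r ^+ 2) / (2 * r ^+ 2)).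
  by rewrite /pos2 exprn_ege1// le_max h1.
by rewrite /cutoff {1}/pos2 max_r ?expr0n//= subr_le0.
Qed.

End Cutoff.

(** * The truncated logarithm *)

Section TruncatedLog.
Context {R : realType}.
Local Notation P := (R * R)%type.

(** Harmonic measures are tested only on data continuous on the whole plane. This is such a
    function, and it equals [L z] on the boundary as soon as [d] is at most the squared distance
    from [z] to it. *)
Definition LT (d : R) (z y : P) : R := ln (Num.max (sq z y) d) / 2.

Lemma LT_cont (d : R) (z : P) : 0 < d -> continuous (LT d z).
Proof.
move=> d0 y; apply: cvgM; last exact: cvg_cst.
have h : {for y, continuous (sq z \max fun=> d)}.
  by apply: continuous_max; [exact: sq_cont|exact: cvg_cst].
apply: (@continuous_comp _ _ _ (sq z \max fun=> d) (@ln R)); first exact: h.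
by apply: continuous_ln; rewrite lt_max d0 orbT.
Qed.

Lemma LT_eq (d : R) (z y : P) : d <= sq z y -> LT d z y = L z y.
Proof. by move=> h; rewrite /LT max_l. Qed.

Lemma within_cont (D : set P) (f : P -> R) (x : P) : {for x, continuous f} ->
  f @ within D (nbhs x) --> f x.
Proof. by move=> cf; apply: cvg_within_filter. Qed.

End TruncatedLog.

(** * Fatou's lemma with convergent upper bounds *)

Section RealFatou.
Context d (T : measurableType d) {R : realType}.
Variable mu : {measure set T -> \bar R}.

Lemma le_limn_einf (u v : nat -> \bar R) : (forall n, u n <= v n)%E ->
  (limn_einf u <= limn_einf v)%E.
Proof.
move=> uv; rewrite !limn_einf_lim; apply: lee_lim.
- exact: is_cvg_einfs.
- exact: is_cvg_einfs.
- apply: nearW => n; apply: le_ereal_inf_tmp => _ [k /= nk <-].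
  by apply: le_trans (uv k); apply: ereal_inf_lbound; exists k.
Qed.

Lemma Rfatou (X : set T) (f : nat -> T -> R) (l : T -> R) (a : nat -> R) (b : R) :
  measurable X -> (forall n, measurable_fun X (f n)) ->
  (forall n x, X x -> 0 <= f n x) -> (forall x, X x -> f n x @[n --> \oo] --> l x) ->
  (forall n, \int[mu]_(x in X) (f n x)%:E <= (a n)%:E)%E -> a @ \oo --> b ->
  (\int[mu]_(x in X) (l x)%:E <= b%:E)%E.
Proof.
move=> mX mf f0 fl fa ab.
have mfE n : measurable_fun X (EFin \o f n) by exact/measurable_EFinP.
have F := fatou mu mX mfE (fun n x Xx => f0 n x Xx).
have E : (\int[mu]_(x in X) (l x)%:E = \int[mu]_(x in X) limn_einf (fun n => (f n x)%:E))%E.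
  apply: eq_integral => x; rewrite inE => Xx.
  have h : (f n x)%:E @[n --> \oo] --> (l x)%:E by apply: cvg_EFin; [exact: nearW|exact: fl].
  rewrite is_cvg_limn_einfE; last by apply/cvg_ex; eexists; exact: h.
  by apply/esym/cvg_lim.
rewrite E; apply: (le_trans F).
have h : (a n)%:E @[n --> \oo] --> b%:E by apply: cvg_EFin; [exact: nearW|exact: ab].
apply: (le_trans (le_limn_einf fa)).
rewrite is_cvg_limn_einfE; last by apply/cvg_ex; eexists; exact: h.
by rewrite (cvg_lim _ h).
Qed.

End RealFatou.

Section CauchyGeometric.
Context {R : realType}.

Lemma cvg_geometric_steps (a : nat -> R) (A : R) :
  (forall n, `|a n.+1 - a n| <= A / 2 ^+ n) -> cvgn a.
Proof.
move=> H; have A0 : 0 <= A by have := H 0%N; rewrite expr0 divr1; apply: le_trans.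
have h : cvgn (series (telescope a)).
  apply: normed_cvg; apply: (@series_le_cvg _ _ (geometric A (2^-1))).
  - by move=> n; exact: normr_ge0.
  - by move=> n; rewrite /geometric/= mulr_ge0// exprn_ge0.
  - by move=> n; rewrite /geometric/= exprVn; exact: H.
  - by apply: is_cvg_geometric_series; rewrite ger0_norm ?invf_lt1// ltr1n.
have -> : a = (fun n => a 0%N + series (telescope a) n).
  by apply/funext => n; rewrite [LHS](eq_sum_telescope a).
by apply: is_cvgD => //; exact: is_cvg_cst.
Qed.

End CauchyGeometric.

(** * The Green function: harmonic measures, sign and size *)

Section Green.
Context {R : realType}.
Local Notation P := (R * R)%type.
Local Notation P2 := (measurableTypeR R * measurableTypeR R)%type.
Local Notation dirv := (@dirv R).
Local Notation lam2 := (@lam2 R).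
Variables (D : set P) (u : P -> R) (g : P -> P -> R).
Variable mu : P -> {measure set P -> \bar R}.
Hypothesis D1 : C1_domain D.
Hypothesis gG : green_function D g.
Hypothesis muD : forall z, D z -> dirichlet_measure D u 0 z (mu z).

Let oD : open D. Proof. by have [] := D1. Qed.

Lemma dom_bound : exists M : R, 1 <= M /\ forall x, closure D x -> `|x| <= M.
Proof.
have [_ [_ [_ [[M DM] _]]]] := D1; exists (Num.max 1 M); split; first by rewrite le_max lexx.
by move=> x /(closure_bounded DM) h; rewrite le_max h orbT.
Qed.

Lemma closure_compactD : compact (closure D).
Proof. by have [_ [_ [_ [[M DM] _]]]] := D1; exact: (bounded_closure_compact DM). Qed.

Lemma closed_boundary : closed (boundary D).
Proof.
apply: closedI; first exact: closed_closure.
exact: open_closedC.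
Qed.

Lemma measurable_boundary : measurable (boundary D).
Proof. exact: closed_measurableP closed_boundary. Qed.

Lemma measurable_dom : measurable D.
Proof. exact: open_measurableP oD. Qed.

Lemma boundary_closure x : boundary D x -> closure D x. Proof. by case. Qed.
Lemma dom_closure x : D x -> closure D x. Proof. exact: subset_closure. Qed.
Lemma boundary_dom_neq x y : boundary D x -> D y -> x != y.
Proof. by move=> [_ nx] Dy; apply/eqP => E; apply: nx; rewrite E. Qed.
Lemma closure_dom_or x : closure D x -> D x \/ boundary D x.
Proof. by move=> cx; have [Dx|nx] := pselect (D x); [left|right; split]. Qed.

Lemma harmonic_int (h psi : P -> R) z : D z -> continuous h ->
  {within closure D, continuous psi} -> C2 D psi ->
  (forall x, D x -> lap psi x = 0) -> (forall x, boundary D x -> psi x = h x) ->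
  (\int[mu z]_(x in boundary D) (h x)%:E)%E = (psi z)%:E.
Proof.
move=> Dz ch cpsi c2 hpsi bpsi; have [_ H] := muD Dz; apply: H => //.
split => //; first exact: C2_C2_on.
by move=> x Dx; rewrite mul0r mul0r subr0 hpsi.
Qed.

Lemma mu_mass z : D z -> mu z (boundary D) = 1%E.
Proof.
move=> Dz; have [c2 l2] := C2_cst (1 : R) oD.
have := @harmonic_int (fun=> 1) (fun=> 1) z Dz.
rewrite integral_cst ?mul1e; last exact: measurable_boundary.
apply => //.
- by move=> x; exact: cvg_cst.
- by apply: continuous_subspaceT => x; exact: cvg_cst.
Qed.

Lemma mu_fin z : D z -> (mu z (boundary D) < +oo)%E.
Proof. by move=> Dz; rewrite mu_mass// ltry. Qed.

Lemma cont_bounded_int z (h : P -> R) : D z -> continuous h ->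
  (mu z).-integrable (boundary D) (EFin \o h).
Proof.
move=> Dz ch; have cb : compact (boundary D).
  apply: (subclosed_compact closed_boundary closure_compactD); exact: boundary_closure.
have [M [_ HM]] : bounded_set (h @` boundary D).
  apply: compact_bounded; apply: continuous_compact => //.
  exact: continuous_subspaceT.
apply: (@Rbounded_integrable _ _ _ (mu z) _ h (M + 1) measurable_boundary (mu_fin Dz)).
  by apply: contT_measurable => x; exact: ch.
by move=> y by_; apply: HM; [rewrite ltrDl|exists y].
Qed.

Lemma harmonic_Rint (h psi : P -> R) z : D z -> continuous h ->
  {within closure D, continuous psi} -> C2 D psi ->
  (forall x, D x -> lap psi x = 0) -> (forall x, boundary D x -> psi x = h x) ->
  \int[mu z]_(x in boundary D) h x = psi z.
Proof. by move=> *; rewrite /Rintegral (harmonic_int (psi := psi)). Qed.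

(** With its pole outside the closure, the logarithm is itself a classical solution for its own
    boundary values; truncation at [d ^+ 2], [d] a lower bound of the distance from [e], only serves
    to make these values global continuous data. *)
Lemma ext_int e w : ~ closure D e -> D w -> \int[mu w]_(x in boundary D) L e x = L e w.
Proof.
move=> ne Dw; have [d [d0 dD]] := not_closure_ball ne.
have en y : closure D y -> y != e.
  by move=> cy; apply/eqP => E; apply: ne; rewrite -E.
have [c2 _ _ l2] := L_C2 oD (fun y Dy => en y (dom_closure Dy)).
have LE : L e = L^~ e by apply/funext => t; rewrite LC.
have bE x : boundary D x -> L e x = LT (d ^+ 2) e x.
  move=> bx; rewrite LT_eq//; apply: le_trans (sq_ge e x).
  by rewrite lerXn2r ?nnegrE ?(ltW d0)// dD//; exact: boundary_closure.
rewrite (@eq_Rintegral _ _ _ _ _ (LT (d ^+ 2) e)); last by move=> x; rewrite inE; exact: bE.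
apply: (harmonic_Rint (psi := L e) Dw).
- by apply: LT_cont; rewrite exprn_gt0.
- apply/subspace_continuousP => x cx; apply: within_cont.
  by apply: L_off_cont; exact: en.
- by rewrite LE.
- by rewrite LE.
- exact: bE.
Qed.

(* The harmonic part of [g z], made 0 when the pole is not in [D]. *)
Definition hreg z : P -> R := fun w => if pselect (D z) is left Dz then
  projT1 (cid (proj1 (gG Dz))) w else 0.

Lemma hregP z : D z -> [/\ C2 D (hreg z), forall w, D w -> lap (hreg z) w = 0 &
  forall w, D w -> w != z -> g z w = L z w / (2 * pi) + hreg z w].
Proof.
move=> Dz; rewrite /hreg; case: pselect => // Dz'; case: cid => h /= [h1 [h2 h3]].
split => //; first exact: C2_on_C2.
by move=> w Dw wz; rewrite h3// ln_edist.
Qed.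

Lemma hreg_int z w : D z -> D w ->
  hreg z w = - (2 * pi)^-1 * \int[mu w]_(x in boundary D) L z x.
Proof.
move=> Dz Dw; have [c2 l2 gE] := hregP Dz.
have [_ [gc g0]] := gG Dz.
have [d [d0 dD]] := open_ball_sub oD Dz.
have zb x : boundary D x -> z != x by move=> bx; rewrite eq_sym; exact: boundary_dom_neq.
have bE x : boundary D x -> LT (d ^+ 2) z x = L z x.
  move=> [cx nx]; rewrite LT_eq//; apply: le_trans (sq_ge z x).
  rewrite lerXn2r ?nnegrE ?(ltW d0)// leNgt; apply/negP => h; apply: nx.
  by apply: dD; apply/ball_normP.
pose k := - (2 * pi)^-1 : R.
(* The harmonic part is known only inside [D]. Near the boundary it equals [g z + k * L z], where
   [g z] is continuous up to the boundary and zero on it, so this extension is continuous and is a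
   classical solution with data [k * L z]. *)
pose psi x := if pselect (D x) then hreg z x else k * L z x.
have psiE x : D x -> hreg z x = psi x by rewrite /psi; case: pselect.
have psib x : boundary D x -> psi x = k * L z x by move=> [_ nx]; rewrite /psi; case: pselect.
rewrite (psiE w Dw) -(@harmonic_Rint (fun x => k * LT (d ^+ 2) z x) psi w Dw).
- rewrite RintegralZl; first by congr (_ * _); apply: eq_Rintegral => x; rewrite inE => /bE.
    exact: measurable_boundary.
  by apply: cont_bounded_int => //; apply: LT_cont; rewrite exprn_gt0.
- move=> x; apply: cvgM; first exact: cvg_cst.
  by apply: LT_cont; rewrite exprn_gt0.
- apply/subspace_continuousP => x cx; have [Dx|bx] := closure_dom_or cx.
    apply: within_cont; apply: (for_cont_ext oD Dx psiE); exact: (C1_cont (C2_C1 c2) Dx).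
  have xz := boundary_dom_neq bx Dz.
  have Uz : \forall y \near x, y != z.
    have := open_near (@open_off R z) (fun e : x = z => elimN eqP xz e).
    by apply: filterS => y; exact: offP.
  have gcx : g z @ within (closure D) (nbhs x) --> g z x.
    rewrite (nbhs_subspace_in cx); exact: (gc x cx xz).
  have : (fun y => g z y + k * L z y) @ within (closure D) (nbhs x) --> g z x + k * L z x.
    apply: cvgD; first exact: gcx.
    by apply: cvgM; [exact: cvg_cst|apply: within_cont; exact: L_off_cont].
  rewrite g0// add0r -psib//; apply: cvg_trans; apply: near_eq_cvg.
  rewrite near_withinE; near=> y => cy.
  have yz : y != z by near: y; exact: Uz.
  have [Dy|by_] := closure_dom_or cy.
    rewrite /from_subspace gE// -psiE// /k; ring.
  by rewrite /from_subspace psib// g0// add0r.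
- exact: (C2_ext oD psiE c2).
- by move=> x Dx; rewrite -(lap_ext oD Dx psiE) l2.
- by move=> x bx; rewrite psib// bE.
Unshelve. all: by end_near. Qed.

Lemma L_near (z : P) (K : R) : exists rho : R, 0 < rho /\
  forall y, y != z -> `|z - y| < rho -> L z y <= - K.
Proof.
have e0 := expR_gt0 (- (K + K)).
exists (Num.min 1 (expR (- (K + K)) / 2)); split.
  by rewrite lt_min ltr01 divr_gt0.
move=> y yz; rewrite lt_min => /andP[y1 y2].
have s0 : 0 < sq z y by apply: sq_gt0; rewrite eq_sym.
have n0 : 0 <= `|z - y| by [].
have h : sq z y <= expR (- (K + K)).
  by apply: (le_trans (sq_le z y)); rewrite expr2; nra.
have : ln (sq z y) <= - (K + K) by rewrite -[leRHS]expRK ler_ln ?posrE.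
by rewrite /L; lra.
Qed.

(* A positive value would give an interior maximum of g z + del x1^2, whose
   Laplacian is 2 del > 0. *)
Lemma green_le0 z w : D z -> D w -> w != z -> g z w <= 0.
Proof.
move=> Dz Dw wz; rewrite leNgt; apply/negP => c0; set c := g z w in c0.
have [c2 l2 gE] := hregP Dz; have [_ [gc g0]] := gG Dz.
have [M [M1 DM]] := dom_bound.
(* The perturbation then adds at most [c/2] on the closure, so the boundary values of [G] stay below
   [c]. *)
pose del : R := c / (2 * M ^+ 2).
have M20 : 0 < 2 * M ^+ 2 by rewrite mulr_gt0// exprn_gt0//; lra.
have del0 : 0 < del by rewrite divr_gt0.
have delM x : closure D x -> 0 <= del * (co true x * co true x) <= c / 2.
  move=> /DM xM; have xx : 0 <= co true x * co true x by rewrite -expr2 sqr_ge0.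
  rewrite mulr_ge0 ?(ltW del0)//=.
  have : co true x * co true x <= M ^+ 2.
    rewrite -expr2 -(real_normK (num_real (co true x))) lerXn2r ?nnegrE//; first lra.
    by apply: le_trans xM; rewrite prodnE le_max lexx.
  rewrite (_ : c / 2 = del * M ^+ 2); last by rewrite /del; field; rewrite gt_eqF//; lra.
  by rewrite ler_pM2l.
pose G x := g z x + del * (co true x * co true x).
have Gw : c <= G w by have /andP[] := delM w (dom_closure Dw); rewrite /G -/c; lra.
have Gb x : boundary D x -> G x < c.
  by move=> bx; have /andP[] := delM x (boundary_closure bx); rewrite /G g0//; lra.
have pi2 : 0 < 2 * pi :> R by rewrite mulr_gt0// pi_gt0.
(* Near the pole the logarithm tends to minus infinity and the remaining terms stay bounded. A ball
   around [z] can be removed, and the maximum is sought on a compact set where [G] is continuous. *)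
have [rho [rho0 [rhoD Gnear]]] : exists rho : R, 0 < rho /\ ball z rho `<=` D /\
    forall x, x != z -> `|z - x| < rho -> G x < c.
  pose H0 := `|hreg z z| + 1.
  have [r1 [r10 rD]] := open_ball_sub oD Dz.
  have := C1_cont (C2_C1 c2) Dz; rewrite /prop_for /continuous_at => /cvgrPdist_lt /(_ 1 ltr01).
  move=> /nbhs_ballP[r2 /= r20 hr2].
  have [r3 [r30 hr3]] := L_near z (2 * pi * H0).
  exists (Num.min r1 (Num.min r2 r3)); split; first by rewrite !lt_min r10 r20 r30.
  split=> [x /ball_normP|x xz]; rewrite !lt_min => /and3P[x1 x2 x3].
    by apply: rD; apply/ball_normP.
  have Dx : D x by apply: rD; apply/ball_normP.
  have h1 := hr3 x xz x3.
  have h2 : `|hreg z z - hreg z x| < 1 by apply: hr2; apply/ball_normP.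
  have /andP[_ h3] := delM x (dom_closure Dx).
  rewrite /G gE//.
  have h4 : L z x / (2 * pi) <= - H0 by rewrite ler_pdivrMr// mulNr [H0 * _]mulrC.
  have h5 : hreg z x <= `|hreg z z| + 1.
    have := ler_norm (hreg z z); move: h2; rewrite ltr_norml => /andP[? ?]; lra.
  by rewrite /H0 in h4; lra.
pose K := closure D `\` ball z rho.
have oB : open (ball z rho) by exact: ball_open.
have cK : compact K.
  apply: (subclosed_compact _ closure_compactD); last by move=> x [].
  by apply: closedI; [exact: closed_closure|exact: open_closedC].
have Kz x : K x -> x != z.
  by move=> [_ nb]; apply/eqP => E; apply: nb; rewrite E; exact: ballxx.
have Kw : K w.
  split; first exact: dom_closure.
  by move=> /ball_normP h; have := Gnear w wz h; lra.
have cG : {within K, continuous G}.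
  apply/subspace_continuousP => x Kx; have [cx _] := Kx.
  have gcx : g z @ within (closure D) (nbhs x) --> g z x.
    rewrite (nbhs_subspace_in cx); exact: (gc x cx (Kz x Kx)).
  apply: cvgD.
    by apply: cvg_trans gcx => A; rewrite /fmap/= /nbhs/= /within/=; apply: filterS => y h [cy _]; exact: h.
  apply: cvgM; first exact: cvg_cst.
  by apply: within_cont; apply: cvgM; exact: co_cont.
have [m] := compact_EVT_max (ex_intro _ w Kw) cK cG; rewrite inE => Km mmax.
have Gm : c <= G m by apply: (le_trans Gw); apply: mmax; rewrite inE.
have Dm : D m.
  by have [cm _] := Km; have [//|bm] := closure_dom_or cm; have := Gb m bm; lra.
have mz := Kz m Km.
pose U := D `&` ~` [set z].
have oU : open U by apply: openI => //; exact: (@open_off R z).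
have Um : U m by split => // /eqP; exact/negP.
have Uz x : U x -> x != z by move=> [_ /offP].
have UD : U `<=` D by move=> x [].
have gU x : U x -> (2 * pi)^-1 * L x z + hreg z x + del * (co true x * co true x) = G x.
  by move=> Ux; rewrite /G gE ?(Uz x Ux)//; [rewrite LC; ring|exact: UD].
have [cL _ _ lL] := L_C2 oU Uz.
have [cL' lL'] := C2Z (2 * pi)^-1 oU cL.
have [cS lS] := lap_sqr oU Um.
have [cS' lS'] := C2Z del oU cS.
have [c3 l3] := C2D oU cL' (C2S UD c2).
have [c4 l4] := C2D oU c3 cS'.
have cGU := C2_ext oU gU c4.
have lG : lap G m = del * 2.
  rewrite -(lap_ext oU Um gU) l4// l3// lL'// lL// lS'// lS (l2 m)//.
  by rewrite mulr0 !add0r.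
have Gmax y : U y -> G y <= G m.
  move=> Uy; have [yr|yr] := ltP `|z - y| rho.
    by apply/ltW/(lt_le_trans _ Gm); exact: Gnear (Uz y Uy) yr.
  apply: mmax; rewrite inE; split; first by apply: dom_closure; exact: UD.
  by move=> /ball_normP; rewrite ltNge yr.
have t1 := second_derivative_max true oU Um cGU Gmax.
have t2 := second_derivative_max false oU Um cGU Gmax.
have : lap G m <= 0 by rewrite /lap; apply: le_trans (lerD t1 t2) _; rewrite addr0.
by rewrite lG leNgt mulr_gt0.
Qed.

Lemma L_bd_int z w : D z -> D w -> (mu w).-integrable (boundary D) (EFin \o L z).
Proof.
move=> Dz Dw; have [d [d0 dD]] := open_ball_sub oD Dz.
have bE x : boundary D x -> LT (d ^+ 2) z x = L z x.
  move=> [cx nx]; rewrite LT_eq//; apply: le_trans (sq_ge z x).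
  rewrite lerXn2r ?nnegrE ?(ltW d0)// leNgt; apply/negP => h; apply: nx.
  by apply: dD; apply/ball_normP.
have d20 : 0 < d ^+ 2 by rewrite exprn_gt0.
apply: (eq_integrable _ _ _ _ (cont_bounded_int Dw (@LT_cont R _ z d20))).
  exact: measurable_boundary.
by move=> x; rewrite inE => /bE /= ->.
Qed.

(** As [g <= 0], its modulus is [(2 pi)^-1] times the difference between the [mu w]-average of [L z]
    and [L z w]. The average is at most [2 M], which exceeds all distances in the closure, by [L_ub]
    and unit mass; [L_pk] handles the other term, and [2 M <= (2 M)^2 pk z w] merges the two. *)
Lemma green_bnd : exists C : R, 0 <= C /\
  forall z w, D z -> D w -> w != z -> `|g z w| <= C * pk z w.
Proof.
have [M [M1 DM]] := dom_bound.
have pi2 : 0 < 2 * pi :> R by rewrite mulr_gt0// pi_gt0.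
have ipi : 0 <= (2 * pi)^-1 :> R by rewrite invr_ge0 ltW.
have M0 : 0 <= 2 * M by lra.
exists ((2 * pi)^-1 * ((2 * M) ^+ 2 + ((2 * M) ^+ 2 + 1))); split.
  by rewrite mulr_ge0// !addr_ge0// sqr_ge0.
move=> z w Dz Dw wz; rewrite ler0_norm ?green_le0//.
have [_ _ ->//] := hregP Dz; rewrite (hreg_int Dz Dw).
have dist x y : closure D x -> closure D y -> `|x - y| <= 2 * M.
  by move=> /DM hx /DM hy; have := ler_normB x y; lra.
have I1 : \int[mu w]_(x in boundary D) L z x <= 2 * M.
  have -> : 2 * M = \int[mu w]_(x in boundary D) (cst (2 * M) x).
    by rewrite Rintegral_cst; [rewrite mu_mass//= mulr1|exact: measurable_boundary].
  apply: le_Rintegral; [exact: measurable_boundary|exact: L_bd_int| |].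
    apply: (cont_bounded_int Dw (h := cst (2 * M))) => x; exact: cvg_cst.
  move=> x bx; apply: (le_trans (L_ub _)); first by rewrite eq_sym; exact: boundary_dom_neq.
  by apply: dist; [exact: dom_closure|exact: boundary_closure].
have zw : z != w by rewrite eq_sym.
have n0 : 0 < `|z - w| by rewrite normr_gt0 subr_eq0.
have dzw := dist z w (dom_closure Dz) (dom_closure Dw).
have I2 : - L z w <= ((2 * M) ^+ 2 + 1) * pk z w.
  by apply: le_trans (L_pk M0 zw dzw); rewrite -normrN; exact: ler_norm.
have I3 : 2 * M <= (2 * M) ^+ 2 * pk z w.
  by rewrite /pk distrC ler_pdivlMr// expr2 ler_wpM2l.
rewrite opprD mulNr opprK -mulNr [_ / (2 * pi)]mulrC -mulrDr -mulrA ler_wpM2l//.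
by rewrite mulrDl; lra.
Qed.

(** For a nonpositive function, failure to tend to 0 shows on a sequence staying below some [- e];
    Fatou's lemma will be applied along it. *)
Lemma seq_of_not_cvg (f : P -> R) (p : P) : (forall e : R, 0 < e ->
    ~ (exists v : nat -> P, [/\ forall n, D (v n), v @ \oo --> p & forall n, f (v n) <= - e])) ->
  (forall x, D x -> f x <= 0) -> f x @[x --> within D (nbhs p)] --> 0.
Proof.
move=> H f0; apply/cvgrPdist_lt => e e0; rewrite near_withinE.
apply: contrapT => nn; apply: (H e e0).
have /choice[v Hv] : forall n : nat, exists x, D x /\ `|p - x| < n.+1%:R^-1 /\ f x <= - e.
  move=> n; apply: contrapT => h; apply: nn; apply/nbhs_ballP.
  exists n.+1%:R^-1 => /=; first by rewrite invr_gt0.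
  move=> x /ball_normP px Dx; rewrite sub0r normrN ltNge; apply/negP => ex; apply: h; exists x.
  by split => //; split => //; move: ex; rewrite ler0_norm ?f0//; lra.
exists v; split; [by move=> n; have [] := Hv n| |by move=> n; have [_ []] := Hv n].
apply/cvgrPdist_lt => d d0; near=> n.
apply: (lt_trans (Hv n).2.1); near: n; exact: near_infty_natSinv_lt (PosNum d0).
Unshelve. all: by end_near. Qed.

(** * The Green function as its pole tends to the boundary *)

Section BoundaryLimit.
Variables (p w : P).
Hypothesis (bp : boundary D p) (Dw : D w).
(** [L p] is singular at [p], so potentials are first integrated off [p] and the atom at [p] is
    treated apart. *)
Let X := boundary D `\ p.
Let mbd : measurable (boundary D) := measurable_boundary.
Let mX : measurable X. Proof. by apply: measurableD => //; exact: measurable_ptP. Qed.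

Let L_cvg (v : nat -> P) (x : P) : v @ \oo --> p -> x != p -> L (v n) x @[n --> \oo] --> L p x.
Proof.
move=> vp xp; have := @L_contl R p x; rewrite eq_sym => /(_ xp); rewrite /prop_for /continuous_at => h.
exact: (cvg_comp _ _ vp h).
Qed.

Let wp : w != p. Proof. by rewrite eq_sym; exact: boundary_dom_neq. Qed.

(* The identity int L e dmu_w = L e w for exterior points [e] passes to the boundary
   point [p]: an atom at [p] would make the left-hand side tend to -oo. *)
Lemma boundary_potential : (mu w).-integrable X (EFin \o L p) /\
  mu w [set p] = 0%E /\ \int[mu w]_(x in X) L p x = L p w.
Proof.
have [M [M1 DM]] := dom_bound.
have [C [e' [C0 e'p ne' e'np conv']]] := exterior_cone D1 bp.
have [N _ hN] := cvg_near_norm e'p (ltr01 : (0:R) < 1).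
pose e n := e' (n + N)%N.
have ep : e @ \oo --> p by exact: (cvg_comp _ _ (cvg_addnr N) e'p).
have ne n : ~ closure D (e n) by exact: ne'.
have enp n : e n != p by exact: e'np.
have cone n x : boundary D x -> sq p x <= C * sq (e n) x by exact: conv'.
have e1 n : `|p - e n| < 1 by apply: hN; rewrite /= leq_addl.
(* Bounds the distance from [e n] to any point of the closure: [e n] is within 1 of [p], and points
   of the closure have norm at most [M]. *)
pose B := 1 + 2 * M.
have B0 : 0 <= B by rewrite /B; lra.
have eb n x : boundary D x -> e n != x.
  by move=> [cx _]; apply/eqP => E; apply: (ne n); rewrite E.
have LB n x : closure D x -> L (e n) x <= B.
  move=> cx; have ex : e n != x by apply/eqP => E; apply: (ne n); rewrite E.
  apply: (le_trans (L_ub ex)); have := ler_normD (e n - p) (p - x); rewrite subrKA.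
  have := e1 n; rewrite distrC; have := ler_normB p x; have := DM x cx.
  by have := DM p (boundary_closure bp); rewrite /B; lra.
have ie n : (mu w).-integrable (boundary D) (EFin \o L (e n)).
  have [d [d0 dD]] := not_closure_ball (ne n).
  have d20 : 0 < d ^+ 2 by rewrite exprn_gt0.
  apply: (eq_integrable mbd _ _ _ (cont_bounded_int Dw (@LT_cont R _ (e n) d20))).
  move=> x; rewrite inE => bx /=; rewrite LT_eq//; apply: le_trans (sq_ge _ x).
  by rewrite lerXn2r ?nnegrE ?(ltW d0)// dD//; exact: boundary_closure.
have iX n : (mu w).-integrable X (EFin \o L (e n)).
  by apply: (integrableS mbd mX _ (ie n)) => x [].
have splitp n : \int[mu w]_(x in boundary D) L (e n) x =
    \int[mu w]_(x in X) L (e n) x + L (e n) p * fine (mu w [set p]).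
  rewrite (_ : L (e n) p * _ = \int[mu w]_(x in [set p]) L (e n) x); last first.
    rewrite -Rintegral_cst; last exact: measurable_ptP.
    by apply: eq_Rintegral => x; rewrite inE => ->.
  have E : boundary D = X `|` [set p].
    apply/seteqP; split => x; last by move=> [[]|->].
    by move=> bx; have [->|xp] := pselect (x = p); [right|left].
  rewrite {1}E Rintegral_setU//.
  - exact: measurable_ptP.
  - by rewrite -E; exact: ie.
  - by rewrite disj_set2E; apply/eqP/seteqP; split => // x [[_ h] /h].
have mXfin : (mu w X < +oo)%E.
  apply: le_lt_trans (mu_fin Dw); apply: le_measure; rewrite ?inE// => x []; done.
have mp1 : (mu w [set p] <= 1)%E.
  rewrite -(mu_mass Dw); apply: le_measure; rewrite ?inE//; first exact: measurable_ptP.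
  by move=> x ->.
have mpfin : mu w [set p] \is a fin_num.
  by rewrite ge0_fin_numE//; apply: le_lt_trans mp1 _; rewrite ltry.
have intX n : \int[mu w]_(x in X) L (e n) x <= B.
  apply: (@le_trans _ _ (\int[mu w]_(x in X) (cst B x))).
    apply: le_Rintegral => //.
      by apply: (@Rbounded_integrable _ _ _ (mu w) X (cst B) `|B|).
    by move=> x [bx _]; apply: LB; exact: boundary_closure.
  rewrite Rintegral_cst// ger_pMr; last by rewrite /B; lra.
  have mX1 : (mu w X <= 1)%E.
    by rewrite -(mu_mass Dw); apply: le_measure; rewrite ?inE// => x [].
  rewrite -lee_fin fineK//; by rewrite ge0_fin_numE.
have mp0 : mu w [set p] = 0%E.
  apply/eqP; apply: contrapT => /negP mp.
  pose m := fine (mu w [set p]).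
  have m0 : 0 < m by rewrite fine_gt0// lt0e mp measure_ge0 /= -ge0_fin_numE.
  (* An atom of mass [m] would contribute at most [- Kc * m], and the rest at most [B], so the
     integral would be at most [- |L p w| - 1]; yet it equals [L (e n) w], which is within 1 of
     [L p w]. *)
  pose Kc := (B + `|L p w| + 1) / m.
  have [rho [rho0 hrho]] := L_near p Kc.
  have a1 : \forall n \near \oo, `|p - e n| < rho by exact: cvg_near_norm.
  have a2 : \forall n \near \oo, `|L p w - L (e n) w| < 1.
    by have /cvgrPdist_lt/(_ 1 ltr01) := L_cvg ep wp.
  have [n h] := filter_ex (filterI a1 a2); case: h => h1 h2.
  have h3 : L (e n) p <= - Kc by rewrite LC; exact: hrho.
  have := ext_int (ne n) Dw; rewrite splitp -/m => h4.
  have h5 : L (e n) p * m <= - (B + `|L p w| + 1).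
    apply: (@le_trans _ _ (- Kc * m)); first by rewrite ler_pM2r.
    by rewrite /Kc mulNr divfK ?gt_eqF.
  have h6 := intX n; have h7 := ler_norm (- L p w); rewrite normrN in h7.
  move: h2; rewrite ltr_norml => /andP[h8 h9].
  by move: h4 h5 h6 h7 h8 h9; lra.
have IX n : \int[mu w]_(x in X) L (e n) x = L (e n) w.
  by rewrite -(ext_int (ne n) Dw) splitp mp0 /= mulr0 addr0.
have icst (c : R) : (mu w).-integrable X (EFin \o cst c).
  by apply: (@Rbounded_integrable _ _ _ (mu w) X (cst c) `|c|).
pose A := fine (mu w X).
(* Fatou's lemma comes first: it makes [L p] integrable off [p], and only then can [L p] enter a
   majorant for dominated convergence. *)
have iBL : (mu w).-integrable X (EFin \o (fun x => B - L p x)).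
  apply/integrableP; split.
    apply/measurable_EFinP; apply: measurable_funB => //; exact: measurable_L.
  have Bp x : X x -> 0 <= B - L p x.
    move=> [bx xp]; rewrite subr_ge0; apply: (le_trans (L_ub _)); first by rewrite eq_sym; apply/eqP.
    have := ler_normB p x; have := DM x (boundary_closure bx).
    by have := DM p (boundary_closure bp); rewrite /B; lra.
  apply: (@le_lt_trans _ _ (B * A - L p w)%:E); last by rewrite ltry.
  rewrite (eq_integral (fun x => (B - L p x)%:E)); last first.
    by move=> x; rewrite inE => Xx /=; rewrite ger0_norm// Bp.
  apply: (@Rfatou _ _ _ (mu w) X (fun n x => B - L (e n) x) _ (fun n => B * A - L (e n) w)) => //.
  - by move=> n; apply: measurable_funB => //; exact: measurable_L.
  - by move=> n x [bx _]; rewrite subr_ge0; apply: LB; exact: boundary_closure.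
  - by move=> x [bx xp]; apply: cvgB; [exact: cvg_cst|apply: L_cvg => //; apply/eqP].
  - move=> n; have h := RintegralB mX (icst B) (iX n).
    rewrite IX Rintegral_cst// in h.
    rewrite -h /Rintegral fineK//; apply: integrable_fin_num => //.
    exact: (RintegrableB mX (icst B) (iX n)).
  - by apply: cvgB; [exact: cvg_cst|exact: L_cvg].
have iLp : (mu w).-integrable X (EFin \o L p).
  have := RintegrableB mX (icst B) iBL.
  by apply: eq_integrable => // x _ /=; rewrite opprB addrC subrK.
split => //; split => //.
(* Half the logarithm of the cone condition: [L (e n)] is bounded below by [L p - c2], uniformly in
   [n]. *)
pose c2 := `|ln C| / 2.
have lower n x : X x -> L p x - c2 <= L (e n) x.
  move=> [bx /= /eqP xp]; have px : p != x by rewrite eq_sym.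
  have s1 := sq_gt0 px; have s2 := sq_gt0 (eb n x bx).
  have : ln (sq p x) <= ln (C * sq (e n) x) by rewrite ler_ln ?posrE ?mulr_gt0// cone.
  rewrite lnM ?posrE//; have := ler_norm (ln C); rewrite /L /c2; lra.
have dom : (mu w).-integrable X (EFin \o (fun x => (B + c2) + `|L p x|)).
  exact: (RintegrableD mX (icst (B + c2)) (integrable_norm iLp)).
have bnd n x : X x -> `|L (e n) x| <= B + c2 + `|L p x|.
  move=> Xx; have h1 := lower n x Xx; have h2 := LB n x (boundary_closure Xx.1).
  have h3 := ler_norm (- L p x); have c20 : 0 <= c2 by rewrite divr_ge0.
  rewrite normrN in h3; have h4 := normr_ge0 (L p x).
  by rewrite ler_norml; apply/andP; split; lra.
have [_ cv] := @Rdct _ _ _ (mu w) X (fun n => L (e n)) (L p) _ mX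
   (fun n => measurable_L (e n) mX) (fun x Xx => L_cvg ep (introN eqP Xx.2)) dom
   bnd.
have cv2 : \int[mu w]_(x in X) L (e n) x @[n --> \oo] --> L p w.
  by rewrite (eq_cvg _ _ IX); exact: L_cvg.
exact: (cvg_unique _ cv cv2).
Qed.

(* [g <= 0], and Fatou's lemma applied to [B - L z] excludes a negative limit point. *)
Lemma green_bdry : g z w @[z --> within D (nbhs p)] --> 0.
Proof.
have [iLp [mp0 ILp]] := boundary_potential.
have [M [M1 DM]] := dom_bound.
have pi2 : 0 < 2 * pi :> R by rewrite mulr_gt0// pi_gt0.
pose B := 2 * M; pose A := fine (mu w X).
have LB z x : closure D z -> closure D x -> z != x -> L z x <= B.
  move=> /DM hz /DM hx zx; apply: (le_trans (L_ub zx)).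
  by have := ler_normB z x; rewrite /B; lra.
(* [green_le0] excludes the pole; since [w != p], the value there does not affect the limit at
   [p]. *)
pose f z := if z == w then 0 else g z w.
suff h : f z @[z --> within D (nbhs p)] --> 0.
  apply: cvg_trans h; apply: near_eq_cvg; rewrite near_withinE.
  have := open_near (@open_off R w) (fun e : p = w => elimN eqP wp (esym e)).
  by apply: filterS => z /offP zw _; rewrite /f (negPf zw).
apply: seq_of_not_cvg; last first.
  by move=> z Dz; rewrite /f; case: eqP => // /eqP zw; apply: green_le0 => //; rewrite eq_sym.
move=> e e0 [v [vD vp vf]].
have vw n : v n != w.
  by apply/eqP => E; have := vf n; rewrite /f E eqxx; lra.
have gv n : g (v n) w <= - e by have := vf n; rewrite /f (negPf (vw n)).
have mXfin : (mu w X < +oo)%E.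
  apply: le_lt_trans (mu_fin Dw); apply: le_measure; rewrite ?inE// => x []; done.
have icst (c : R) : (mu w).-integrable X (EFin \o cst c).
  by apply: (@Rbounded_integrable _ _ _ (mu w) X (cst c) `|c|).
have vb n x : boundary D x -> v n != x.
  by move=> bx; rewrite eq_sym; exact: (boundary_dom_neq bx (vD n)).
have iv n : (mu w).-integrable X (EFin \o L (v n)).
  by apply: (integrableS mbd mX _ (L_bd_int (vD n) Dw)) => x [].
have Iv n : \int[mu w]_(x in X) L (v n) x = \int[mu w]_(x in boundary D) L (v n) x.
  congr fine; symmetry; apply: negligible_integral => //; first exact: measurable_ptP.
  exact: L_bd_int.
(* By [boundary_potential] the left side is exactly [B * A - L p w]: a contradiction. The excess
   [2 * pi * e] is [g (v n) w <= - e] after clearing the factor [2 pi]. *)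
have F : (\int[mu w]_(x in X) (B - L p x)%:E <= (B * A - L p w - 2 * pi * e)%:E)%E.
  apply: (@Rfatou _ _ _ (mu w) X (fun n x => B - L (v n) x) _
      (fun n => B * A - L (v n) w - 2 * pi * e)) => //.
  - by move=> n; apply: measurable_funB => //; exact: measurable_L.
  - move=> n x [bx _]; rewrite subr_ge0; apply: LB; [|exact: boundary_closure|exact: vb].
    exact: dom_closure.
  - by move=> x [bx xp]; apply: cvgB; [exact: cvg_cst|apply: L_cvg => //; apply/eqP].
  - move=> n; have h := RintegralB mX (icst B) (iv n).
    have i2 := RintegrableB mX (icst B) (iv n).
    have := integrable_fin_num mX i2 => hf; rewrite -(fineK hf) lee_fin -/(Rintegral _ _ _) h.
    rewrite Rintegral_cst// Iv -/A.
    have [_ _ gE] := hregP (vD n); have := gv n; rewrite gE//; last by rewrite eq_sym.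
    rewrite (hreg_int (vD n) Dw); set I := Rintegral _ _ _ => hh.
    have : (L (v n) w / (2 * pi) + - (2 * pi)^-1 * I) * (2 * pi) <= - e * (2 * pi) by rewrite ler_pM2r.
    have -> : (L (v n) w / (2 * pi) + - (2 * pi)^-1 * I) * (2 * pi) = L (v n) w - I.
      by move: (pi_gt0 R); move: (pi : R) => q q0; field; exact: lt0r_neq0.
    by move=> h3; rewrite mulNr (mulrC e) in h3; lra.
  - by apply: cvgB; [apply: cvgB; [exact: cvg_cst|exact: L_cvg]|exact: cvg_cst].
have h := RintegralB mX (icst B) iLp.
rewrite ILp Rintegral_cst// -/A in h.
have i2 := RintegrableB mX (icst B) iLp.
have hf := integrable_fin_num mX i2.
move: F; rewrite -(fineK hf) lee_fin -/(Rintegral _ _ _) h.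
have := mulr_gt0 pi2 e0; lra.
Qed.

End BoundaryLimit.

(** * The Green operator: bounds, boundary values and regularity *)

Let mD : measurable D := measurable_dom.
Let mD2 : @measurable _ P2 D := mD.

Lemma dom_ball : exists M : R, [/\ 1 <= M, D `<=` ball (0 : P) M &
  forall x y, closure D x -> closure D y -> `|x - y| < M].
Proof.
have [M [M1 DM]] := dom_bound; exists (2 * M + 1); split; first lra.
  move=> x Dx; apply/ball_normP; rewrite sub0r normrN.
  by have := DM x (dom_closure Dx); lra.
by move=> x y /DM hx /DM hy; have := ler_normB x y; lra.
Qed.

Lemma dom_fin : (lam2 D < +oo)%E.
Proof. by have [M [_ DM _]] := dom_ball; exact: (lam2_fin mD2 DM). Qed.

(** By [hreg_int], the pole enters only through logarithms with singularities on the boundary, at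
    distance at least [r] from the smaller ball. The bound is uniform in [w] because each [mu w] has
    mass one. *)
Lemma hreg_pole z0 (r : R) : 0 < r -> ball z0 (2 * r) `<=` D -> exists B : R, [/\ 0 <= B,
  forall w, D w -> C2 (ball z0 r) (hreg^~ w),
  forall w, D w -> forall z, ball z0 r z -> lap (hreg^~ w) z = 0 &
  forall w, D w -> forall z, ball z0 r z -> [/\ `|hreg z w| <= B,
    forall b, `|partial b (hreg^~ w) z| <= B &
    forall b b', `|partial b' (partial b (hreg^~ w)) z| <= B]].
Proof.
move=> r0 rD; have [M [M1 DM dM]] := dom_ball.
have oU : open (ball z0 r) by exact: ball_open.
have UD : ball z0 r `<=` D.
  by move=> z /ball_normP h; apply: rD; apply/ball_normP; lra.
pose a : R := - (2 * pi)^-1.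
pose B := M + r^-1 + 3 / r ^+ 2.
have B0 : 0 <= B by rewrite !addr_ge0 ?divr_ge0 ?invr_ge0 ?exprn_ge0 ?(ltW r0)//; lra.
have far z x : ball z0 r z -> boundary D x -> r <= `|z - x| <= M.
  move=> Uz bx; apply/andP; split; last first.
    by apply/ltW/dM; [exact/dom_closure/UD|exact: boundary_closure].
  rewrite leNgt; apply/negP => h2; have [_ nx] := bx; apply: nx; apply: rD; move: Uz => /ball_normP h.
  apply/ball_normP; rewrite (_ : z0 - x = (z0 - z) + (z - x)); last by rewrite subrKA.
  by apply: (le_lt_trans (ler_normD _ _)); lra.
have HC w : D w -> [/\ C2 (ball z0 r) (hreg^~ w), forall z, ball z0 r z -> lap (hreg^~ w) z = 0 &
  forall z, ball z0 r z -> [/\ `|hreg z w| <= `|a| * B,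
    forall b, `|partial b (hreg^~ w) z| <= `|a| * B &
    forall b b', `|partial b' (partial b (hreg^~ w)) z| <= `|a| * B]].
  move=> Dw.
  have E z : ball z0 r z -> \int[mu w]_(y in boundary D) (a * L z y) = hreg z w.
    move=> Uz; rewrite (hreg_int (UD z Uz) Dw) RintegralZl//.
      exact: measurable_boundary.
    by apply: (L_bd_int) => //; exact: UD.
  have [] := @log_kernel_C2 R _ _ (mu w) (ball z0 r) (boundary D) id (fun=> a) `|a| r M oU
    (measurable_boundary) (mu_fin Dw) (measurable_cst _) (fun _ _ => lexx _) _ r0 far.
    by move=> z _; apply: measurable_L; exact: measurable_boundary.
  rewrite (mu_mass Dw) /= mulr1 => c2 l2 b0 b1 b2; split.
  - exact: (C2_ext oU E c2).
  - by move=> z Uz; rewrite -(lap_ext oU Uz E); exact: l2.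
  move=> z Uz; split.
  - by rewrite -E//; exact: b0.
  - by move=> b; rewrite -(partial_ext b oU Uz E); exact: b1.
  - move=> b b'; have E2 t : ball z0 r t -> _ := fun Ut => partial_ext b oU Ut E.
    by rewrite -(partial_ext b' oU Uz E2); exact: b2.
exists (`|a| * B); split; first by rewrite mulr_ge0.
- by move=> w Dw; have [] := HC w Dw.
- by move=> w Dw; have [_ h _] := HC w Dw.
- by move=> w Dw; have [_ _ h] := HC w Dw.
Qed.

Lemma measurable_hreg z : D z -> measurable_fun D (hreg z).
Proof.
move=> Dz; have [c2 _ _] := hregP Dz; apply: cont_measurable => // x Dx.
exact: (C1_cont (C2_C1 c2) Dx).
Qed.

(* The value of [g] at the pole is unspecified. *)
Definition green0 z w : R := if w == z then 0 else g z w.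

Lemma green0E z w : D z -> D w -> w != z -> green0 z w = L z w / (2 * pi) + hreg z w.
Proof.
move=> Dz Dw wz; rewrite /green0 (negPf wz); have [_ _ E] := hregP Dz; exact: E.
Qed.

Lemma measurable_green0 z : D z -> measurable_fun D (green0 z).
Proof.
move=> Dz; apply: (measurable_off_pt (z := z)) => //.
apply: (eq_measurable_fun (fun w => L z w / (2 * pi) + hreg z w)).
  by move=> w; rewrite inE => -[Dw /eqP wz]; rewrite green0E.
apply: (@measurable_funS _ _ _ _ D _ _ mD (@subDsetl _ D [set z])).
apply: measurable_funD; last exact: measurable_hreg.
by apply: measurable_funM => //; exact: measurable_L.
Qed.

Lemma measurable_green z : D z -> measurable_fun D (g z).
Proof.
move=> Dz; apply: (measurable_off_pt (z := z)) => //.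
apply: (eq_measurable_fun (green0 z)).
  by move=> w; rewrite inE => -[Dw /eqP/negPf wz]; rewrite /green0 wz.
apply: (@measurable_funS _ _ _ _ D _ _ mD (@subDsetl _ D [set z])).
exact: measurable_green0.
Qed.

Definition Gop (f : P -> R) z : R := \int[lam2]_(w in D) (f w * green0 z w).

(** The bound is kept as an explicit parameter: contraction and remainder estimates follow how it
    changes under [T]. *)
Definition adm (K : R) (f : P -> R) : Prop :=
  measurable_fun D f /\ forall w, D w -> `|f w| <= K.

Lemma Gop_Top f z : D z -> measurable_fun D f -> measurable_fun D u ->
  Top D u g f z = Gop (fun w => f w * u w) z.
Proof.
move=> Dz mf mu_; apply: (Rint_eq_off2 (a := z) (b := z)) => //.
- apply: measurable_funM; last exact: measurable_green.
  exact: measurable_funM.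
- apply: measurable_funM; last exact: measurable_green0.
  exact: measurable_funM.
- by move=> y _ /negPf yz _; rewrite /green0 yz.
Qed.

Lemma green0_bnd : exists C : R, 0 <= C /\
  forall z w, D z -> D w -> `|green0 z w| <= C * pk z w.
Proof.
have [C [C0 HC]] := green_bnd; exists C; split => // z w Dz Dw.
rewrite /green0; case: ifPn => [_|wz]; last exact: HC.
by rewrite normr0 mulr_ge0 ?pk_ge0.
Qed.

Lemma measurable_fgreen0 K f z : D z -> adm K f -> measurable_fun D (fun w => f w * green0 z w).
Proof. by move=> Dz [mf _]; apply: measurable_funM => //; exact: measurable_green0. Qed.

Lemma adm_green0 C K f z w : 0 <= C -> (forall z w, D z -> D w -> `|green0 z w| <= C * pk z w) ->
  adm K f -> D z -> D w -> `|f w * green0 z w| <= K * C * pk z w.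
Proof.
move=> C0 HC [_ fK] Dz Dw; rewrite normrM -mulrA; apply: ler_pM => //; first exact: fK.
exact: HC.
Qed.

Lemma adm_ge0 K f : adm K f -> 0 <= K.
Proof.
move=> [_ fK]; have [_ [_ [[x Dx] _]]] := D1.
exact: le_trans (fK x Dx).
Qed.

Lemma adm_pk2 C K f z z' w : 0 <= C -> (forall z w, D z -> D w -> `|green0 z w| <= C * pk z w) ->
  adm K f -> D z -> D w -> `|f w * green0 z w| <= K * C * (pk z w + pk z' w).
Proof.
move=> C0 HC af Dz Dw; apply: (le_trans (adm_green0 C0 HC af Dz Dw)).
by apply: ler_wpM2l; rewrite ?lerDl ?pk_ge0// mulr_ge0//; exact: adm_ge0 af.
Qed.

Lemma Gop_int K f z : D z -> adm K f -> lam2.-integrable D (EFin \o (fun w => f w * green0 z w)).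
Proof.
move=> Dz af; have [C [C0 HC]] := green0_bnd; have [M [_ DM _]] := dom_ball.
apply: (pk_dom mD DM (c := K * C) (z := z) (z' := z)).
  exact: measurable_fgreen0 af.
by move=> w Dw; exact: adm_pk2.
Qed.

Lemma Gop_bound : exists C : R, 0 < C /\
  forall K f, adm K f -> forall z, D z -> `|Gop f z| <= C * K.
Proof.
have [C [C0 HC]] := green0_bnd; have [M [M1 DM dM]] := dom_ball.
(* [pk_small] on the whole domain, which lies in a ball of radius [M] about each of its points; the
   [+ 1] only ensures positivity. *)
exists (32 * C * M + 1); split; first by rewrite ltr_wpDl// !mulr_ge0//; lra.
move=> K f af z Dz; have K0 := adm_ge0 af.
have Dz' : D `<=` ball z M.
  by move=> w Dw; apply/ball_normP/dM; exact: dom_closure.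
have M0 : 0 < M by lra.
have KC : 0 <= K * C by rewrite mulr_ge0.
have := @pk_small R D 0 M (K * C) z z _ M mD DM (measurable_fgreen0 Dz af) KC M0 Dz' Dz'
  (fun w Dw => adm_pk2 z C0 HC af Dz Dw).
by move/le_trans; apply; rewrite mulrDl mul1r (_ : K * C * _ = 32 * C * M * K); [lra|ring].
Qed.

Lemma Gop_cvg K (f : nat -> P -> R) l z : D z -> (forall n, adm K (f n)) ->
  (forall w, D w -> f n w @[n --> \oo] --> l w) -> Gop (f n) z @[n --> \oo] --> Gop l z.
Proof.
move=> Dz af fl; have [C [C0 HC]] := green0_bnd; have [M [_ DM _]] := dom_ball.
apply: (proj2 (@Rdct _ _ _ lam2 D (fun n w => f n w * green0 z w) (fun w => l w * green0 z w)
  (fun w => (K * C) * pk z w) mD2 _ _ _ _)).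
- by move=> n; exact: (measurable_fgreen0 Dz (af n)).
- by move=> w Dw; apply: cvgM; [exact: fl|exact: cvg_cst].
- exact: (RintegrableZ _ mD2 (pk_integrable z mD DM)).
- by move=> n w Dw; exact: (adm_green0 C0 HC (af n) Dz Dw).
Qed.

(** [green_bdry] gives the limit for each fixed [w]; [singular_dct], with poles moving to [p],
    integrates it. *)
Lemma Gop_bdry K f p : adm K f -> boundary D p -> Gop f z @[z --> within D (nbhs p)] --> 0.
Proof.
move=> af bp; have [C [C0 HC]] := green0_bnd; have [M [_ DM _]] := dom_ball.
apply: (@cvg_within_seq R _ D (Gop f) p 0) => v vD vp.
have -> : (0 : R) = \int[lam2]_(w in D) (cst 0 w) by rewrite Rintegral_cst// mul0r.
apply: (@singular_dct R D 0 p M (K * C) v (fun n w => f w * green0 (v n) w) (cst 0)) => //.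
- by rewrite mulr_ge0//; exact: adm_ge0 af.
- by move=> n; exact: measurable_fgreen0 af.
- by move=> n y Dy _ _; exact: adm_pk2.
- move=> y Dy _; rewrite -[X in _ --> X](mulr0 (f y)); apply: cvgM; first exact: cvg_cst.
  have h := green_bdry bp Dy.
  have hv : g (v n) y @[n --> \oo] --> 0.
    apply: cvg_comp h => A; rewrite /fmap/= /nbhs/= /within/= => hA.
    by have [N _ hN] := vp _ hA; exists N => // n /hN; apply.
  apply: norm_cvg0; apply: (@squeeze_cvgr _ _ _ _ (fun=> 0) (fun n => `|g (v n) y|)).
  + apply: nearW => n; rewrite normr_ge0 /green0; case: ifP => _; last exact: lexx.
    by rewrite normr0 normr_ge0.
  + exact: cvg_cst.
  + by rewrite -(normr0 R); apply: cvg_norm.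
Qed.

Definition regpart (f : P -> R) z : R := \int[lam2]_(w in D) (f w * hreg z w).

Lemma small_ball z : D z -> exists r : R, 0 < r /\ ball z (4 * r) `<=` D.
Proof.
move=> Dz; have [r [r0 rD]] := open_ball_sub oD Dz; exists (r / 4); split; first by rewrite divr_gt0.
by rewrite mulrC divfK.
Qed.

Lemma ball_subD z (r s : R) : s <= r -> ball z r `<=` D -> ball z s `<=` D.
Proof.
move=> sr rD y /ball_normP h; apply: rD; apply/ball_normP; exact: lt_le_trans sr.
Qed.

Lemma regpart_C2 K f z0 (r : R) : adm K f -> 0 < r -> ball z0 (4 * r) `<=` D ->
  C2 (ball z0 r) (regpart f) /\ (forall z, ball z0 r z -> lap (regpart f) z = 0).
Proof.
move=> [mf fK] r0 rD; have rD2 : ball z0 (2 * r) `<=` D by apply: ball_subD rD; lra.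
have [B [B0 c2 l2 bB]] := hreg_pole r0 rD2.
have UD : ball z0 r `<=` D by apply: ball_subD rD; lra.
have [] := @kernel_C2 R _ _ lam2 (ball z0 r) D hreg f K B (ball_open _ _) mD2 (dom_fin) mf fK.
- by move=> z /UD; exact: measurable_hreg.
- exact: c2.
- by move=> z y Uz Dy; have [] := bB y Dy z Uz.
- by move=> z y b Uz Dy; have [_ h _] := bB y Dy z Uz; exact: h.
- by move=> z y b b' Uz Dy; have [_ _ h] := bB y Dy z Uz; exact: h.
- by move=> z y Uz Dy; exact: l2.
by [].
Qed.

Lemma Gop_split K f z : adm K f -> D z -> Gop f z = (2 * pi)^-1 * newt D f z + regpart f z.
Proof.
move=> af Dz; have [mf fK] := af; have K0 := adm_ge0 af.
have [M [_ DM _]] := dom_ball.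
have iL : lam2.-integrable D (EFin \o (fun w => L z w * f w)).
  exact: (@integrable_Lf R D 0 M K f mD DM mf K0 fK z).
have [r [r0 rD]] := small_ball Dz.
have rD2 : ball z (2 * r) `<=` D by apply: ball_subD rD; lra.
have [B [B0 _ _ bB]] := hreg_pole r0 rD2.
have mh : measurable_fun D (fun w => f w * hreg z w).
  by apply: measurable_funM => //; exact: measurable_hreg.
have ih : lam2.-integrable D (EFin \o (fun w => f w * hreg z w)).
  apply: (@Rbounded_integrable _ _ _ lam2 D (fun w => f w * hreg z w) (K * B) mD2 (dom_fin) mh).
  move=> w Dw; rewrite normrM; apply: ler_pM => //; first exact: fK.
  by have [] := bB w Dw z (ballxx _ r0).
rewrite /newt -(RintegralZl (2 * pi)^-1 mD2 iL) /regpart -(RintegralD mD2 (RintegrableZ _ mD2 iL) ih).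
apply: (Rint_eq_off2 (a := z) (b := z)) => //.
- exact: measurable_fgreen0 af.
- apply: measurable_funD => //; apply: measurable_funM => //.
  by apply: measurable_funM => //; exact: measurable_L.
- move=> y Dy yz _; rewrite (green0E Dz Dy yz); ring.
Qed.

(** The Newton potential of a bounded density gains one derivative, and the regular part is smooth
    in the pole. It is also the source of measurability for [T f]. *)
Lemma Gop_C1 K f : adm K f -> C1 D (Gop f).
Proof.
move=> af; apply: C1_local => z Dz; have [r [r0 rD]] := small_ball Dz.
exists (ball z r); split; first exact: ballxx.
have oU : open (ball z r) by exact: ball_open.
have [mf fK] := af; have K0 := adm_ge0 af.
have [M [_ DM _]] := dom_ball.
have [c1 _] := @newt_C1 R D 0 M K f mD DM mf K0 fK.
have [c2 _] := C1Z (2 * pi)^-1 oU (C1S (@subsetT _ _) c1).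
have [c3 _] := regpart_C2 af r0 rD.
have [c4 _] := C1D oU c2 (C2_C1 c3).
apply: (C1_ext oU _ c4) => y Uy; rewrite (Gop_split af)//.
by apply: (ball_subD _ rD) Uy; lra.
Qed.

(* Near [z0], [G f] is the Newton potential of [f] cut off around [z0], plus
   potentials whose kernel is harmonic and smooth in [z]. *)
Lemma Gop_C2 K f : adm K f -> C1 D f -> C2 D (Gop f) /\ (forall z, D z -> lap (Gop f) z = f z).
Proof.
move=> af cf; have [mf fK] := af; have K0 := adm_ge0 af.
have [M [M1 DM dM]] := dom_ball.
suff H z0 : D z0 -> exists V, [/\ open V, V z0, C2 V (Gop f) & lap (Gop f) z0 = f z0].
  split; first by apply: C2_local => z /H[V [_ Vz c2 _]]; exists V.
  by move=> z /H[V []].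
(* Nested radii about [z0]: the result is proved within [r/2], the cutoff is 1 up to [r] and 0 from
   [2 r] on, the potential of the cut density is taken over radius [3 r], and radius [4 r] still
   lies in [D]. *)
move=> Dz0; have [r [r0 rD]] := small_ball Dz0.
have r20 : 0 < r / 2 by rewrite divr_gt0.
pose V := ball z0 (r / 2).
have oV : open V by exact: ball_open.
have Vz0 : V z0 by exact: ballxx.
have VD : V `<=` D by apply: (ball_subD _ rD); lra.
exists V.
pose chi := cutoff z0 r.
have cchi : C1 setT chi := cutoff_C1 z0 r.
have chi01 y : 0 <= chi y <= 1 := cutoff_01 z0 r y.
(* Nothing is known of [f] off [D]. The extension by zero is C^1 on the plane because the cutoff
   dies inside [D]. *)
pose F y : R := if pselect (D y) then chi y * f y else 0.
have FE y : D y -> F y = chi y * f y by rewrite /F; case: pselect.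
have F0 y : 2 * r <= `|z0 - y| -> F y = 0.
  by move=> h; rewrite /F; case: pselect => // Dy; rewrite /chi cutoff0// mul0r.
have oW : open [set y : P | 2 * r < `|z0 - y|].
  apply: (@open_lt2 R (fun=> 2 * r) (fun y => `|z0 - y|)) => y; first exact: cvg_cst.
  by apply: cvg_norm; apply: cvgB; [exact: cvg_cst|exact: cvg_id].
have offW y : ~ D y -> 2 * r < `|z0 - y|.
  move=> nD; rewrite ltNge; apply/negP => h; apply: nD; apply: rD; apply/ball_normP.
  by apply: (le_lt_trans h); lra.
have [cz pz] := @C1_cst R [set y : P | 2 * r < `|z0 - y|] 0 oW.
have zF y : 2 * r < `|z0 - y| -> 0 = F y by move=> h; rewrite F0// ltW.
have cF : C1 setT F.
  apply: C1_local => y _; have [Dy|nD] := pselect (D y).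
    exists D; split => //; have [c _] := C1M oD (C1S (@subsetT _ _) cchi) cf.
    by apply: (C1_ext oD _ c) => t Dt; rewrite FE.
  exists [set y : P | 2 * r < `|z0 - y|]; split; first exact: offW.
  exact: (C1_ext oW zF cz).
have dF0 b y : ~ D y -> partial b F y = 0.
  by move=> /offW h; rewrite -(partial_ext b oW h zF) pz.
have [K' [K'0 dFK]] : exists K' : R, 0 <= K' /\ forall b y, `|partial b F y| <= K'.
  have bb b : exists K' : R, 0 <= K' /\ forall y, `|partial b F y| <= K'.
    have [A [_ HA]] : bounded_set (partial b F @` closure D).
      apply: compact_bounded; apply: continuous_compact; last exact: closure_compactD.
      by apply: continuous_subspaceT => y; exact: (C1_pcont b cF).
    exists (Num.max 0 (A + 1)); split; first by rewrite le_max lexx.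
    move=> y; have [Dy|nD] := pselect (D y); last by rewrite dF0// normr0 le_max lexx.
    rewrite le_max; apply/orP; right; apply: HA; first by rewrite ltrDl.
    by exists y => //; exact: dom_closure.
  have [a [a0 ha]] := bb true; have [b [b0 hb]] := bb false.
  exists (a + b); split; first by rewrite addr_ge0.
  by move=> [] y; [have := ha y|have := hb y]; lra.
have FK y : `|F y| <= K.
  have [Dy|nD] := pselect (D y); last by rewrite -(zF y (offW y nD)) normr0.
  rewrite FE //.
  have /andP[c0 c1] := chi01 y; rewrite normrM (ger0_norm c0).
  by apply: le_trans (fK y Dy); rewrite ler_piMl.
have K2 : 0 <= K + K' by rewrite addr_ge0.
have FK2 y : `|F y| <= K + K' by have := FK y; lra.
have dFK2 b y : `|partial b F y| <= K + K' by have := dFK b y; lra.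
have r2 : 0 < 2 * r by rewrite mulr_gt0.
have r3 : 2 * r < 3 * r by lra.
have [cN lN] := newt_C2 r2 r3 cF FK2 dFK2 F0.
(* Carries [f1], the rest of the density; it stays at distance at least [r/2] from [V], so its
   potential is harmonic there. *)
pose Y := D `\` ball z0 r.
have mB s : measurable (ball z0 s) by exact: measurable_ballP.
have mY : measurable Y by exact: measurableD.
have mY2 : @measurable _ P2 Y := mY.
have YD : Y `<=` D by move=> y [].
have Yoo : (lam2 Y < +oo)%E by apply: (lam2_fin mY2 (z := 0) (r := M)) => y /YD /DM.
pose f1 y := (1 - chi y) * f y.
have mchi : measurable_fun D chi by apply: contT_measurable => y; exact: (C1_cont cchi).
have mf1 : measurable_fun D f1.
  by apply: measurable_funM => //; apply: measurable_funB.
have f1K y : D y -> `|f1 y| <= K.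
  move=> Dy; have /andP[c0 c1] := chi01 y; rewrite normrM ger0_norm ?subr_ge0//.
  by apply: le_trans (fK y Dy); rewrite ler_piMl// gerBl.
have far z y : V z -> Y y -> r / 2 <= `|z - y| <= M.
  move=> Vz Yy; apply/andP; split; last by apply/ltW/dM; apply: dom_closure; [exact: VD|exact: YD].
  rewrite leNgt; apply/negP => h2; have [_ /ball_normP] := Yy; apply; move: Vz => /ball_normP h.
  rewrite (_ : z0 - y = (z0 - z) + (z - y)); last by rewrite subrKA.
  by apply: (le_lt_trans (ler_normD _ _)); lra.
pose N1 z := \int[lam2]_(y in Y) (f1 y * L z y).
have [cN1 lN1] : C2 V N1 /\ forall z, V z -> lap N1 z = 0.
  have [] := @log_kernel_C2 R _ _ lam2 V Y id f1 K (r / 2) M oV mY2 Yoo _ _ _ r20 far => //.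
  - exact: measurable_funS mf1.
  - by move=> y /YD; exact: f1K.
  - by move=> z _; exact: measurable_L.
have mF : measurable_fun D F by apply: contT_measurable => y; exact: (C1_cont cF).
have NE z : V z -> newt D f z = newt (ball z0 (3 * r)) F z + N1 z.
  move=> Vz.
  have iF : lam2.-integrable D (EFin \o (fun w => L z w * F w)).
    exact: (@integrable_Lf R D 0 M K F mD DM mF K0 (fun y _ => FK y) z).
  have i1 : lam2.-integrable D (EFin \o (fun w => L z w * f1 w)).
    exact: (@integrable_Lf R D 0 M K f1 mD DM mf1 K0 f1K z).
  have -> : newt D f z = \int[lam2]_(y in D) (L z y * F y) + \int[lam2]_(y in D) (L z y * f1 y).
    rewrite -(RintegralD mD2 iF i1); apply: eq_Rintegral => y; rewrite inE => Dy.
    by rewrite FE// /f1; ring.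
  congr (_ + _).
    rewrite (Rint_splitB mD (mB (3 * r)) iF) [X in _ + X](@eq_Rintegral _ _ _ _ _ (fun=> 0)).
      rewrite Rintegral_cst ?mul0r ?addr0; last exact: (measurableD mD2 (mB (3 * r))).
      rewrite (_ : D `&` ball z0 (3 * r) = ball z0 (3 * r)) //.
      by apply: setIidr; apply: (ball_subD _ rD); lra.
    move=> y; rewrite inE => -[_ /ball_normP nb]; rewrite F0 ?mulr0//.
    by rewrite leNgt; apply/negP => h; apply: nb; apply: (lt_trans h).
  rewrite (Rint_splitB mD (mB r) i1) [X in X + _](@eq_Rintegral _ _ _ _ _ (fun=> 0)).
    rewrite Rintegral_cst ?mul0r ?add0r; last exact: (measurableI _ _ mD2 (mB r)).
    by apply: eq_Rintegral => y _; rewrite mulrC.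
  move=> y; rewrite inE => -[_ /ball_normP nb].
  by rewrite /f1 /chi cutoff1 ?subrr ?mul0r ?mulr0// ltW.
have [c1 l1] := C2D oV (C2S (@subsetT _ _) cN) cN1.
have [c2 l2] := C2Z (2 * pi)^-1 oV c1.
have VU : V `<=` ball z0 r by move=> y /ball_normP h; apply/ball_normP; lra.
have [c3 l3] := regpart_C2 af r0 rD.
have [c4 l4] := C2D oV c2 (C2S VU c3).
have E y : V y -> (2 * pi)^-1 * (newt (ball z0 (3 * r)) F y + N1 y) + regpart f y = Gop f y.
  by move=> Vy; rewrite (Gop_split af (VD y Vy)) NE.
split => //; first exact: (C2_ext oV E c4).
rewrite -(lap_ext oV Vz0 E) l4// l2// l1// lN (lN1 z0 Vz0) (l3 z0 (VU _ Vz0)) !addr0.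
rewrite FE// /chi cutoff1 ?subrr ?normr0 ?(ltW r0)// mul1r mulrA mulVf ?mul1r//.
by rewrite mulf_neq0// gt_eqF// pi_gt0.
Qed.

(** * The weighted operator [T] *)

Hypothesis su : smooth_on_closure D u.

Local Notation T := (Top D u g).

Lemma within_open_cont (v : P -> R) x : {within closure D, continuous v} -> D x ->
  {for x, continuous v}.
Proof.
move=> /subspace_continuousP cv Dx; have h := cv x (dom_closure Dx).
rewrite /prop_for /continuous_at; apply: cvg_trans h => A; rewrite /fmap/= /nbhs/= /within/=.
by apply: filterS2 (open_near oD Dx) => y Dy; apply; exact: dom_closure.
Qed.

Lemma cont_bounded (v : P -> R) : {within closure D, continuous v} ->
  exists K : R, 0 < K /\ forall x, closure D x -> `|v x| <= K.
Proof.
move=> cv; have [A [_ HA]] : bounded_set (v @` closure D).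
  by apply: compact_bounded; apply: continuous_compact cv _; exact: closure_compactD.
exists (Num.max 1 (A + 1)); split; first by rewrite lt_max ltr01.
by move=> y cy; rewrite le_max; apply/orP; right; apply: HA; [rewrite ltrDl|exists y].
Qed.

Lemma weight_C1 : C1 D u.
Proof.
have [cu H] := su; split => x Dx; split; first exact: within_open_cont.
move=> b; have [/(_ x b Dx) dx _] := H [::]; split; first exact: dx.
have [_ [v [cv vE]]] := H [:: b].
apply: (for_cont_ext oD Dx _ (within_open_cont cv Dx)) => y Dy.
by apply/esym; apply: vE; rewrite inE.
Qed.

Lemma C1_measurable f : C1 D f -> measurable_fun D f.
Proof. by move=> cf; apply: cont_measurable => // x Dx; exact: (C1_cont cf Dx). Qed.

Lemma admD K K' f f' : adm K f -> adm K' f' -> adm (K + K') (fun x => f x + f' x).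
Proof.
move=> [mf fK] [mf' fK']; split; first exact: measurable_funD.
by move=> w Dw; apply: (le_trans (ler_normD _ _)); apply: lerD; [exact: fK|exact: fK'].
Qed.

Lemma admZ K c f : adm K f -> adm (`|c| * K) (fun x => c * f x).
Proof.
move=> [mf fK]; split; first exact: measurable_funM.
by move=> w Dw; rewrite normrM ler_wpM2l//; exact: fK.
Qed.

Lemma admM K K' f f' : adm K f -> adm K' f' -> adm (K * K') (fun x => f x * f' x).
Proof.
move=> [mf fK] [mf' fK']; split; first exact: measurable_funM.
by move=> w Dw; rewrite normrM; apply: ler_pM => //; [exact: fK|exact: fK'].
Qed.

Lemma GopD K K' f f' z : D z -> adm K f -> adm K' f' ->
  Gop (fun x => f x + f' x) z = Gop f z + Gop f' z.
Proof.
move=> Dz af af'; rewrite /Gop -(RintegralD mD2 (Gop_int Dz af) (Gop_int Dz af')).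
by apply: eq_Rintegral => y _; rewrite mulrDl.
Qed.

Lemma GopZ K c f z : D z -> adm K f -> Gop (fun x => c * f x) z = c * Gop f z.
Proof.
move=> Dz af; rewrite /Gop -(RintegralZl c mD2 (Gop_int Dz af)).
by apply: eq_Rintegral => y _; rewrite mulrA.
Qed.

Lemma GopS f f' z : (forall x, D x -> f x = f' x) -> Gop f z = Gop f' z.
Proof. by move=> E; apply: eq_Rintegral => y; rewrite inE => Dy; rewrite E. Qed.

Lemma TopS f f' z : (forall x, D x -> f x = f' x) -> T f z = T f' z.
Proof. by move=> E; apply: eq_Rintegral => y; rewrite inE => Dy; rewrite E. Qed.

Lemma weight_adm : exists K : R, 0 < K /\ adm K u.
Proof.
have [K [K0 HK]] := cont_bounded (proj1 su); exists K; split => //; split.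
  exact: C1_measurable weight_C1.
by move=> x Dx; apply: HK; exact: dom_closure.
Qed.

Lemma Top_Gop K f z : D z -> adm K f -> T f z = Gop (fun x => f x * u x) z.
Proof.
move=> Dz [mf _]; apply: (Gop_Top) => //; exact: C1_measurable weight_C1.
Qed.

(** [theta] is a bound of the Green operator times one of the weight. Measurability in [z], with [g]
    given pole by pole, comes from [Gop_C1]. *)
Lemma Top_adm : exists theta : R, 0 < theta /\ forall K f, adm K f -> adm (theta * K) (T f).
Proof.
have [Ku [Ku0 au]] := weight_adm; have [C [C0 HC]] := Gop_bound.
exists (C * Ku); split; first by rewrite mulr_gt0.
move=> K f af; have afu := admM af au; split.
  apply: (eq_measurable_fun (Gop (fun x => f x * u x))).
    by move=> x; rewrite inE => Dx; rewrite (Top_Gop Dx af).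
  exact: C1_measurable (Gop_C1 afu).
move=> z Dz; rewrite (Top_Gop Dz af); apply: (le_trans (HC _ _ afu z Dz)).
by rewrite (mulrC K) mulrA.
Qed.

Lemma TopD K K' f f' z : D z -> adm K f -> adm K' f' ->
  T (fun x => f x + f' x) z = T f z + T f' z.
Proof.
move=> Dz af af'; have [Ku [_ au]] := weight_adm.
rewrite (Top_Gop Dz af) (Top_Gop Dz af') (Top_Gop Dz (admD af af')).
rewrite -(GopD Dz (admM af au) (admM af' au)); apply: GopS => x _; exact: mulrDl.
Qed.

Lemma TopZ K c f z : D z -> adm K f -> T (fun x => c * f x) z = c * T f z.
Proof.
move=> Dz af; have [Ku [_ au]] := weight_adm.
rewrite (Top_Gop Dz af) (Top_Gop Dz (admZ c af)) -(GopZ c Dz (admM af au)).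
by apply: GopS => x _; rewrite mulrA.
Qed.

Lemma Top_cvg K (f : nat -> P -> R) l z : D z -> (forall n, adm K (f n)) -> adm K l ->
  (forall w, D w -> f n w @[n --> \oo] --> l w) -> T (f n) z @[n --> \oo] --> T l z.
Proof.
move=> Dz af al fl; have [Ku [_ au]] := weight_adm.
rewrite (Top_Gop Dz al); under eq_fun do rewrite (Top_Gop Dz (af _)).
apply: (Gop_cvg (K := K * Ku) (f := fun n x => f n x * u x) Dz).
  by move=> n; exact: admM (af n) au.
by move=> w Dw; apply: cvgM; [exact: fl|exact: cvg_cst].
Qed.

(** * The fixed point and the classical solutions it yields *)

Section FixedPoint.
Variables (theta eps A : R) (psi0 : P -> R).
Hypothesis thetaP : forall K f, adm K f -> adm (theta * K) (T f).
Hypothesis (eps0 : 0 <= eps) (eps1 : eps * theta <= 1 / 2).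
Hypothesis apsi0 : adm A psi0.

(** Since [eps * theta <= 1/2], each step halves the previous increment, whence [A / 2 ^+ n]; and
    [2 A] bounds all iterates because it solves [A + K/2 = K]. *)
Fixpoint picard n : P -> R :=
  if n is n'.+1 then (fun x => psi0 x + eps * T (picard n') x) else (fun=> 0).

Let A0 : 0 <= A := adm_ge0 apsi0.

Lemma adm_le K K' f : K <= K' -> adm K f -> adm K' f.
Proof. by move=> KK [mf fK]; split => // w Dw; apply: le_trans (fK w Dw) KK. Qed.

Lemma adm_epsT K f : adm K f -> adm (K / 2) (fun x => eps * T f x).
Proof.
move=> af; apply: adm_le (admZ eps (thetaP af)).
by rewrite ger0_norm// mulrA mulrC [K / 2]mulrC -div1r mulrC ler_wpM2r//; exact: adm_ge0 af.
Qed.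

Lemma picard_adm n : adm (2 * A) (picard n).
Proof.
elim: n => [|n IH] /=.
  by split; [exact: measurable_cst|move=> w _; rewrite normr0 mulr_ge0].
apply: adm_le (admD apsi0 (adm_epsT IH)).
by lra.
Qed.

Lemma picard_step n : adm (A / 2 ^+ n) (fun x => picard n.+1 x - picard n x).
Proof.
have E f f' : (fun x => f x - f' x) = (fun x => f x + (-1) * f' x) :> (P -> R).
  by apply/funext => x; rewrite mulN1r.
have aB m : adm (2 * A + `|-1| * (2 * A)) (fun x => picard m.+1 x - picard m x).
  by rewrite E; exact: admD (picard_adm _) (admZ _ (picard_adm _)).
elim: n => [|n IH].
  split; first by have [] := aB 0%N.
  move=> w Dw /=; rewrite expr0 divr1 subr0.
  have z0 x : D x -> (fun=> 0 : R) x = 0 * (fun=> 0) x by rewrite mul0r.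
  have a0 : adm 0 (fun=> 0 : R) by split; [exact: measurable_cst|move=> ? _; rewrite normr0].
  rewrite (TopS w z0) (TopZ 0 Dw a0) mul0r mulr0 addr0; have [_ h] := apsi0; exact: h.
have := adm_epsT IH; rewrite -mulrA -invfM -exprSr => -[_ h].
split; first by have [] := aB n.+1.
move=> w Dw; apply: le_trans (h w Dw); rewrite le_eqVlt; apply/orP; left; apply/eqP; congr `|_|.
rewrite E (TopD Dw (picard_adm _) (admZ _ (picard_adm _))) (TopZ _ Dw (picard_adm _)) mulN1r.
rewrite /= mulrBr; ring.
Qed.

(** The iterates converge pointwise on [D] under the common bound [2 A], and dominated convergence
    carries the equation through [T]. *)
Lemma fixed_point : exists psi : P -> R, adm (2 * A) psi /\
  forall z, D z -> psi z = psi0 z + eps * T psi z.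
Proof.
pose psi x := limn (fun n => picard n x).
have cv x : D x -> picard n x @[n --> \oo] --> psi x.
  by move=> Dx; apply: (@cvg_geometric_steps R _ A) => n; have [_ h] := picard_step n; exact: h.
have apsi : adm (2 * A) psi.
  split.
    apply: (@measurable_fun_cvg _ _ _ D picard psi) => //.
    by move=> n; have [] := picard_adm n.
  move=> w Dw; have h : `|picard n w| @[n --> \oo] --> `|psi w| by apply: cvg_norm; exact: cv.
  rewrite -(cvg_lim _ h)//; apply: limr_le; first by apply/cvg_ex; eexists; exact: h.
  by apply: nearW => n; have [_ k] := picard_adm n; exact: k.
exists psi; split => // z Dz.
have h1 : picard n.+1 z @[n --> \oo] --> psi z by rewrite (cvg_shiftS (fun n => picard n z)); exact: cv.
have h2 : picard n.+1 z @[n --> \oo] --> psi0 z + eps * T psi z.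
  apply: cvgD; first exact: cvg_cst.
  apply: cvgM; first exact: cvg_cst.
  exact: (Top_cvg Dz picard_adm apsi cv).
by rewrite -(cvg_lim _ h1)// -(cvg_lim _ h2).
Qed.

End FixedPoint.

(* Regularity bootstraps: psi = H + G (eps u psi - lap H) is bounded, hence C^1, hence C^2. *)
Lemma neumann_classical theta eps A H :
  (forall K f, adm K f -> adm (theta * K) (T f)) -> 0 <= eps -> eps * theta <= 1 / 2 ->
  C2 setT H -> C1 setT (lap H) -> adm A (fun x => H x - Gop (lap H) x) ->
  exists psi Psi : P -> R, [/\ adm (2 * A) psi,
    forall z, D z -> psi z = (H z - Gop (lap H) z) + eps * T psi z,
    classical_dirichlet D u eps H Psi & forall z, D z -> Psi z = psi z].
Proof.
move=> tP e0 e1 cH clH aA.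
have [psi [apsi psiE]] := fixed_point tP e0 e1 aA.
(* The fixed point is determined only inside [D]; the boundary values have to be put in by hand
   before continuity on the closure can be claimed. *)
pose Psi x := if pselect (D x) then psi x else H x.
have PsiE x : D x -> Psi x = psi x by rewrite /Psi; case: pselect.
have Psib x : boundary D x -> Psi x = H x by move=> [_ nx]; rewrite /Psi; case: pselect.
exists psi, Psi.
have [Ku [_ au]] := weight_adm.
have [Kl [_ HKl]] : exists K : R, 0 < K /\ forall x, closure D x -> `|lap H x| <= K.
  by apply: cont_bounded; apply: continuous_subspaceT => x; exact: (C1_cont clH).
have al : adm Kl (lap H).
  split; first by apply: C1_measurable; exact: (C1S (@subsetT _ _) clH).
  by move=> x Dx; apply: HKl; exact: dom_closure.
pose f x := eps * (psi x * u x) + (-1) * lap H x.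
have a1 := admZ eps (admM apsi au); have a2 := admZ (-1) al.
have af := admD a1 a2.
have E z : D z -> psi z = H z + Gop f z.
  move=> Dz; rewrite (psiE z Dz) (Top_Gop Dz apsi) /f (GopD Dz a1 a2) (GopZ _ Dz al).
  rewrite (GopZ _ Dz (admM apsi au)); ring.
have E' z : D z -> H z + Gop f z = psi z by move=> /E.
have cHD : C2 D H := C2S (@subsetT _ _) cH.
have c1 : C1 D psi.
  have [c _] := C1D oD (C2_C1 cHD) (Gop_C1 af).
  exact: (C1_ext oD E' c).
have cf : C1 D f.
  have [ca _] := C1M oD c1 weight_C1; have [cb _] := C1Z eps oD ca.
  have [cc _] := C1Z (-1) oD (C1S (@subsetT _ _) clH).
  by have [] := C1D oD cb cc.
have [cG lG] := Gop_C2 af cf.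
have [c2 l2] := C2D oD cHD cG.
have EP z : D z -> H z + Gop f z = Psi z by move=> Dz; rewrite PsiE// E'.
have cP : C2 D Psi := C2_ext oD EP c2.
split => //.
split.
- apply/subspace_continuousP => x cx; have [Dx|bx] := closure_dom_or cx.
    by apply: within_cont; exact: (C1_cont (C2_C1 cP) Dx).
  have hG := Gop_bdry af bx.
  have hH : {for x, continuous H} by exact: (C1_cont (C2_C1 cH)).
  apply/cvgrPdist_lt => e ee; have ee2 : 0 < e / 2 by rewrite divr_gt0.
  have := hG; move/cvgrPdist_lt => /(_ _ ee2); rewrite near_withinE => h1.
  have := hH; rewrite /prop_for /continuous_at => /cvgrPdist_lt/(_ _ ee2) h2.
  near=> y => cy.
  have h3 : `|H x - H y| < e / 2 by near: y; exact: h2.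
  have h4 : D y -> `|0 - Gop f y| < e / 2 by near: y; exact: h1.
  rewrite /from_subspace (Psib x bx); have [Dy|by_] := closure_dom_or cy; last by rewrite (Psib y by_); lra.
  have := h4 Dy; rewrite -EP// sub0r opprD addrA.
  by have := ler_normD (H x - H y) (- Gop f y); lra.
- exact: C2_C2_on.
- move=> x Dx; rewrite -(lap_ext oD Dx EP) l2// lG// PsiE// /f; ring.
- exact: Psib.
Unshelve. all: by end_near. Qed.

End Green.

(** * Smooth approximation of quadrants *)

Section SmoothSteps.
Context {R : realType}.
Local Notation P := (R * R)%type.
Implicit Types (f g : P -> R).

(** Order 3 is the one used: it makes [lap H] of class C^1, as [neumann_classical] requires. *)
Fixpoint diffn (n : nat) f : Prop :=
  if n is m.+1 then C1 setT f /\ forall b, diffn m (partial b f) else True.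

Lemma diffnW n f : diffn n.+1 f -> diffn n f.
Proof.
elim: n f => [//|n IH] f [cf h]; split => // b; apply: IH; exact: h.
Qed.

Lemma diffnD n f g : diffn n f -> diffn n g -> diffn n (fun x => f x + g x).
Proof.
elim: n f g => [//|n IH] f g [cf hf] [cg hg].
have [c p] := C1D openT cf cg; split => // b.
rewrite (_ : partial b _ = fun x => partial b f x + partial b g x); first exact: IH (hf b) (hg b).
by apply/funext => x; exact: p.
Qed.

Lemma diffnM n f g : diffn n f -> diffn n g -> diffn n (fun x => f x * g x).
Proof.
elim: n f g => [//|n IH] f g sf sg; have [cf hf] := sf; have [cg hg] := sg.
have [c p] := C1M openT cf cg; split => // b.
rewrite (_ : partial b _ = fun x => f x * partial b g x + g x * partial b f x).
  by apply: diffnD; [exact: IH (diffnW sf) (hg b)|exact: IH (diffnW sg) (hf b)].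
by apply/funext => x; exact: p.
Qed.

Lemma diffn_cst n (c : R) : diffn n (fun=> c).
Proof.
elim: n c => [//|n IH] c; have [c1 p] := C1_cst c openT; split => // b.
rewrite (_ : partial b _ = fun=> 0); first exact: IH.
by apply/funext => x; exact: p.
Qed.

Lemma diffn_co n b : diffn n (co b).
Proof.
case: n => [//|n]; have [c1 p] := @C1_co R setT b openT; split => // b'.
rewrite (_ : partial b' _ = fun=> (b == b')%:R); first exact: diffn_cst.
by apply/funext => x; exact: p.
Qed.

Lemma diffn_exp n f : diffn n f -> diffn n (fun x => expR (f x)).
Proof.
elim: n f => [//|n IH] f sf; have [cf hf] := sf.
have [c p] : C1 setT (fun x => expR (f x)) /\
    forall x b, setT x -> partial b (fun x => expR (f x)) x = expR (f x) * partial b f x.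
  apply: (@C1_comp R setT f (@expR R) (@expR R) openT cf) => x _.
  exact: continuous_expR.
split => // b.
rewrite (_ : partial b _ = fun x => expR (f x) * partial b f x).
  by apply: diffnM; [apply: IH; exact: diffnW|exact: hf].
by apply/funext => x; exact: p.
Qed.

Lemma diffn_C2 f : diffn 2 f -> C2 setT f.
Proof. by move=> [cf hf]; split => // b; have [] := hf b. Qed.

Lemma diffn_lap f : diffn 3 f -> C1 setT (lap f).
Proof.
move=> [_ hf]; have h b : C1 setT (partial b (partial b f)) by have [_ /(_ b)[]] := hf b.
by have [] := C1D openT (h true) (h false).
Qed.

(** A Gompertz curve: smooth by closure under products and the exponential, with values in [[0, 1]].
    Its limit is the indicator of [t > 0] at every point, 0 included, where it equals
    [expR (- n)]. *)
Definition step (n : nat) (t : R) : R := expR (- n%:R * expR (- n%:R * t)).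

Lemma step_01 n (t : R) : 0 <= step n t <= 1.
Proof. by rewrite expR_ge0 expR_le1 mulNr oppr_le0 mulr_ge0 ?expR_ge0. Qed.

Lemma step_cvg t : step n t @[n --> \oo] --> ((0 < t)%R%:R : R).
Proof.
have cE : {for (0 : R), continuous (@expR R)} by exact: continuous_expR.
have [t0|t0] := ltP 0 t.
  rewrite [X in _ --> X](_ : _ = expR 0); last by rewrite expR0.
  apply: (@cvg_comp _ _ _ (fun n : nat => - n%:R * expR (- n%:R * t)) (@expR R) _ (nbhs (0 : R))); last exact: cE.
  (* From [expR x >= 1 + x^2/2] at [x = n t], the exponent is at most [2/(n t^2)] in modulus, and
     [n + 1 <= 2 n] for [n >= 1]. *)
  apply: norm_cvg0; apply: (@squeeze_cvgr _ _ _ _ (fun=> 0) (fun n : nat => (4 / t ^+ 2) * n.+1%:R^-1)).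
  - near=> n; rewrite normr_ge0/= mulNr normrN ger0_norm ?mulr_ge0 ?expR_ge0// mulNr expRN.
    have n1 : (1 : R) <= n%:R by rewrite ler1n; near: n; exact: nbhs_infty_ge.
    have nt : 0 <= n%:R * t by rewrite mulr_ge0// ltW.
    have h := expR_ge1Dxn 1 nt; have e0 := expR_gt0 (n%:R * t).
    have t2 : 0 < t ^+ 2 by rewrite exprn_gt0.
    have n0 : 0 < n.+1%:R :> R by [].
    rewrite ler_pdivrMr// mulrAC ler_pdivlMr// mulrAC ler_pdivlMr//.
    rewrite -natr1; have hE : 1 + (n%:R * t) ^+ 2 / 2 <= expR (n%:R * t) by [].
    apply: (@le_trans _ _ (4 * ((n%:R * t) ^+ 2 / 2))); last by lra.
    by rewrite exprMn; nra.
  - exact: cvg_cst.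
  - rewrite -(mulr0 (4 / t ^+ 2)); apply: cvgM; [exact: cvg_cst|exact: cvg_harmonic].
(* For [t <= 0] the inner exponential is at least 1, so the step is at most
   [expR (- n) <= 1/(n + 1)]. *)
apply: (@squeeze_cvgr _ _ _ _ (fun=> 0) (fun n : nat => n.+1%:R^-1)).
- apply: nearW => n; rewrite expR_ge0/= /step mulNr expRN lef_pV2 ?posrE ?expR_gt0//.
  have h1 : 1 <= expR (- n%:R * t).
    rewrite -[leLHS]expR0 ler_expR mulNr oppr_ge0; exact: mulr_ge0_le0.
  apply: le_trans (expR_ge1Dx _); rewrite -natr1 addrC lerD2l ler_peMr//.
- exact: cvg_cst.
- exact: cvg_harmonic.
Unshelve. all: by end_near. Qed.

Definition corner_step (n : nat) (a b : R) (x : P) : R :=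
  step n (co true x + - a) * step n (co false x + - b).

Lemma corner_step_diffn n a b k : diffn k (corner_step n a b).
Proof.
have h c (d : R) : diffn k (fun x => step n (co c x + - d)).
  apply/diffn_exp/diffnM; first exact: diffn_cst.
  apply/diffn_exp/diffnM; first exact: diffn_cst.
  by apply: diffnD; [exact: diffn_co|exact: diffn_cst].
exact: diffnM (h true a) (h false b).
Qed.

Lemma corner_step_01 n a b x : 0 <= corner_step n a b x <= 1.
Proof.
have /andP[a0 a1] := step_01 n (co true x + - a).
have /andP[b0 b1] := step_01 n (co false x + - b).
by rewrite /corner_step mulr_ge0//= mulr_ile1.
Qed.

Definition corner (a b : R) : set P := `]a, +oo[%classic `*` `]b, +oo[%classic.

Lemma cornerP a b x : corner a b x <-> a < x.1 /\ b < x.2.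
Proof. by rewrite /corner /= !in_itv/= !andbT. Qed.

Lemma corner_step_cvg a b x :
  corner_step n a b x @[n --> \oo] --> (\1_(corner a b) x : R).
Proof.
rewrite [X in _ --> X](_ : _ = (0 < x.1 - a)%R%:R * (0 < x.2 - b)%R%:R); last first.
  rewrite indicE -natrM mulnb !subr_gt0; congr ((nat_of_bool _)%:R).
  apply/idP/idP; first by rewrite inE => /cornerP[-> ->].
  by move=> /andP[h1 h2]; rewrite inE; apply/cornerP.
by apply: cvgM; exact: step_cvg.
Qed.

Definition corners : set (set P) := [set corner c.1 c.2 | c in [set: P]].

Lemma setI_corners : setI_closed corners.
Proof.
move=> _ _ [a _ <-] [b _ <-]; exists (Num.max a.1 b.1, Num.max a.2 b.2) => //=.
apply/seteqP; split => x.
  by move=> /cornerP[]; rewrite !gt_max => /andP[? ?] /andP[? ?]; split; apply/cornerP.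
by move=> [/cornerP[h1 h2] /cornerP[h3 h4]]; apply/cornerP; rewrite !gt_max h1 h2 h3 h4.
Qed.

(** A half-plane [x.1 > a] or [x.2 > a] is the union over [n] of quadrants whose other edge is at
    [- n]; so both projections are measurable for the generated sigma-algebra. *)
Lemma measurable_corners : @measurable _ P = <<s corners >>.
Proof.
have arch (t : R) : exists n : nat, - n%:R < t.
  have [n _ /(_ n (leqnn n)) /= h] : \forall n \near \oo, n%:R > - t by exact: nbhs_infty_gtr.
  by exists n; rewrite ltrNl.
have m1 : measurable_fun [set: g_sigma_algebraType corners] (fun x : P => x.1).
  apply: (measurability _ (RGenOInfty.measurableE R)) => _ [_ [a ->] <-].
  rewrite setTI (_ : _ @^-1` _ = \bigcup_n corner a (- n%:R)).
    apply: bigcup_measurable => n _; apply: sub_sigma_algebra.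
    by exists (a, - n%:R).
  apply/seteqP; split => x; last by move=> [n _ /cornerP[h _]]; rewrite /= in_itv/= h.
  rewrite /= in_itv/= andbT => h; have [n hn] := arch x.2; exists n => //; exact/cornerP.
have m2 : measurable_fun [set: g_sigma_algebraType corners] (fun x : P => x.2).
  apply: (measurability _ (RGenOInfty.measurableE R)) => _ [_ [a ->] <-].
  rewrite setTI (_ : _ @^-1` _ = \bigcup_n corner (- n%:R) a).
    apply: bigcup_measurable => n _; apply: sub_sigma_algebra.
    by exists (- n%:R, a).
  apply/seteqP; split => x; last by move=> [n _ /cornerP[_ h]]; rewrite /= in_itv/= h.
  rewrite /= in_itv/= andbT => h; have [n hn] := arch x.1; exists n => //; exact/cornerP.
rewrite measurable_prod_measurableType; apply/seteqP; split.
  apply: smallest_sub; first exact: smallest_sigma_algebra.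
  move=> _ [A mA] [B mB] <-.
  have h1 := m1 measurableT A mA; have h2 := m2 measurableT B mB.
  have := measurableI _ _ h1 h2; rewrite !setTI; exact.
apply: smallest_sub; first exact: smallest_sigma_algebra.
move=> _ [c _ <-]; apply: sub_sigma_algebra.
by exists `]c.1, +oo[%classic; [exact: measurable_itv|exists `]c.2, +oo[%classic; [exact: measurable_itv|]].
Qed.

End SmoothSteps.

(** * Approximation by staircases *)

Section CountingApproximation.
Context {R : realType}.

Lemma count_below (s : R) n : 0 <= s -> let c := \sum_(k < n) (k.+1%:R <= s)%R%:R : R in
  [/\ c <= s, n%:R <= s -> c = n%:R & s < n%:R -> s < c + 1].
Proof.
move=> s0; elim: n => [|n [h1 h2 h3]] /=.
  by rewrite big_ord0; split => //; rewrite ltNge s0.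
rewrite big_ord_recr /=; set c := \sum_(_ < _) _ in h1 h2 h3 *.
have [h|h] := leP n.+1%:R s.
  have hn : n%:R <= s by apply: le_trans h; rewrite ler_nat.
  by rewrite (h2 hn) natr1.
rewrite addr0; split => // _; have [hn|hn] := leP n%:R s; last exact: h3.
by rewrite (h2 hn) natr1.
Qed.

(** For [t] in [[0, 1]] this rounds [t] down to a multiple of [1/(n + 1)]. Written as a sum over
    thresholds, it becomes a combination of indicators of superlevel sets when composed with a
    function. *)
Definition staircase (n : nat) (t : R) : R :=
  \sum_(k < n.+1) n.+1%:R^-1 * (k.+1%:R <= n.+1%:R * t)%R%:R.

Lemma staircase_near n t : 0 <= t <= 1 -> 0 <= t - staircase n t <= n.+1%:R^-1.
Proof.
move=> /andP[t0 t1]; have n0 : 0 < n.+1%:R :> R by [].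
have s0 : 0 <= n.+1%:R * t by rewrite mulr_ge0.
have := count_below n.+1 s0; rewrite /staircase -mulr_sumr.
set c := \sum_(_ < _) _ => -[h1 h2 h3].
have h4 : n.+1%:R * t <= c + 1.
  have [h|h] := leP n.+1%:R (n.+1%:R * t); last exact: ltW (h3 h).
  rewrite (h2 h); apply: (@le_trans _ _ n.+1%:R); last by rewrite lerDl.
  by rewrite ger_pMr.
move: h1 h4; rewrite (mulrC n.+1%:R t) (mulrC _ c) => h1 h4.
rewrite subr_ge0 ler_pdivrMr// h1/= lerBlDr -[leRHS]/(_ + _) -{1}[_^-1]div1r -mulrDl ler_pdivlMr//.
by rewrite addrC.
Qed.

End CountingApproximation.

(** * The identity [phi_eps = phi_0 + eps T phi_eps] for bounded Borel data *)

Section Duhamel.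
Context {R : realType}.
Local Notation P := (R * R)%type.
Variables (D : set P) (u : P -> R) (g : P -> P -> R).
Variables mu0 mue : P -> {measure set P -> \bar R}.
Variables (eps theta : R).
Hypothesis D1 : C1_domain D.
Hypothesis gG : green_function D g.
Hypothesis su : smooth_on_closure D u.
Hypothesis mu0D : forall z, D z -> dirichlet_measure D u 0 z (mu0 z).
Hypothesis mueD : forall z, D z -> dirichlet_measure D u eps z (mue z).
Local Notation Gop := (Gop D g).
Local Notation adm := (adm D).
Local Notation T := (Top D u g).
Hypothesis thetaP : forall K f, adm K f -> adm (theta * K) (T f).
Hypothesis (eps0 : 0 <= eps) (eps1 : eps * theta <= 1 / 2).

Let mD : measurable D := measurable_dom D1.
Let mB : measurable (boundary D) := measurable_boundary D1.

Definition avg (nu : P -> {measure set P -> \bar R}) (f : P -> R) (z : P) : R :=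
  \int[nu z]_(x in boundary D) f x.

Lemma smooth_data_adm H : C2 setT H -> C1 setT (lap H) ->
  exists A : R, adm A (fun x => H x - Gop (lap H) x).
Proof.
move=> cH cl.
have bd v : (forall x, {for x, continuous v}) -> exists K : R, adm K v.
  move=> cv; have [K [_ HK]] := cont_bounded D1 (continuous_subspaceT cv).
  exists K; split; first by apply: contT_measurable.
  by move=> x Dx; apply: HK; exact: dom_closure.
have [K aK] := bd H (fun x => C1_cont (C2_C1 cH) (x := x) I).
have [K' aK'] := bd (lap H) (fun x => C1_cont cl (x := x) I).
have [C [C0 HC]] := Gop_bound D1 gG mu0D.
have aG : adm (C * K') (Gop (lap H)).
  split; last by move=> z Dz; exact: HC.
  by apply: (C1_measurable D1); exact: (Gop_C1 D1 gG mu0D aK').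
exists (K + `|-1| * (C * K')); rewrite (_ : (fun x => _) = (fun x => H x + (-1) * Gop (lap H) x)).
  exact: admD aK (admZ (-1) aG).
by apply/funext => x; rewrite mulN1r.
Qed.

(** [neumann_classical] is applied twice, with [eps] and with 0. The defining property of the
    measures turns both classical solutions into integrals of [H], and for 0 the fixed point reduces
    to [H - Gop (lap H)]. *)
Lemma smooth_data H A : C2 setT H -> C1 setT (lap H) -> adm A (fun x => H x - Gop (lap H) x) ->
  exists psi : P -> R, [/\ adm (2 * A) psi,
    forall z, D z -> (\int[mue z]_(x in boundary D) (H x)%:E)%E = (psi z)%:E,
    forall z, D z -> (\int[mu0 z]_(x in boundary D) (H x)%:E)%E = (H z - Gop (lap H) z)%:E &
    forall z, D z -> psi z = (H z - Gop (lap H) z) + eps * T psi z].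
Proof.
move=> cH cl aA.
have cH' : continuous H by move=> x; exact: (C1_cont (C2_C1 cH) (x := x) I).
have [psi [Psi [apsi psiE PsiC PsiE]]] := neumann_classical D1 gG mu0D su thetaP eps0 eps1 cH cl aA.
have z1 : 0 * theta <= 1 / 2 by rewrite mul0r divr_ge0.
have [psi' [Psi' [_ psiE' PsiC' PsiE']]] := neumann_classical D1 gG mu0D su thetaP (lexx 0) z1 cH cl aA.
exists psi; split => // z Dz.
  by have [_ h] := mueD Dz; rewrite (h H Psi cH' PsiC) PsiE.
have [_ h] := mu0D Dz; rewrite (h H Psi' cH' PsiC') PsiE'// psiE'//.
by rewrite mul0r addr0.
Qed.

(** The datum 1 has zero Laplacian, so [A = 1]; the fixed point bound [2 A] becomes a bound of all
    masses, uniform in [z], on which the limits below rest. *)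
Lemma avg_one : exists psi : P -> R, [/\ adm 2 psi,
    forall z, D z -> mue z (boundary D) = (psi z)%:E,
    forall z, D z -> mu0 z (boundary D) = 1%E &
    forall z, D z -> psi z = 1 + eps * T psi z].
Proof.
have [c2 l2] := C2_cst (1 : R) (@openT P).
have lE : lap (fun=> 1 : R) = (fun=> 0) :> (P -> R) by apply/funext => x; exact: l2.
have [cl _] := C1_cst (0 : R) (@openT P); rewrite -lE in cl.
have G0 z : Gop (lap (fun=> 1)) z = 0.
  rewrite lE /Gop (@eq_Rintegral _ _ _ _ _ (fun=> 0)); first by rewrite Rintegral_cst ?mul0r.
  by move=> y _; rewrite mul0r.
have a1 : adm 1 (fun x => 1 - Gop (lap (fun=> 1)) x).
  rewrite (_ : (fun x => _) = fun=> 1); last by apply/funext => x; rewrite G0 subr0.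
  by split => [|w _]; [exact: measurable_cst|rewrite normr1].
have [psi [apsi h1 h2 h3]] := smooth_data c2 cl a1.
exists psi; split.
- by rewrite mulr1 in apsi.
- by move=> z Dz; have := h1 z Dz; rewrite integral_cst ?mul1e.
- by move=> z Dz; have := h2 z Dz; rewrite integral_cst ?mul1e// G0 subr0.
- by move=> z Dz; rewrite h3// G0 subr0.
Qed.

Lemma mass_le z : D z -> (mue z (boundary D) <= 2%:E)%E /\ (mu0 z (boundary D) <= 2%:E)%E.
Proof.
move=> Dz; have [psi [[_ apsi] h1 h2 _]] := avg_one.
rewrite h1// h2// !lee_fin ler1n; split => //.
exact: le_trans (ler_norm _) (apsi z Dz).
Qed.

Let fin_e z : D z -> (mue z (boundary D) < +oo)%E.
Proof. by move=> Dz; have [h _] := mass_le Dz; apply: le_lt_trans h _; rewrite ltry. Qed.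
Let fin_0 z : D z -> (mu0 z (boundary D) < +oo)%E.
Proof. by move=> Dz; have [_ h] := mass_le Dz; apply: le_lt_trans h _; rewrite ltry. Qed.

Definition bdata (K : R) (f : P -> R) : Prop :=
  [/\ 0 <= K, measurable_fun (boundary D) f & forall x, boundary D x -> `|f x| <= K].

Lemma avg_bound (nu : P -> {measure set P -> \bar R}) K f z : (nu z (boundary D) <= 2%:E)%E -> bdata K f -> `|avg nu f z| <= 2 * K.
Proof.
move=> n2 [K0 mf fK]; have nf : (nu z (boundary D) < +oo)%E by apply: le_lt_trans n2 _; rewrite ltry.
apply: (le_trans (Rbounded_le mB nf mf fK)); rewrite mulrC ler_wpM2r//.
by rewrite -lee_fin fineK// ge0_fin_numE.
Qed.

(** Measurability of both averages belongs to the predicate: [T] needs it, and with measures chosen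
    point by point it can only be inherited along the approximation. *)
Definition duhamel f : Prop :=
  [/\ exists K, bdata K f, measurable_fun D (avg mu0 f), measurable_fun D (avg mue f) &
    forall z, D z -> avg mue f z = avg mu0 f z + eps * T (avg mue f) z].

Lemma avg_adm K f : bdata K f -> measurable_fun D (avg mue f) -> adm (2 * K) (avg mue f).
Proof. by move=> bf mf; split => // w Dw; apply: avg_bound => //; have [] := mass_le Dw. Qed.

Lemma bdata_int (nu : P -> {measure set P -> \bar R}) K f z : (nu z (boundary D) < +oo)%E -> bdata K f ->
  (nu z).-integrable (boundary D) (EFin \o f).
Proof. by move=> nf [_ mf fK]; exact: (Rbounded_integrable mB nf mf fK). Qed.

Lemma duhamel_lin c f f' : duhamel f -> duhamel f' -> duhamel (fun x => c * f x + f' x).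
Proof.
move=> [[K [K0 mf fK]] m0 me E] [[K' [K'0 mf' fK']] m0' me' E'].
have bf : bdata K f by []. have bf' : bdata K' f' by [].
have AL (nu : P -> {measure set P -> \bar R}) : (forall z, D z -> (nu z (boundary D) < +oo)%E) ->
    forall z, D z -> c * avg nu f z + avg nu f' z = avg nu (fun x => c * f x + f' x) z.
  move=> nf z Dz; have i1 := bdata_int (nf z Dz) bf.
  rewrite /avg (RintegralD mB (RintegrableZ c mB i1) (bdata_int (nf z Dz) bf')).
  by rewrite (RintegralZl c mB i1).
have A0 := AL mu0 fin_0; have Ae := AL mue fin_e.
split.
- exists (`|c| * K + K'); split; [by rewrite addr_ge0// mulr_ge0| |].
    by apply: measurable_funD => //; exact: measurable_funM.
  move=> x bx; apply: (le_trans (ler_normD _ _)); rewrite normrM lerD ?fK'//.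
  by rewrite ler_wpM2l// fK.
- apply: (eq_measurable_fun (fun z => c * avg mu0 f z + avg mu0 f' z)).
    by move=> z; rewrite inE => Dz; exact: A0.
  by apply: measurable_funD => //; exact: measurable_funM.
- apply: (eq_measurable_fun (fun z => c * avg mue f z + avg mue f' z)).
    by move=> z; rewrite inE => Dz; exact: Ae.
  by apply: measurable_funD => //; exact: measurable_funM.
have af := avg_adm bf me; have af' := avg_adm bf' me'.
move=> z Dz; rewrite -(A0 z Dz) -(Ae z Dz) -(TopS (f := fun z => c * avg mue f z + avg mue f' z) u g z Ae).
rewrite (TopD D1 gG mu0D su Dz (admZ c af) af') (TopZ D1 gG mu0D su c Dz af) (E z Dz) (E' z Dz); ring.
Qed.

Lemma duhamel_ext f f' : (forall x, boundary D x -> f x = f' x) -> duhamel f -> duhamel f'.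
Proof.
move=> E [[K [K0 mf fK]] m0 me H].
have AE (nu : P -> {measure set P -> \bar R}) : avg nu f = avg nu f'.
  by apply/funext => z; apply: eq_Rintegral => x; rewrite inE => bx; exact: E.
rewrite /duhamel -!AE; split => //; exists K; split => //.
  by apply: (eq_measurable_fun f) => // x; rewrite inE => bx; exact: E.
by move=> x bx; rewrite -E//; exact: fK.
Qed.

(** Dominated convergence twice: against each measure on the boundary, then under [T], where the
    averages are bounded by [2 * K]. *)
Lemma duhamel_lim K (f : nat -> P -> R) l : 0 <= K -> (forall n, duhamel (f n)) ->
  (forall n x, boundary D x -> `|f n x| <= K) ->
  (forall x, boundary D x -> f n x @[n --> \oo] --> l x) -> duhamel l.
Proof.
move=> K0 df fK fl.
have bf n : bdata K (f n) by have [[K' [_ mf _]] _ _ _] := df n; split => // x; exact: fK.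
have ml : measurable_fun (boundary D) l.
  by apply: (@measurable_fun_cvg _ _ _ (boundary D) f l) => // n; have [] := bf n.
have AC (nu : P -> {measure set P -> \bar R}) : (forall z, D z -> (nu z (boundary D) < +oo)%E) ->
    forall z, D z -> avg nu (f n) z @[n --> \oo] --> avg nu l z.
  move=> nf z Dz; apply: (proj2 (@Rdct _ _ _ (nu z) (boundary D) f l (cst K) mB _ fl _ _)).
  - by move=> n; have [] := bf n.
  - have := @bdata_int nu K (cst K) z (nf z Dz); apply; split => // x _.
    by rewrite ger0_norm.
  - exact: fK.
have A0 := AC mu0 fin_0; have Ae := AC mue fin_e.
have lK : bdata K l.
  split => // x bx; have h : `|f n x| @[n --> \oo] --> `|l x| by apply: cvg_norm; exact: fl.
  rewrite -(cvg_lim _ h)//; apply: limr_le; first by apply/cvg_ex; eexists; exact: h.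
  by apply: nearW => n; exact: fK.
have mel : measurable_fun D (avg mue l).
  by apply: (@measurable_fun_cvg _ _ _ D (fun n => avg mue (f n)) (avg mue l)) => // n; have [] := df n.
split => //.
- by exists K.
- by apply: (@measurable_fun_cvg _ _ _ D (fun n => avg mu0 (f n)) (avg mu0 l)) => // n; have [] := df n.
move=> z Dz.
have ae n : adm (2 * K) (avg mue (f n)) by apply: avg_adm => //; have [] := df n.
have h : avg mue (f n) z @[n --> \oo] --> avg mu0 l z + eps * T (avg mue l) z.
  have E n : avg mue (f n) z = avg mu0 (f n) z + eps * T (avg mue (f n)) z.
    by have [_ _ _ k] := df n; exact: k.
  rewrite (eq_cvg _ _ E); apply: cvgD; first exact: A0.
  apply: cvgM; first exact: cvg_cst.
  exact: (Top_cvg D1 gG mu0D su Dz ae (avg_adm lK mel) Ae).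
by rewrite -(cvg_lim _ (Ae z Dz))// -(cvg_lim _ h).
Qed.

Lemma duhamel_smooth H K : diffn 3 H -> bdata K H -> duhamel H.
Proof.
move=> sH bH; have cH := diffn_C2 (diffnW sH); have cl := diffn_lap sH.
have [A aA] := smooth_data_adm cH cl.
have [psi [apsi h1 h2 h3]] := smooth_data cH cl aA.
have E1 z : D z -> psi z = avg mue H z by move=> Dz; rewrite /avg /Rintegral h1.
have E2 z : D z -> H z - Gop (lap H) z = avg mu0 H z by move=> Dz; rewrite /avg /Rintegral h2.
split; first by exists K.
- apply: (eq_measurable_fun (fun z => H z - Gop (lap H) z)); last by have [] := aA.
  by move=> z; rewrite inE => Dz; exact: E2.
- apply: (eq_measurable_fun psi); last by have [] := apsi.
  by move=> z; rewrite inE => Dz; exact: E1.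
- by move=> z Dz; rewrite -(E1 z Dz) -(E2 z Dz) -(TopS u g z E1); exact: h3.
Qed.

Lemma duhamel_cst c : duhamel (fun=> c).
Proof. by apply: (@duhamel_smooth _ `|c|); [exact: diffn_cst|split]. Qed.

Lemma duhamel_corner a b : duhamel (\1_(corner a b)).
Proof.
have h01 n x : `|corner_step n a b x| <= 1.
  by have /andP[h0 h1] := corner_step_01 n a b x; rewrite ger0_norm.
apply: (@duhamel_lim 1 (fun n => corner_step n a b)) => //.
- move=> n; have s3 := corner_step_diffn n a b 3; apply: (duhamel_smooth s3 (K := 1)).
  split => //; apply: contT_measurable => x.
  by have [c _] := s3; exact: (C1_cont c (x := x) I).
- by move=> x _; exact: corner_step_cvg.
Qed.

Lemma duhamel_sum n (f : nat -> P -> R) : (forall k, duhamel (f k)) ->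
  duhamel (fun x => \sum_(k < n) f k x).
Proof.
move=> df; elim: n => [|n IH].
  by have := duhamel_cst 0; congr duhamel; apply/funext => x; rewrite big_ord0.
have := duhamel_lin 1 (df n) IH; congr duhamel.
by apply/funext => x; rewrite big_ord_recr mul1r addrC.
Qed.

Lemma duhamel_set A : measurable A -> duhamel (\1_A).
Proof.
rewrite measurable_corners => mA.
apply: (dynkin_induction (P := fun A => duhamel (\1_A)) measurable_corners setI_corners _ _ _ _ mA).
- by have := duhamel_cst 1; congr duhamel; apply/funext => x; rewrite indicT.
- by move=> _ [c _ <-]; exact: duhamel_corner.
- move=> S _ dS; have := duhamel_lin (-1) dS (duhamel_cst 1); congr duhamel.
  apply/funext => x; rewrite !indicE in_setC; case: (x \in S) => /=; ring.
(* Disjointness makes the partial sums indicators of finite unions, hence bounded by 1 as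
   [duhamel_lim] requires. *)
- move=> F mF tF dF.
  have sE n x : \sum_(k < n) (\1_(F k) x : R) = \1_(\bigcup_(k < n) F k) x.
    elim: n => [|n IH]; first by rewrite big_ord0 bigcup_mkord big_ord0 indic0.
    rewrite big_ord_recr /= IH !indicE !bigcup_mkord big_ord_recr/= in_setU.
    case: (boolP (x \in F n)) => [xn|_]; last by rewrite orbF addr0.
    rewrite orbT (_ : x \in _ = false) ?add0r//; apply/negbTE/negP.
    rewrite inE -bigcup_mkord => -[k /= kn Fkx]; rewrite inE in xn.
    have := tF k n I I; move=> /(_ (ex_intro _ x (conj Fkx xn))) E.
    by rewrite E ltnn in kn.
  apply: (@duhamel_lim 1 (fun n x => \sum_(k < n) (\1_(F k) x : R))) => //.
  + by move=> n; exact: (@duhamel_sum n (fun k => \1_(F k)) dF).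
  + by move=> n x _; rewrite sE indicE; case: (_ \in _); rewrite ?normr1 ?normr0.
  move=> x _; have [[j _ Fjx]|nF] := pselect ((\bigcup_k F k) x).
    rewrite indicE mem_set; last by exists j.
    have E : \forall n \near \oo, (1 : R) = \sum_(k < n) \1_(F k) x.
      near=> n; rewrite sE indicE mem_set//; exists j => //=.
      by near: n; exact: nbhs_infty_gt.
    by apply: cvg_trans (near_eq_cvg E) _; exact: cvg_cst.
  rewrite indicE memNset//.
  have E n : \sum_(k < n) (\1_(F k) x : R) = 0.
    by rewrite sE indicE memNset// => -[k _ Fkx]; apply: nF; exists k.
  by rewrite (eq_cvg _ _ E); exact: cvg_cst.
Unshelve. all: by end_near. Qed.

Lemma duhamel_01 (f : P -> R) : measurable_fun (boundary D) f ->
  (forall x, boundary D x -> 0 <= f x <= 1) -> duhamel f.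
Proof.
move=> mf f01.
(* The superlevel sets behind [staircase n (f x)], cut down to the boundary, on which [f] is
   measurable. *)
pose X (n k : nat) : set P := boundary D `&` f @^-1` `[k.+1%:R / n.+1%:R, +oo[%classic.
have mX n k : measurable (X n k) by apply: mf => //; exact: measurable_itv.
have XE n k x : boundary D x -> (\1_(X n k) x : R) = (k.+1%:R <= n.+1%:R * f x)%R%:R.
  move=> bx; rewrite indicE; congr ((nat_of_bool _)%:R).
  rewrite mulrC -ler_pdivrMr//; apply/idP/idP.
    by rewrite inE /X /= in_itv/= andbT => -[].
  by move=> h; rewrite inE /X /= in_itv/= andbT.
have SE n x : boundary D x -> \sum_(k < n.+1) (n.+1%:R^-1 * \1_(X n k) x) = staircase n (f x).
  by move=> bx; apply: eq_bigr => k _; rewrite XE.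
apply: (@duhamel_lim 1 (fun n x => \sum_(k < n.+1) (n.+1%:R^-1 * \1_(X n k) x))) => //.
- move=> n; apply: (@duhamel_sum n.+1 (fun k x => n.+1%:R^-1 * \1_(X n k) x)) => k.
  by have := duhamel_lin n.+1%:R^-1 (duhamel_set (mX n k)) (duhamel_cst 0); congr duhamel;
    apply/funext => x; rewrite addr0.
- move=> n x bx; rewrite SE// ger0_norm; last first.
    by rewrite /staircase sumr_ge0// => k _; rewrite mulr_ge0.
  have /andP[h _] := staircase_near n (f01 x bx); have /andP[_ h2] := f01 x bx; lra.
- move=> x bx; apply/cvgrPdist_le => e e0; near=> n; rewrite SE//.
  have /andP[h h2] := staircase_near n (f01 x bx); rewrite ger0_norm//.
  apply: (le_trans h2); near: n.
  have := near_infty_natSinv_lt (PosNum e0); apply: filterS => n; exact: ltW.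
Unshelve. all: by end_near. Qed.

Lemma duhamel_bounded K f : bdata K f -> duhamel f.
Proof.
(* An affine change maps [[- M, M]] onto [[0, 1]]; the [+ 1] keeps it invertible when [K = 0]. *)
move=> [K0 mf fK]; pose M := K + 1; have M0 : 0 < M by rewrite /M; lra.
have h : duhamel (fun x => (2 * M)^-1 * (f x + M)).
  apply: duhamel_01; first by apply: measurable_funM => //; exact: measurable_funD.
  move=> x bx; have := fK x bx; rewrite ler_norml => /andP[h1 h2].
  rewrite mulrC divr_ge0/= ?ler_pdivrMr ?mulr_gt0//; rewrite /M; lra.
apply: (duhamel_ext _ (duhamel_lin (2 * M) h (duhamel_cst (- M)))) => x _.
by field; rewrite gt_eqF.
Qed.

End Duhamel.

(** * The Neumann series, its remainder and the conclusion *)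

Section Expansion.
Context {R : realType}.
Local Notation P := (R * R)%type.
Variables (D : set P) (u : P -> R) (g : P -> P -> R).
Variable mu : P -> {measure set P -> \bar R}.
Hypothesis D1 : C1_domain D.
Hypothesis gG : green_function D g.
Hypothesis su : smooth_on_closure D u.
Hypothesis muD : forall z, D z -> dirichlet_measure D u 0 z (mu z).
Local Notation adm := (adm D).
Local Notation T := (Top D u g).
Variables (theta eps K : R) (phi0 phi : P -> R).
Hypothesis thetaP : forall K f, adm K f -> adm (theta * K) (T f).
Hypothesis (a0 : adm K phi0) (a1 : adm K phi).
Hypothesis phiE : forall z, D z -> phi z = phi0 z + eps * T phi z.

Lemma iter_Top_adm n f : adm K f -> adm (theta ^+ n * K) (iter n T f).
Proof.
move=> af; elim: n => [|n IH]; first by rewrite expr0 mul1r.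
by rewrite exprS -mulrA; exact: thetaP.
Qed.

Lemma iter_Top_duhamel n z : D z ->
  iter n T phi z = iter n T phi0 z + eps * iter n.+1 T phi z.
Proof.
elim: n z => [|n IH] z Dz; first exact: phiE.
transitivity (T (fun x => iter n T phi0 x + eps * iter n.+1 T phi x) z); first exact: TopS.
rewrite (TopD D1 gG muD su Dz (iter_Top_adm n a0) (admZ eps (iter_Top_adm n.+1 a1))).
by rewrite (TopZ D1 gG muD su eps Dz (iter_Top_adm n.+1 a1)).
Qed.

Lemma neumann_remainder n z : D z ->
  phi z - \sum_(k < n) eps ^+ k * iter k T phi0 z = eps ^+ n * iter n T phi z.
Proof.
move=> Dz; elim: n => [|n IH]; first by rewrite big_ord0 subr0 expr0 mul1r.
rewrite big_ord_recr /= opprD addrA IH (iter_Top_duhamel n Dz) exprS /=; ring.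
Qed.

Lemma neumann_remainder_le n z : D z -> 0 <= eps ->
  `|phi z - \sum_(k < n) eps ^+ k * iter k T phi0 z| <= (eps * theta) ^+ n * K.
Proof.
move=> Dz e0; rewrite (neumann_remainder n Dz) normrM ger0_norm ?exprn_ge0//.
by rewrite exprMn -mulrA ler_wpM2l ?exprn_ge0//; have [_ h] := iter_Top_adm n a1; exact: h.
Qed.

End Expansion.

Lemma dirichlet_choice (R : realType) (D : set (R * R)) (u f phi : R * R -> R) (eps : R) : D !=set0 ->
  dirichlet_solution D u eps f phi -> exists mu : R * R -> {measure set (R * R) -> \bar R},
    forall z, D z -> dirichlet_measure D u eps z (mu z) /\ phi z = avg D mu f z.
Proof.
move=> [z0 Dz0] sol.
have /choice[mu muP] : forall z, exists m : {measure set (R * R) -> \bar R}, D z ->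
    dirichlet_measure D u eps z m /\ phi z = Rintegral m (boundary D) f.
  move=> z; have [Dz|nD] := pselect (D z).
    by have [m h] := sol z Dz; exists m.
  (* Off [D] any measure will do, and the point [z0] supplies one. *)
  by have [m h] := sol z0 Dz0; exists m.
by exists mu.
Qed.

Theorem theorem3 (R : realType) (D : set (R * R)) (u : R * R -> R)
    (g : R * R -> R * R -> R) (f : R * R -> R) (phi : R -> R * R -> R) :
  C1_domain D ->
  smooth_on_closure D u ->
  (forall x, closure D x -> 0 < u x) ->
  green_function D g ->
  measurable_fun (boundary D) f ->
  (exists M : R, forall x, boundary D x -> `|f x| <= M) ->
  (forall eps : R, 0 <= eps -> dirichlet_solution D u eps f (phi eps)) ->
  (* first order expansion, with error o(eps) uniformly in z *)
  (forall e : R, 0 < e -> exists delta : R, 0 < delta /\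
     forall eps : R, 0 < eps < delta -> forall z, D z ->
       `|phi eps z - (phi 0 z + eps * Top D u g (phi 0) z)| <= e * eps) /\
  (* full series expansion, valid for small eps *)
  (exists eps0 : R, 0 < eps0 /\
     forall eps : R, 0 <= eps < eps0 -> forall z, D z ->
       (fun N : nat => \sum_(n < N) eps ^+ n * iter n (Top D u g) (phi 0) z)
         @ \oo --> phi eps z).
Proof.
move=> D1 su _ gG mf [M0 fM0] sol.
have D0 : D !=set0 by have [_ [_ []]] := D1.
have [mu0 mu0P] := dirichlet_choice D0 (sol 0 (lexx 0)).
have mu0D z : D z -> dirichlet_measure D u 0 z (mu0 z) by move=> /mu0P[].
have [theta [theta0 thetaP]] := Top_adm D1 gG mu0D su.
pose M := Num.max 0 M0.
have bf : bdata D M f.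
  split=> //; first by rewrite le_max lexx.
  by move=> x bx; rewrite le_max fM0 ?orbT.
have M_ge0 : 0 <= M by have [] := bf.
have key eps : 0 <= eps -> eps * theta <= 1 / 2 ->
    [/\ adm D (2 * M) (phi eps), adm D (2 * M) (phi 0) &
     forall z, D z -> phi eps z = phi 0 z + eps * Top D u g (phi eps) z].
  move=> e0 e1; have [mu muP] := dirichlet_choice D0 (sol eps e0).
  have muD z : D z -> dirichlet_measure D u eps z (mu z) by move=> /muP[].
  have E0 z : D z -> avg D mu0 f z = phi 0 z by move=> /mu0P[_ ->].
  have E1 z : D z -> avg D mu f z = phi eps z by move=> /muP[_ ->].
  have [_ m0 m1 E] := duhamel_bounded D1 gG su mu0D muD thetaP e0 e1 bf.
  have ml z (Dz : D z) := mass_le D1 gG su mu0D muD thetaP e0 e1 Dz.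
  split.
  - split; first by apply: (eq_measurable_fun (avg D mu f)) m1 => z; rewrite inE => /E1.
    by move=> z Dz; rewrite -E1//; apply: (avg_bound D1) bf; have [] := ml z Dz.
  - split; first by apply: (eq_measurable_fun (avg D mu0 f)) m0 => z; rewrite inE => /E0.
    by move=> z Dz; rewrite -E0//; apply: (avg_bound D1) bf; have [] := ml z Dz.
  - by move=> z Dz; rewrite -(E0 z Dz) -(E1 z Dz) -(TopS u g z E1); exact: E.
(* The threshold below which [eps * theta <= 1/2], hence at which [key] applies. *)
pose eps0 : R := 1 / (2 * theta).
have eps00 : 0 < eps0 by rewrite divr_gt0// mulr_gt0.
have small eps : eps < eps0 -> eps * theta <= 1 / 2.
  move=> h; apply: (@le_trans _ _ (eps0 * theta)); first by rewrite ler_pM2r// ltW.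
  by rewrite le_eqVlt; apply/orP; left; apply/eqP; rewrite /eps0; field; rewrite gt_eqF.
split.
  (* The remainder after two terms is at most [(eps * theta)^2 * (2 * M) <= eps^2 * C], and
     [eps < e / C] makes this at most [e * eps], for all [z] at once. *)
  move=> e e0; pose C := theta ^+ 2 * (2 * M) + 1.
  have C0 : 0 < C by rewrite ltr_wpDl// mulr_ge0 ?sqr_ge0// mulr_ge0.
  exists (Num.min eps0 (e / C)); split; first by rewrite lt_min eps00 divr_gt0.
  move=> eps /andP[ep]; rewrite lt_min => /andP[ep0 epC] z Dz.
  have [a1 a0 E] := key eps (ltW ep) (small eps ep0).
  have := neumann_remainder_le D1 gG su mu0D thetaP a0 a1 E 2 Dz (ltW ep).
  rewrite !big_ord_recr big_ord0 /= add0r expr0 mul1r expr1 => /le_trans; apply.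
  have h : eps * C <= e by move: epC; rewrite ltr_pdivlMr// => /ltW.
  apply: (@le_trans _ _ (eps * (eps * C))); last by rewrite [leRHS]mulrC ler_pM2l.
  rewrite (_ : _ * (2 * M) = eps * (eps * (theta ^+ 2 * (2 * M)))); last by ring.
  by rewrite !ler_pM2l// /C lerDl.
exists eps0; split => // eps /andP[ep0 ep] z Dz.
have h := small eps ep.
have [a1 a0 E] := key eps ep0 h.
have q0 : 0 <= eps * theta by rewrite mulr_ge0// ltW.
apply/cvgrPdist_le => e e0.
have c0 : (eps * theta) ^+ n * (2 * M) @[n --> \oo] --> 0.
  rewrite -(mul0r (2 * M)); apply: cvgM; last exact: cvg_cst.
  by apply: cvg_expr; rewrite ger0_norm//; lra.
have /cvgrPdist_le/(_ e e0) := c0; apply: filterS => n.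
rewrite sub0r normrN ger0_norm; last by rewrite mulr_ge0 ?exprn_ge0// mulr_ge0.
by apply: le_trans; exact: (neumann_remainder_le D1 gG su mu0D thetaP a0 a1 E n Dz ep0).
Qed.
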